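(* Let $\alpha>0$ and let $c:\Omega_1\times\Omega_2\to\mathbb R$ be $c(\gamma,\xi)=\int_0^1\frac12|\dot\gamma|^2-\frac12|\dot\xi|^2+\alpha|\gamma-\xi|^2\,dt$. Let $\sigma_0:\mathcal P(\Omega_1)\times\mathcal P(\Omega_2)\to\mathbb R$ be the bilinear functional $\sigma_0(\pi_1,\pi_2)=\iint c(\gamma,\xi)\,d\pi_1(\gamma)\,d\pi_2(\xi)$. Then there exists a Nash Equilibrium Transport Plan $(\pi_1^*,\pi_2^* )\in\Pi_{\text{path}}(\mu_1,\nu_1)\times\Pi_{\text{path}}(\mu_2,\nu_2)$ such that $$\sigma_0(\pi_1^*,\pi_2^* )=\inf_{\pi_1\in\Pi_{\text{path}}(\mu_1,\nu_1)}\ \sup_{\pi_2\in\Pi_{\text{path}}(\mu_2,\nu_2)}\sigma_0(\pi_1,\pi_2)=\sup_{\pi_2\in\Pi_{\text{path}}(\mu_2,\nu_2)}\ \inf_{\pi_1\in\Pi_{\text{path}}(\mu_1,\nu_1)}\sigma_0(\pi_1,\pi_2).$$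
   Context: $X,Y\subset\mathbb R^d$ are closed balls of radius $R>0$ centered at the origin. For fixed constants $K,L>0$, $\Omega_1=\{\gamma\in W^{1,2}([0,1];X):\int_0^1|\dot\gamma|^2dt\le K\}$ and $\Omega_2=\{\xi\in W^{1,2}([0,1];Y):\int_0^1|\dot\xi|^2dt\le L\}$. Each $\Omega_i$ carries the metric $\|\gamma-\eta\|_{\Omega_i}=\|\gamma-\eta\|_{L^\infty}+\|\dot\gamma-\dot\eta\|_{L^2}$. $\mu_1,\nu_1$ are probability measures on $X$ and $\mu_2,\nu_2$ are probability measures on $Y$. $e_t(\gamma)=\gamma(t)$, and $\Pi_{\text{path}}(\mu_i,\nu_i)=\{\pi_i\in\mathcal P(\Omega_i):(e_0)_\#\pi_i=\mu_i,\ (e_1)_\#\pi_i=\nu_i\}$. A Nash Equilibrium Transport Plan (NETP) is a pair solving both the minimax ($\inf_{\pi_1}\sup_{\pi_2}$) problem and the maximin ($\sup_{\pi_2}\inf_{\pi_1}$) problem for $\sigma_0$, i.e. an equilibrium: $\sigma_0(\pi_1^*,\pi_2)\le\sigma_0(\pi_1^*,\pi_2^* )\le\sigma_0(\pi_1,\pi_2^* )$ for all admissible $\pi_1,\pi_2$.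
   Formalization: The formal theorem assumes that both sets Π_path(μ_1,ν_1) and Π_path(μ_2,ν_2) are nonempty; without this the claim fails, e.g. for μ_1=δ_x, ν_1=δ_y with |x−y|²>K, where no admissible path, hence no plan, exists. *)

(* Defs.v *)
From HB Require Import structures.
From mathcomp Require Import all_boot all_order all_algebra.
From mathcomp Require Import all_classical all_reals all_analysis.

Set Implicit Arguments.
Unset Strict Implicit.
Unset Printing Implicit Defensive.

Import Order.TTheory GRing.Theory Num.Theory.
Import numFieldNormedType.Exports.

Local Open Scope classical_set_scope.
Local Open Scope ring_scope.

Section Euclidean.
Context {R : realType} {d : nat}.

(* The library norm on 'rV[R]_d is the sup norm; |.| is the Euclidean one. *)
Definition enorm (v : 'rV[R]_d) : R := Num.sqrt (\sum_(i < d) v ord0 i ^+ 2).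

Definition eball (r : R) : set 'rV[R]_d := [set v | enorm v <= r].

End Euclidean.

(* R^d with its Borel sigma-algebra (the sup norm and the Euclidean norm have
   the same open sets). *)
Definition euclidean (R : realType) (d : nat) :=
  g_sigma_algebraType (@open 'rV[R]_d).

HB.instance Definition _ (R : realType) (d : nat) :=
  Measurable.on (euclidean R d).

Section Sobolev.
Context {R : realType} {d : nat}.
Implicit Types (gamma eta g : R -> 'rV[R]_d) (phi : R -> R).

(* Test functions: C^1 with compact support in the open interval (0, 1). *)
Definition C1c_01 phi : Prop :=
  [/\ forall t : R, derivable phi t 1,
      continuous (derive1 phi) &
      exists a b : R, [/\ 0 < a, b < 1 & forall t, t \notin `[a, b] -> phi t = 0]].

Definition L2_01 g : Prop :=
  (forall i : 'I_d, measurable_fun `[(0 : R), 1] (fun t : R => g t ord0 i)) /\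
  lebesgue_measure.-integrable `[(0 : R), 1] (fun t : R => (enorm (g t) ^+ 2)%:E).

Definition weak_derivative gamma g : Prop :=
  L2_01 g /\
  forall phi, C1c_01 phi -> forall i : 'I_d,
    \int[lebesgue_measure]_(t in `[0, 1]) (gamma t ord0 i * derive1 phi t) =
    - \int[lebesgue_measure]_(t in `[0, 1]) (g t ord0 i * phi t).

(* An element of W^{1,2}([0,1]; R^d) is given by its continuous representative
   on [0, 1], so that gamma(t) makes sense for every t. It is extended by 0
   outside [0, 1] in order that equal paths be equal functions. *)
Definition W12 gamma : Prop :=
  [/\ {within `[0, 1], continuous gamma},
      forall t : R, t \notin `[0, 1] -> gamma t = 0 &
      exists g, weak_derivative gamma g].

(* The weak derivative is unique up to a null set; everything below only
   depends on its almost everywhere class. *)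
Definition velocity gamma : R -> 'rV[R]_d := get (weak_derivative gamma).

Definition energy g : R := \int[lebesgue_measure]_(t in `[0, 1]) enorm (g t) ^+ 2.

(* The energy bound is stated on some weak derivative, hence on all of them. *)
Definition path_set (r K : R) : set (R -> 'rV[R]_d) :=
  [set gamma | [/\ W12 gamma,
                   forall t : R, t \in `[0, 1] -> eball r (gamma t) &
                   exists2 g, weak_derivative gamma g & energy g <= K]].

Definition Lnorm_01 (p : \bar R) (g : R -> 'rV[R]_d) : \bar R :=
  'N[lebesgue_measure]_p[(fun t => (enorm (g t))%:E) \_ `[(0 : R)%R, 1%R]]%E.

Definition path_dist gamma eta : \bar R :=
  (Lnorm_01 +oo (gamma \- eta)%R +
   Lnorm_01 2%:E (velocity gamma \- velocity eta)%R)%E.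

Lemma enorm0 : enorm (0 : 'rV[R]_d) = 0.
Proof.
rewrite /enorm big1 ?sqrtr0// => i _.
by rewrite mxE expr0n.
Qed.

Lemma weak_derivative0 : weak_derivative (cst 0) (cst 0).
Proof.
split; first split.
- by move=> i; exact: measurable_cst.
- rewrite [X in integrable _ _ X](_ : _ = cst 0%E); first exact: integrable0.
  by apply/funext => t /=; rewrite enorm0 expr0n.
- move=> phi _ i.
  have e (h : R -> R) : \int[lebesgue_measure]_(t in `[0, 1])
      ((cst 0 t : 'rV[R]_d) ord0 i * h t) = 0.
    by under eq_Rintegral do rewrite /= mxE mul0r; rewrite Rintegral_cst//= mul0r.
  by rewrite !e oppr0.
Qed.

Lemma path_set0 (r K : R) : 0 <= r -> 0 <= K -> path_set r K (cst 0).
Proof.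
move=> r0 K0; split.
- split => //; first by move=> ?; exact: cst_continuous.
  by exists (cst 0); exact: weak_derivative0.
- by move=> t _; rewrite /eball/= enorm0.
- exists (cst 0); first exact: weak_derivative0.
  rewrite /energy; under eq_Rintegral do rewrite /= enorm0 expr0n.
  by rewrite Rintegral_cst//= mul0r.
Qed.

End Sobolev.

Section PathSpace.
Context (R : realType) (d : nat) (r K : {posnum R}).

Definition curve : Type := set_type (@path_set R d r%:num K%:num).

HB.instance Definition _ := Choice.on curve.

Definition curve0 : curve :=
  exist _ (cst 0) (mem_set (path_set0 (ltW (gt0 r)) (ltW (gt0 K)))).

HB.instance Definition _ := isPointed.Build curve curve0.

Definition path_open : set (set curve) :=
  [set U | forall gamma, U gamma -> exists2 e : R, 0 < e &
    forall eta : curve, (path_dist (val gamma) (val eta) < e%:E)%E -> U eta].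

(* The path space with the Borel sigma-algebra of its metric. *)
Definition Omega := g_sigma_algebraType path_open.

HB.instance Definition _ := Measurable.on Omega.

Definition eval_path (t : R) (gamma : Omega) : euclidean R d := val gamma t.

(* This set may be empty, for instance for two Dirac masses whose squared
   distance exceeds K. *)
Definition Pi_path (mu nu : probability (euclidean R d) R) :
    set (probability Omega R) :=
  [set pi | (forall A, measurable A -> pushforward pi (eval_path 0) A = mu A) /\
            (forall A, measurable A -> pushforward pi (eval_path 1) A = nu A)].

End PathSpace.

Arguments Pi_path {R d} r K mu nu.

Section Game.
Context {R : realType} {d : nat} {r K L : {posnum R}}.

Definition cost (alpha : R) (gamma : Omega d r K) (xi : Omega d r L) : R :=
  \int[lebesgue_measure]_(t in `[0, 1])
    (2^-1 * enorm (velocity (val gamma) t) ^+ 2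
     - 2^-1 * enorm (velocity (val xi) t) ^+ 2
     + alpha * enorm (val gamma t - val xi t) ^+ 2).

Definition sigma0 (alpha : R) (pi1 : probability (Omega d r K) R)
    (pi2 : probability (Omega d r L) R) : R :=
  \int[(pi1 \x pi2)%E]_z cost alpha z.1 z.2.

End Game.

Definition is_NETP {R : realType} {P1 P2 : Type} (sigma : P1 -> P2 -> R)
    (A1 : set P1) (A2 : set P2) (p1 : P1) (p2 : P2) : Prop :=
  [/\ A1 p1, A2 p2,
      forall q2, A2 q2 -> sigma p1 q2 <= sigma p1 p2 &
      forall q1, A1 q1 -> sigma p1 p2 <= sigma q1 p2].

(* Main.v *)
(** The payoff is affine in each plan, so a saddle point exists as soon as, for
    a suitable topology, each strategy set is compact and the payoff is
    semicontinuous in the right direction in each player's own plan.  By Fubini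
    sigma0 splits into half the mean kinetic energy of the first plan, minus half
    that of the second one, plus a term which is continuous for the sup
    distance on paths.  The kinetic energy is lower semicontinuous under uniform
    convergence, and this has the favourable sign for both players: the first
    one minimises his energy, the second one maximises minus his.  Plans are
    therefore tested against functions that are uniformly continuous for the sup
    distance, under which a path space is totally bounded (Hoelder) and
    complete (the energy bound survives uniform limits), so that every
    ultrafilter of plans has a weak limit.  That limit is a measure for the Borel
    sets of the finer W^{1,2} metric as well, because convergence in W^{1,2} is
    uniform convergence together with convergence of the energies. *)

From HB Require Import structures.
Require Import Defs.
From mathcomp Require Import all_boot all_order all_algebra.
From mathcomp Require Import all_classical all_reals all_analysis.
From mathcomp Require Import measurable_realfun ess_sup_inf ring lra.

Set Implicit Arguments.
Unset Strict Implicit.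
Unset Printing Implicit Defensive.

Import Order.TTheory GRing.Theory Num.Theory.
Import numFieldNormedType.Exports.

Local Open Scope classical_set_scope.
Local Open Scope ring_scope.

(** * Minimax under ultrafilter compactness *)

(** Plans are measures for the W^{1,2} metric, in which a path space of bounded energy need not be
    compact; for the uniform distance it is compact, but the payoff is no longer continuous; and the
    plans themselves carry no topology. Compactness is therefore phrased directly: an ultrafilter of
    plans containing the constraint set has a point of that set to which inequalities on the payoff
    pass. The limit plan does not come from a representation theorem. It is built as the law of a
    random path, so that the finer sigma-algebra raises a single question, the measurability of one
    map from the line into the path space. That is tested on countably many sets, given by a uniform
    ball and a rational bound on the energy; every strongly open set is a union of such sets. The
    minimax part uses no separation theorem either: two opponents are merged into a mixture by an
    argument on one real weight, and finitely many by induction. *)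

Section Minimax.
Context {R : realType} {P1 P2 : Type} (f : P1 -> P2 -> R).

(** The strategy types carry no convex structure, so convexity is expressed through the payoffs
    against [A2]. The set [X] is a parameter of its own because the induction over opponents
    replaces [A1] by smaller convex pieces. *)
Definition mixable1 (X : set P1) (A2 : set P2) := forall x x' (s : R),
  X x -> X x' -> 0 <= s <= 1 ->
  exists2 x'', X x'' & forall y, A2 y -> f x'' y = (1 - s) * f x y + s * f x' y.

Definition mixable2 (A1 : set P1) (Y : set P2) := forall y y' (s : R),
  Y y -> Y y' -> 0 <= s <= 1 ->
  exists2 y'', Y y'' & forall x, A1 x -> f x y'' = (1 - s) * f x y + s * f x y'.

(** Each [x] below [c] against [y] forces a least weight [l x] on [y']; each [x'] below [c] against
    [y'] forces a greatest one. A least weight above a greatest one would yield a mixture of [x] and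
    [x'] below [c] against both opponents. Hence all least weights lie below all greatest ones, and
    their supremum works. *)
Lemma two_alternatives (X : set P1) (A2 : set P2) (y y' : P2) (c : R) :
  mixable1 X A2 -> A2 y -> A2 y' -> (forall x, X x -> c <= f x y \/ c <= f x y') ->
  exists2 s : R, 0 <= s <= 1 & forall x, X x -> c <= (1 - s) * f x y + s * f x y'.
Proof.
move=> mX Ay Ay' alt.
pose l x := (c - f x y) / ((c - f x y) + (f x y' - c)).
pose S := [set l x | x in [set x | X x /\ f x y < c]].
have cross x x' : X x -> X x' -> f x y < c -> f x' y' < c ->
    (c - f x y) * (c - f x' y') <= (f x y' - c) * (f x' y - c).
  move=> Xx Xx' lx lx'.
  have hx : c <= f x y' by case: (alt x Xx) => // h; lra.
  have hx' : c <= f x' y by case: (alt x' Xx') => // h; lra.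
  rewrite leNgt; apply/negP => H.
  set a := c - f x y in H; set b := f x y' - c in H.
  set b' := c - f x' y' in H; set a' := f x' y - c in H.
  have a0 : 0 < a by rewrite /a; lra.
  have b0 : 0 <= b by rewrite /b; lra.
  have a'0 : 0 <= a' by rewrite /a'; lra.
  have b'0 : 0 < b' by rewrite /b'; lra.
  pose D := a + b + a' + b'.
  have D0 : 0 < D by rewrite /D; lra.
  (* the mediant weight lies strictly between the two critical ones *)
  have [|x'' Xx'' e] := mX x x' ((a + b) / D) Xx Xx'.
    by rewrite divr_ge0 ?ler_pdivrMr//= ?mul1r /D; lra.
  have e1 : f x'' y = c - (a * b' - b * a') / D.
    rewrite e// (_ : f x y = c - a); last by rewrite /a; lra.
    rewrite (_ : f x' y = c + a'); last by rewrite /a'; lra.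
    by rewrite /D; field; rewrite -/D gt_eqF.
  have e2 : f x'' y' = c - (a * b' - b * a') / D.
    rewrite e// (_ : f x y' = c + b); last by rewrite /b; lra.
    rewrite (_ : f x' y' = c - b'); last by rewrite /b'; lra.
    by rewrite /D; field; rewrite -/D gt_eqF.
  have p0 : 0 < (a * b' - b * a') / D by rewrite divr_gt0//; lra.
  by case: (alt _ Xx''); rewrite ?e1 ?e2; lra.
have lb x : X x -> f x y < c -> 0 <= l x <= 1.
  move=> Xx lx; have hx : c <= f x y' by case: (alt x Xx) => // h; lra.
  by rewrite /l divr_ge0 ?ler_pdivrMr//= ?mul1r; lra.
have [S0|/set0P/negP/negPn/eqP S0] := pselect (S !=set0); last first.
  exists 0; first by rewrite lexx ler01.
  move=> x Xx; rewrite subr0 mul1r mul0r addr0 leNgt; apply/negP => h.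
  have Sx : S (l x) by exists x.
  by rewrite S0 in Sx.
have bS : has_sup S.
  by split => //; exists 1 => _ [x [Xx lx] <-]; case/andP: (lb x Xx lx).
have /andP[s0 s1] : 0 <= sup S <= 1.
  move: (S0) => [_ [x [Xx lx] _]]; apply/andP; split.
    apply: (@le_trans _ _ (l x)); first by case/andP: (lb x Xx lx).
    by apply: ub_le_sup; [case: bS|exists x].
  by apply: ge_sup => // _ [z [Xz lz] <-]; case/andP: (lb z Xz lz).
exists (sup S); first by rewrite s0 s1.
move=> x Xx; have [lx|gx] := ltP (f x y) c.
  have hx : c <= f x y' by case: (alt x Xx) => // h; lra.
  have : l x <= sup S by apply: ub_le_sup; [case: bS|exists x].
  rewrite /l ler_pdivrMr; last lra.
  lra.
have [lx'|gx'] := ltP (f x y') c; last by nra.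
(* The right-hand side is the greatest weight that [x] allows; this is where [cross] enters. *)
have : sup S <= (f x y - c) / ((f x y - c) + (c - f x y')).
  apply: ge_sup => // _ [z [Xz lz] <-].
  have hz : c <= f z y' by case: (alt z Xz) => // h; lra.
  have := cross z x Xz Xx lz lx'; rewrite /l.
  rewrite ler_pdivrMr; last lra.
  rewrite mulrAC ler_pdivlMr; last lra.
  lra.
rewrite ler_pdivlMr; last lra.
lra.
Qed.

(** On the part of [X] where the last opponent fails, the earlier ones suffice and by induction are
    replaced by a single [y]; then [y] and the last one are two alternatives on all of [X]. That
    part is again mixable because the payoff is affine along mixtures. *)
Lemma finite_alternatives (A1 : set P1) (A2 : set P2) (c : R) n :
  mixable2 A1 A2 -> A2 !=set0 ->
  forall (X : set P1) (ys : nat -> P2), X `<=` A1 -> mixable1 X A2 ->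
  (forall i, A2 (ys i)) ->
  (forall x, X x -> exists2 i, (i < n)%N & c <= f x (ys i)) ->
  exists2 y, A2 y & forall x, X x -> c <= f x y.
Proof.
move=> mA2 [y0 Ay0]; elim: n => [|n IH] X ys XA mX Ays alt.
  by exists y0 => // x /alt[].
have [|||y Ay hy] := IH (X `&` [set x | f x (ys n) < c]) ys _ _ Ays.
- by move=> x [/XA].
- move=> x x' s [Xx lx] [Xx' lx'] s01; have [x'' Xx'' e] := mX x x' s Xx Xx' s01.
  exists x'' => //; split => //=; rewrite e//.
  have [->|s1] := eqVneq s 1; first by rewrite subrr mul0r mul1r add0r.
  have : s < 1 by rewrite lt_neqAle s1; case/andP: s01.
  by case/andP: s01; rewrite /= in lx lx'; nra.
- move=> x [/alt[i +]] /= h1 h2; rewrite ltnS leq_eqVlt => /orP[/eqP ei|ii].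
    by subst i; move: h1; rewrite leNgt h2.
  by exists i.
have [|s s01 hs] := @two_alternatives X A2 (ys n) y c mX (Ays n) Ay.
  by move=> x Xx; have [lx|] := ltP (f x (ys n)) c; [right; apply: hy|left].
have [y'' Ay'' e] := mA2 (ys n) y s (Ays n) Ay s01.
by exists y'' => // x Xx; rewrite e ?hs//; exact: XA.
Qed.

(* Sequential compactness would not do here, since the finite families of
   opponents to be met form an uncountable directed set. *)
Theorem saddle_point (A1 : set P1) (A2 : set P2) (M : R) :
  A1 !=set0 -> A2 !=set0 -> mixable1 A1 A2 -> mixable2 A1 A2 ->
  (forall x y, A1 x -> A2 y -> `|f x y| <= M) ->
  (forall U : set_system P1, UltraFilter U -> U A1 ->
    exists2 x, A1 x & forall y c, A2 y -> U [set x' | f x' y <= c] -> f x y <= c) ->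
  (forall U : set_system P2, UltraFilter U -> U A2 ->
    exists2 y, A2 y & forall x c, A1 x -> U [set y' | c <= f x y'] -> c <= f x y) ->
  exists x y, is_NETP f A1 A2 x y.
Proof.
move=> [x0 Ax0] [y0 Ay0] m1 m2 bM cpt1 cpt2.
(* The levels that the second player can guarantee; their supremum [v] is the maximin value. *)
pose S := [set c | exists2 y, A2 y & forall x, A1 x -> c <= f x y].
have bS : has_sup S.
  split.
    by exists (- M); exists y0 => // x Ax; have := bM _ _ Ax Ay0; rewrite ler_norml => /andP[].
  exists M => c [y Ay /(_ _ Ax0) h]; apply: (le_trans h).
  by have := bM _ _ Ax0 Ay; rewrite ler_norml => /andP[].
pose v := sup S.
have [y Ay hy] : exists2 y, A2 y & forall x, A1 x -> v <= f x y.
  (* Strategies guaranteeing levels that approach [v]; a limit along an ultrafilter guarantees [v]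
     itself. *)
  pose F := filter_from [set c | c < v] (fun c => [set y | A2 y /\ forall x, A1 x -> c <= f x y]).
  have FF : ProperFilter F.
    apply: filter_from_proper; first apply: filter_from_filter.
    - by exists (v - 1) => /=; lra.
    - move=> c c' cv cv'; exists (Num.max c c') => [|y [Ay h]]; first by rewrite /= gt_max cv.
      by split; split => // x Ax; have := h x Ax; rewrite ge_max => /andP[].
    - move=> c /= cv; have [z [y Ay h] cz] := sup_gt bS.1 cv.
      by exists y; split => // x Ax; apply: ltW; apply: lt_le_trans cz (h _ Ax).
  have [U [UU FU]] := ultraFilterLemma FF.
  have [|y Ay h] := cpt2 U UU; first by apply: FU; exists (v - 1) => /= [|? []//]; lra.
  exists y => // x Ax; apply/ler_addgt0Pl => e e0; rewrite -lerBlDl.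
  apply: h => //; apply: FU; exists (v - e) => /= [|y' [_]]; [lra|exact].
have [x Ax hx] : exists2 x, A1 x & forall y, A2 y -> f x y <= v.
  (* An index holds a level above [v] and a sequence of opponents of which only the first [n] count.
     If no [x] kept all of these below the level, [finite_alternatives] would merge them into one
     [y] guaranteeing a level above [v]. *)
  pose F := filter_from [set p : R * nat * (nat -> P2) | v < p.1.1 /\ forall i, A2 (p.2 i)]
    (fun p => [set x | A1 x /\ forall i, (i < p.1.2)%N -> f x (p.2 i) < p.1.1]).
  have FF : ProperFilter F.
    apply: filter_from_proper; first apply: filter_from_filter.
    - by exists (v + 1, 0%N, fun=> y0) => /=; split => //; lra.
    - move=> [[c n] ys] [[c' n'] ys'] /= [cv Ays] [cv' Ays'].
      exists (Num.min c c', (n + n')%N, fun i => if (i < n)%N then ys i else ys' (i - n)%N) => /=.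
        by split => [|i]; [rewrite lt_min cv|case: ifP].
      move=> x [Ax h]; split; split => //= i iN.
        have := h i; rewrite iN lt_min => /(_ _)/andP[]//.
        by rewrite (leq_trans iN) ?leq_addr.
      have := h (n + i)%N; rewrite (ltn_add2l n i) iN => /(_ isT).
      by rewrite ltnNge leq_addr/= addKn lt_min => /andP[].
    - move=> [[c n] ys] /= [cv Ays]; apply: contrapT => /forallNP N.
      have [|y1 Ay1 h1] := @finite_alternatives A1 A2 c n m2
        (ex_intro _ y0 Ay0) A1 ys (fun=> id) m1 Ays.
      + move=> x Ax; apply: contrapT => N1; apply: (N x); split => // i iN.
        by rewrite ltNge; apply/negP => h; apply: N1; exists i.
      have : c <= v by apply: ub_le_sup; [case: bS|exists y1].
      by rewrite leNgt cv.
  have [U [UU FU]] := ultraFilterLemma FF.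
  have [|x Ax h] := cpt1 U UU.
    by apply: FU; exists (v + 1, 0%N, fun=> y0) => /= [|? []//]; split=> //; lra.
  exists x => // y1 Ay1; apply/ler_addgt0Pr => e e0.
  apply: h => //; apply: FU; exists (v + e, 1%N, fun=> y1) => /=.
    by split=> //; lra.
  by move=> x' [_ /(_ 0%N)] /= /(_ isT) /ltW.
exists x, y; split=> // q Aq.
- by apply: (le_trans (hx _ Aq)); apply: hy.
- by apply: (le_trans _ (hy _ Aq)); apply: hx.
Qed.

End Minimax.

(** * Weak limits of probabilities along ultrafilters *)

Section ProbabilityIntegrals.
Context {R : realType} {dT : measure_display} {T : measurableType dT}.

(** Supplies the structure of a [probability]: dividing by a total mass of 1 leaves the measure
    unchanged. *)
Lemma probability_of_measure (mu : {measure set T -> \bar R}) :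
  mu setT = 1%E -> exists P : probability T R, forall A, P A = mu A.
Proof.
move=> mu1; exists (mnormalize mu (dirac point)) => A.
by rewrite /= /mnormalize mu1/= onee_eq0/= invr1 mule1.
Qed.

Lemma bounded_integrable (P : probability T R) (f : T -> R) (M : R) :
  measurable_fun setT f -> (forall x, `|f x| <= M) ->
  P.-integrable setT (EFin \o f).
Proof.
move=> mf bf; apply: measurable_bounded_integrable => //.
  by rewrite (le_lt_trans (probability_le1 P _)) ?ltry.
by exists M; split; rewrite ?num_real// => N MN x _; apply: le_trans (bf x) (ltW MN).
Qed.

Lemma Rintegral_dist_le (P : probability T R) (f g : T -> R) (M N e : R) :
  measurable_fun setT f -> measurable_fun setT g ->
  (forall x, `|f x| <= M) -> (forall x, `|g x| <= N) ->
  (forall x, `|f x - g x| <= e) ->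
  `|\int[P]_x f x - \int[P]_x g x| <= e.
Proof.
move=> mf mg bf bg fg.
have If := bounded_integrable P mf bf; have Ig := bounded_integrable P mg bg.
have mfg : measurable_fun setT (fun x => f x - g x) by exact: measurable_funB.
have Ifg : P.-integrable setT (EFin \o (fun x => f x - g x)).
  exact: bounded_integrable mfg fg.
rewrite -RintegralB//.
apply: (le_trans (le_normr_Rintegral _ _)) => //.
rewrite [leRHS](_ : e = \int[P]_x (cst e x)); last first.
  by rewrite Rintegral_cst// [X in fine X]probability_setT mulr1.
apply: le_Rintegral => //.
  apply: (@bounded_integrable _ _ e); last by move=> x; rewrite normr_id.
  exact: measurableT_comp.
by apply: (@bounded_integrable _ _ `|e|).
Qed.

Lemma Rintegral_indic_sum (P : probability T R) {I : Type} (s : seq I)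
    (a : I -> R) (E : I -> set T) : (forall i, measurable (E i)) ->
  \int[P]_x (\sum_(i <- s) a i * \1_(E i) x) =
  \sum_(i <- s) a i * fine (P (E i)).
Proof.
move=> mE.
have m1 i : measurable_fun setT (fun x => \1_(E i) x : R).
  exact: measurable_indic.
have b1 i x : `|\1_(E i) x| <= 1 :> R.
  by rewrite indicE; case: (_ \in _); rewrite ?normr1 ?normr0.
have ms s' : measurable_fun setT (fun x => \sum_(i <- s') a i * \1_(E i) x).
  by apply: measurable_sum => i; apply: measurable_funM.
have bs s' x : `|\sum_(i <- s') a i * \1_(E i) x| <= \sum_(i <- s') `|a i|.
  apply: (le_trans (ler_norm_sum _ _ _)); apply: ler_sum => i _.
  by rewrite normrM ler_piMr.
elim: s => [|i s IH].
  under eq_Rintegral do rewrite big_nil.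
  by rewrite big_nil Rintegral_cst// mul0r.
under eq_Rintegral do rewrite big_cons.
rewrite RintegralD//; last 2 first.
- apply: (@bounded_integrable _ _ `|a i|); first exact: measurable_funM.
  by move=> x; rewrite normrM ler_piMr.
- exact: bounded_integrable (bs s).
rewrite IH big_cons RintegralZl//; last exact: bounded_integrable (b1 i).
by rewrite /Rintegral integral_indic// setIT.
Qed.

(** The error does not depend on [P], so one finite sum approximates the integrals of all plans at
    once. This uniformity turns convergence of cell masses into convergence of integrals. *)
Lemma Rintegral_simple_approx (P : probability T R) {I : finType} (a : I -> R)
    (w : T -> I) (h : T -> R) (M e : R) :
  (forall i, measurable [set x | w x = i]) -> measurable_fun setT h ->
  (forall x, `|h x| <= M) -> (forall x, `|h x - a (w x)| <= e) ->
  `|\int[P]_x h x - \sum_i a i * fine (P [set x | w x = i])| <= e.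
Proof.
move=> mw mh bh he.
have aE x : a (w x) = \sum_i a i * \1_[set x | w x = i] x.
  rewrite (bigD1 (w x))//= big1 ?addr0.
    by rewrite indicE mem_set// mulr1.
  by move=> i wi; rewrite indicE memNset ?mulr0//= => /eqP; rewrite eq_sym (negbTE wi).
rewrite -Rintegral_indic_sum//.
have eqa : (fun x => a (w x)) = (fun x => \sum_i a i * \1_[set x | w x = i] x).
  by apply/funext.
rewrite -eqa; apply: (@Rintegral_dist_le _ _ _ M (\sum_i `|a i|)) => //.
- rewrite eqa; apply: measurable_sum => i; exact: measurable_funM.
- by move=> x; rewrite (bigD1 (w x))//= lerDl sumr_ge0.
Qed.

End ProbabilityIntegrals.

Section UltraLimit.
Context {R : realType} {T : Type} (U : set_system T) {UU : UltraFilter U}.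

(** The image of an ultrafilter is again an ultrafilter, and this one contains the compact segment
    [-M, M]. *)
Lemma ultra_bounded_cvg (a : T -> R) (M : R) : (forall x, `|a x| <= M) ->
  a @ U --> lim (a @ U).
Proof.
move=> aM.
have UaU : UltraFilter (a @ U).
  apply: Build_UltraFilter => G PG sG.
  apply/seteqP; split=> // A GA.
  have [//|cA] := in_ultra_setVsetC (a @^-1` A) UU.
  have GcA : G (~` A) by exact: sG.
  have /filter_ex[//] : G set0 by rewrite -(setICr A); exact: filterI.
have := @segment_compact R (- M) M; rewrite compact_ultra => /(_ (a @ U) UaU).
case.
  apply: (@filterS _ U _ setT _ _ filterT) => x _ /=.
  by rewrite in_itv/= -ler_norml.
by move=> l [_ /= al]; apply/cvg_ex; exists l.
Qed.

End UltraLimit.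

Lemma measurable_countable_comp {d d' : measure_display} {X : measurableType d}
    {Y : measurableType d'} {C : countType} (w : X -> C) (k : C -> Y) :
  (forall c, measurable [set x | w x = c]) -> measurable_fun setT (k \o w).
Proof.
move=> mw _ B mB; rewrite setTI.
rewrite (_ : _ @^-1` _ = \bigcup_c [set x | w x = c /\ B (k c)]).
  apply: countable_bigcupT_measurable => // c.
  have [Bc|nBc] := pselect (B (k c)).
    by rewrite (_ : mkset _ = [set x | w x = c])//; apply/seteqP; split=> x //= [].
  by rewrite (_ : mkset _ = set0)//; apply/seteqP; split=> x //= [].
by apply/seteqP; split=> [x Bx|x [c _ [<-]]] //; exists (w x).
Qed.

Definition unif_for {R : realType} {T : Type} (D : T -> T -> R) (H : T -> R) :=
  forall e, 0 < e -> exists2 del, 0 < del &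
    forall x y, D x y <= del -> `|H x - H y| <= e.

(* The weak limit is realised as the law of a random point, drawn by
   subdividing [0, 1[ into intervals whose lengths are the limit masses of the
   cylinders of the binary coding [beta]. *)
Section UltraLimitMeasure.
Context {R : realType} {dT : measure_display} {T : measurableType dT}.
Variables (D : T -> T -> R) (beta : nat -> T -> bool).
Hypothesis mbeta : forall n, measurable_fun setT (beta n).

(* The most recent bit comes first. *)
Fixpoint pre (n : nat) (x : T) : seq bool :=
  if n is n'.+1 then beta n' x :: pre n' x else [::].

(** Total boundedness in coded form: the finitely many cells of some depth [n] all have diameter at
    most [e]. *)
Hypothesis pre_small : forall e : R, 0 < e ->
  exists n, forall x y, pre n x = pre n y -> D x y <= e.

Lemma size_pre n x : size (pre n x) = n.
Proof. by elim: n => //= n ->. Qed.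

Lemma drop_pre n m x : (m <= n)%N -> drop (n - m) (pre n x) = pre m x.
Proof.
elim: n => [|n IH]; first by rewrite leqn0 => /eqP ->.
rewrite leq_eqVlt => /orP[/eqP ->|]; first by rewrite subnn.
by rewrite ltnS => mn; rewrite subSn//= IH.
Qed.

Lemma measurable_pre w : measurable [set x | pre (size w) x = w].
Proof.
elim: w => [|b w IH]; first by rewrite (_ : mkset _ = setT)//; apply/seteqP; split.
rewrite (_ : mkset _ = (beta (size w) @^-1` [set b]) `&` [set x | pre (size w) x = w]).
  apply: measurableI => //; rewrite -[X in measurable X]setTI; exact: mbeta.
by apply/seteqP; split => x /= [-> ->].
Qed.

Definition rep (w : seq bool) : T := xget point [set x | pre (size w) x = w].

Lemma pre_rep w : [set x | pre (size w) x = w] !=set0 -> pre (size w) (rep w) = w.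
Proof. by move=> [x xw]; rewrite /rep; case: xgetP => [? -> //|/(_ x)]. Qed.

Lemma pre_repE n x : pre n (rep (pre n x)) = pre n x.
Proof.
have := @pre_rep (pre n x); rewrite size_pre; apply; exists x => /=.
by [].
Qed.

Lemma unif_pre (H : T -> R) : unif_for D H -> forall e, 0 < e ->
  exists n0, forall n x y, (n0 <= n)%N -> pre n x = pre n y -> `|H x - H y| <= e.
Proof.
move=> uH e e0; have [del del0 Hd] := uH e e0; have [n0 h] := pre_small del0.
exists n0 => n x y n0n xy; apply/Hd/h.
by rewrite -!(drop_pre _ n0n) xy.
Qed.

(** At a suitable depth there are finitely many cells and [H] varies by at most 1 on each. *)
Lemma unif_bounded (H : T -> R) : unif_for D H -> exists M, forall x, `|H x| <= M.
Proof.
move=> uH; have [n h] := unif_pre uH ltr01.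
exists (1 + \sum_(w : n.-tuple bool) `|H (rep w)|) => x.
have := h n x (rep (pre n x)) (leqnn _); rewrite pre_repE => /(_ erefl) hx.
have -> : H x = (H x - H (rep (pre n x))) + H (rep (pre n x)) by rewrite subrK.
apply: (le_trans (ler_normD _ _)); apply: lerD => //.
have sz : size (pre n x) == n by rewrite size_pre.
by rewrite (bigD1 (Tuple sz))//= lerDl sumr_ge0.
Qed.

Lemma measurable_rep_pre n {d'} {Y : measurableType d'} (H : T -> Y) :
  measurable_fun setT (fun x => H (rep (pre n x))).
Proof.
apply: (@measurable_countable_comp _ _ _ _ _ (pre n) (H \o rep)) => w.
have [<-|nw] := eqVneq (size w) n; first exact: measurable_pre.
rewrite (_ : mkset _ = set0)//; apply/seteqP; split=> x //= xw.
by move: nw; rewrite -xw size_pre eqxx.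
Qed.

Lemma unif_rep_cvg (H : T -> R) : unif_for D H ->
  forall x, H (rep (pre n x)) @[n --> \oo] --> H x.
Proof.
move=> uH x; apply/cvgrPdist_le => e e0.
have [n0 h] := unif_pre uH e0; exists n0 => // n /= n0n.
by apply: (h n) => //; rewrite pre_repE.
Qed.

Lemma unif_measurable (H : T -> R) : unif_for D H -> measurable_fun setT H.
Proof.
move=> uH; apply: (@measurable_fun_cvg _ _ _ _ (fun n x => H (rep (pre n x)))).
  by move=> n; exact: measurable_rep_pre.
by move=> x _; exact: unif_rep_cvg.
Qed.

Context (U : set_system (probability T R)) {UU : UltraFilter U}.

Definition mass (w : seq bool) : R :=
  lim ((fun P : probability T R => fine (P [set x | pre (size w) x = w])) @ U).

Lemma fine_prob01 (P : probability T R) A : measurable A -> 0 <= fine (P A) <= 1.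
Proof.
move=> mA; rewrite fine_ge0//= -lee_fin fineK ?probability_le1//.
exact: fin_num_measure.
Qed.

Lemma cvg_mass w :
  (fun P : probability T R => fine (P [set x | pre (size w) x = w])) @ U
  --> mass w.
Proof.
apply: (@ultra_bounded_cvg _ _ _ _ _ 1) => P.
by have /andP[? ?] := fine_prob01 P (measurable_pre w); rewrite ger0_norm.
Qed.

Lemma mass_ge0 w : 0 <= mass w.
Proof.
apply: limr_ge; first exact: cvg_mass.
near=> P.
by have /andP[] := fine_prob01 P (measurable_pre w).
Unshelve. all: by end_near. Qed.

Lemma mass_gt0_ex w : 0 < mass w -> [set x | pre (size w) x = w] !=set0.
Proof.
move=> w0; apply: contrapT => /nonemptyPn E; move: w0.
rewrite /mass E (_ : (fun P => _) = cst 0) ?lim_cst ?ltxx//.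
by apply/funext => P; rewrite measure0.
Qed.

Lemma mass_nil : mass [::] = 1.
Proof.
rewrite /mass (_ : (fun P => _) = cst 1) ?lim_cst//.
apply/funext => P; rewrite (_ : mkset _ = setT) ?probability_setT//.
by apply/seteqP; split.
Qed.

(** Only finite additivity passes to the limit along [U]; the countable additivity of the limit plan
    will come from Lebesgue measure. *)
Lemma mass_cons w : mass w = mass (false :: w) + mass (true :: w).
Proof.
rewrite {1}/mass (_ : (fun P => _) = (fun P : probability T R =>
  fine (P [set x | pre (size (false :: w)) x = false :: w]) +
  fine (P [set x | pre (size (true :: w)) x = true :: w]))).
  by apply/cvg_lim => //; apply: cvgD; exact: cvg_mass.
apply/funext => P.
rewrite /= -fineD ?fin_num_measure//; last 2 first.
- exact: (measurable_pre (false :: w)).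
- exact: (measurable_pre (true :: w)).
rewrite -measureU.
- congr (fine (P _)); apply/seteqP; split=> x /=.
    by move=> ->; case: (beta (size w) x); [right|left].
  by case=> [[_ ->]|[_ ->]].
- exact: (measurable_pre (false :: w)).
- exact: (measurable_pre (true :: w)).
- by apply/seteqP; split=> x //= [[-> _] []].
Qed.

(** The interval attached to [w] is [left_end w, left_end w + mass w[, and the child with bit
    [false] occupies its left part. *)
Fixpoint left_end (w : seq bool) : R :=
  if w is b :: w' then left_end w' + (if b then mass (false :: w') else 0) else 0.

Fixpoint code (n : nat) (u : R) : seq bool :=
  if n is n'.+1 then
    let w := code n' u in (left_end w + mass (false :: w) <= u) :: w
  else [::].

Lemma size_code n u : size (code n u) = n.
Proof. by elim: n => //= n ->. Qed.

Lemma code_itv n (u : R) : 0 <= u < 1 ->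
  left_end (code n u) <= u < left_end (code n u) + mass (code n u).
Proof.
move=> u01; elim: n => [|n /andP[]] /=; first by rewrite mass_nil add0r.
move: (code n u) => w; have := mass_cons w.
by move=> mw lu ur; case: (lerP (left_end w + mass (false :: w)) u) => /= *; apply/andP; split; lra.
Qed.

Lemma left_end_ge0 w : 0 <= left_end w.
Proof. by elim: w => //= b w h; case: b; rewrite ?addr_ge0 ?mass_ge0. Qed.

Lemma left_end_le1 w : left_end w + mass w <= 1.
Proof.
elim: w => [|b w]; first by rewrite mass_nil add0r.
have := mass_cons w; have := mass_ge0 (false :: w); have := mass_ge0 (true :: w).
by case: b => /=; lra.
Qed.

Lemma codeE w (u : R) : left_end w <= u < left_end w + mass w -> code (size w) u = w.
Proof.
elim: w => //= b w IH.
have m1 := mass_ge0 (false :: w); have m2 := mass_ge0 (true :: w).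
have mw := mass_cons w => ub.
have -> : code (size w) u = w.
  by apply: IH; case/andP: ub; case: b => *; apply/andP; split; lra.
case/andP: ub => ub1 ub2.
by congr (_ :: _); case: b ub1 ub2 => *; [apply/idP|apply/negbTE; rewrite -ltNge]; lra.
Qed.

Lemma code_fiber w : [set` `[0, 1[] `&` [set u : R | code (size w) u = w] =
  [set` `[left_end w, left_end w + mass w[] :> set R.
Proof.
apply/seteqP; split => u /=; rewrite !in_itv/=.
  by move=> [u01 <-]; apply: code_itv.
move=> uw; split; last exact: codeE.
case/andP: uw => *; have := left_end_ge0 w; have := left_end_le1 w.
by move=> *; apply/andP; split; lra.
Qed.

Lemma drop_code n m u : (m <= n)%N -> drop (n - m) (code n u) = code m u.
Proof.
elim: n => [|n IH]; first by rewrite leqn0 => /eqP ->.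
rewrite leq_eqVlt => /orP[/eqP ->|]; first by rewrite subnn.
by rewrite ltnS => mn; rewrite subSn//= IH.
Qed.

(** The random point is a function on the whole line, under Lebesgue measure restricted to [0, 1[;
    numbers outside are sent to 0 so that the properties of the coding hold everywhere. *)
Definition clamp (u : R) : R := if 0 <= u < 1 then u else 0.

Lemma clamp01 u : 0 <= clamp u < 1.
Proof. by rewrite /clamp; case: ifP => // _; rewrite lexx ltr01. Qed.

(** The half-open interval of the code contains a point, so its length, the limit mass of the cell,
    is positive. An empty cell would have mass 0, hence the cell has a representative. *)
Lemma pre_rep_code n u : pre n (rep (code n (clamp u))) = code n (clamp u).
Proof.
have := @pre_rep (code n (clamp u)); rewrite size_code; apply.
have := @mass_gt0_ex (code n (clamp u)); rewrite size_code; apply.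
by have /andP[] := code_itv n (clamp01 u); lra.
Qed.

Lemma clamp_code_fiber w : [set` `[0, 1[] `&` [set u | code (size w) (clamp u) = w] =
  [set` `[left_end w, left_end w + mass w[].
Proof.
rewrite -code_fiber; apply/seteqP; split => u /= [].
  by rewrite in_itv/= /clamp => u01; rewrite u01.
by rewrite in_itv/= /clamp => u01; rewrite u01.
Qed.

Lemma measurable_clamp_code n w :
  measurable [set u : measurableTypeR R | code n (clamp u) = w].
Proof.
have [<-|nw] := eqVneq (size w) n; last first.
  rewrite (_ : mkset _ = set0)//; apply/seteqP; split=> x //= xw.
  by move: nw; rewrite -xw size_code eqxx.
set S := mkset _.
rewrite (_ : S = ([set` `[0, 1[] `&` S) `|`
    (~` [set` `[0, 1[] `&` [set u | code (size w) 0 = w])).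
  apply: measurableU; first by rewrite clamp_code_fiber; exact: measurable_itv.
  have [h|h] := pselect (code (size w) 0 = w).
    rewrite [X in _ `&` X](_ : _ = setT) ?setIT; last by apply/seteqP; split.
    by apply: measurableC; exact: measurable_itv.
  by rewrite [X in _ `&` X](_ : _ = set0) ?setI0//; apply/seteqP; split.
apply/seteqP; split => u /=.
  rewrite /S/= in_itv/=; have [u01|u01] := boolP (0 <= u < 1); first by left.
  by rewrite {1}/clamp (negbTE u01) => h; right.
case=> [[]//|[]]; rewrite in_itv/= => /negP u01.
by rewrite /S/= /clamp (negbTE u01).
Qed.

Hypothesis complete : forall x_ : nat -> T,
  (forall e : R, 0 < e -> exists n0, forall m n, (n0 <= m)%N -> (n0 <= n)%N ->
    D (x_ m) (x_ n) <= e) ->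
  exists x, forall e : R, 0 < e -> exists n0, forall n, (n0 <= n)%N -> D (x_ n) x <= e.

(** The only link between [D] and the sigma-algebra of [T] on the side of the limit. It leaves room
    for a sigma-algebra defined by a metric finer than [D]. *)
Hypothesis measurable_into : forall G : measurableTypeR R -> T,
  (forall H, unif_for D H -> measurable_fun setT (H \o G)) -> measurable_fun setT G.

(** [G u] is the limit of the representatives of the nested cells coded by [u], and [Q] is the law
    of [G]. The integrals of [H] against [Q] and against every [P] are within e / 3 of sums over the
    same cells with the same values, and these sums converge because the masses do. *)
Theorem ultra_limit_probability : exists Q : probability T R,
  forall H : T -> R, unif_for D H ->
    (fun P : probability T R => \int[P]_x H x) @ U --> \int[Q]_x H x.
Proof.
have /choice[G HG] u : exists x, forall e : R, 0 < e ->
    exists n0, forall n, (n0 <= n)%N -> D (rep (code n (clamp u))) x <= e.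
  apply: complete => e e0; have [n0 h] := pre_small e0; exists n0 => m n m0 n0n.
  by apply: h; rewrite -(drop_pre _ m0) -(drop_pre _ n0n) !pre_rep_code !drop_code.
have cG H : unif_for D H -> forall u, H (rep (code n (clamp u))) @[n --> \oo] --> H (G u).
  move=> uH u; apply/cvgrPdist_le => e e0.
  have [del del0 h] := uH e e0; have [n0 hn] := HG u del del0.
  exists n0 => // n /= n0n; rewrite distrC; apply: h; exact: hn.
have mG : measurable_fun setT (G : measurableTypeR R -> T).
  apply: measurable_into => H uH.
  apply: (@measurable_fun_cvg _ _ _ _ (fun n u => H (rep (code n (clamp u))))).
    move=> n; apply: (@measurable_countable_comp _ _ _ _ _
      (fun u => code n (clamp u)) (H \o rep)) => w; exact: measurable_clamp_code.
  by move=> u _; exact: cG.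
have m01 : measurable ([set` `[0, 1[] : set (measurableTypeR R)).
  exact: measurable_itv.
have [|P0 P0E] := @probability_of_measure R _ _ (mrestr lebesgue_measure m01).
  by rewrite /= /mrestr setTI lebesgue_measure_itv/= lte01 oppr0 adde0.
have P0code n (w : n.-tuple bool) : fine (P0 [set u | code n (clamp u) = w]) = mass w.
  rewrite P0E/= /mrestr setIC.
  have := clamp_code_fiber w; rewrite size_tuple => ->.
  rewrite lebesgue_measure_itv/= lte_fin; case: ltP => [_|].
    by rewrite -EFinD/= addrAC subrr add0r.
  by have := mass_ge0 w => ? ? /=; lra.
pose GX : {RV P0 >-> T} := @mfun_Sub _ _ (measurableTypeR R) T G (mem_set mG).
exists (distribution P0 GX) => H uH.
have [M HM] := unif_bounded uH; have mH := unif_measurable uH.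
have IG : \int[distribution P0 GX]_x H x = \int[P0]_u H (G u).
  rewrite /Rintegral integral_distribution//; first exact/measurable_EFinP.
  by apply: (@bounded_integrable _ _ _ _ _ M) => //; exact: measurableT_comp.
rewrite IG; apply/cvgrPdist_le => e e0.
have e30 : 0 < e / 3 by rewrite divr_gt0.
have [n hn] := unif_pre uH e30.
pose S (P : probability T R) := \sum_(w : n.-tuple bool) H (rep w) * fine (P [set x | pre n x = w]).
have cS : S @ U --> \sum_(w : n.-tuple bool) H (rep w) * mass w.
  apply: cvg_big => [|w _]; first exact: add_continuous.
  apply: cvgMr; by have := @cvg_mass w; rewrite size_tuple.
have h0 : `|\int[P0]_u H (G u) - \sum_(w : n.-tuple bool) H (rep w) * mass w| <= e / 3.
  under eq_bigr do rewrite -P0code.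
  have sz u : size (code n (clamp u)) == n by rewrite size_code.
  pose c u := Tuple (sz u).
  have cE w : [set u | code n (clamp u) = tval w] = [set u | c u = w].
    by apply/seteqP; split=> u /= h; [apply: val_inj|rewrite -h].
  under eq_bigr do rewrite cE.
  apply: (@Rintegral_simple_approx _ _ _ P0 _ (fun w : n.-tuple bool => H (rep w)) c _ M).
  - by move=> w; rewrite -cE; exact: measurable_clamp_code.
  - exact: measurableT_comp.
  - by move=> u; exact: HM.
  (* [G u] may lie outside the cell coded by [u], since cells need not be closed; the bound is
     proved for deeper representatives, which do lie in it, and then passed to the limit. *)
  - move=> u; have cu : `|H (rep (code m (clamp u))) - H (rep (c u))| @[m --> \oo]
      --> `|H (G u) - H (rep (c u))|.
      by apply: cvg_norm; apply: cvgB; [exact: cG|exact: cvg_cst].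
    rewrite -(cvg_lim _ cu)//; apply: limr_le; first exact: (cvgP _ cu).
    near=> m; apply: (hn n) => //.
    have nm : (n <= m)%N by near: m; exact: nbhs_infty_ge.
    by rewrite /= -(drop_pre _ nm) pre_rep_code drop_code// pre_rep_code.
have hP (P : probability T R) : `|\int[P]_x H x - S P| <= e / 3.
  have sz x : size (pre n x) == n by rewrite size_pre.
  pose c x := Tuple (sz x).
  have cE w : [set x | pre n x = tval w] = [set x | c x = w].
    by apply/seteqP; split=> x /= h; [apply: val_inj|rewrite -h].
  rewrite /S; under eq_bigr do rewrite cE.
  apply: (@Rintegral_simple_approx _ _ _ P _ (fun w : n.-tuple bool => H (rep w)) c _ M) => //.
  - by move=> w; rewrite -cE; have := measurable_pre w; rewrite size_tuple.
  - by move=> x; apply: (hn n) => //; rewrite pre_repE.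
near=> P.
have hS : `|\sum_(w : n.-tuple bool) H (rep w) * mass w - S P| <= e / 3.
  by near: P; move/cvgrPdist_le : cS; apply.
have := hP P; move: h0 hS; rewrite !ler_norml => /andP[? ?] /andP[? ?] /andP[? ?].
apply/andP; split; lra.
Unshelve. all: by end_near. Qed.

End UltraLimitMeasure.

(** * Weak derivatives on the unit interval *)

Section SquareIntegrable.
Context {R : realType}.
Notation mu := (@lebesgue_measure R).
Implicit Types f g h : R -> R.

Definition sqint g := measurable_fun `[(0 : R), 1] g /\
  mu.-integrable `[(0 : R), 1] (fun t => (g t ^+ 2)%:E).

Lemma measurable_01 : measurable (`[(0 : R), 1]%classic : set (measurableTypeR R)).
Proof. exact: measurable_itv. Qed.
Hint Resolve measurable_01 : core.

Lemma measure_01 : mu `[0, 1]%classic = 1%E.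
Proof. by rewrite lebesgue_measure_itv/= lte_fin ltr01 oppr0 adde0. Qed.

Lemma integrable_le_sq g h : measurable_fun `[(0 : R), 1] h ->
  mu.-integrable `[(0 : R), 1] (EFin \o g) ->
  (forall t : R, t \in `[0, 1] -> `|h t| <= g t) ->
  mu.-integrable `[(0 : R), 1] (EFin \o h).
Proof.
move=> mh ig hg; apply: le_integrable ig => //; first exact/measurable_EFinP.
move=> t t01 /=; rewrite lee_fin (le_trans (hg t _))//; last exact: ler_norm.
Qed.

Lemma sqint_mul f g : sqint f -> sqint g ->
  mu.-integrable `[(0 : R), 1] (EFin \o (fun t => f t * g t)).
Proof.
move=> [mf f2] [mg g2].
apply: (@integrable_le_sq (fun t => f t ^+ 2 + g t ^+ 2)).
- exact: measurable_funM.
- by have := integrableD measurable_01 f2 g2; apply: eq_integrable.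
- move=> t _; rewrite normrM -(real_normK (num_real (f t))).
  rewrite -(real_normK (num_real (g t))).
  by have := normr_ge0 (f t); have := normr_ge0 (g t); nra.
Qed.

Lemma sqint_bounded f (M : R) : measurable_fun `[(0 : R), 1] f ->
  (forall t : R, t \in `[0, 1] -> `|f t| <= M) -> sqint f.
Proof.
move=> mf fM; split=> //; apply: measurable_bounded_integrable => //.
- by rewrite [ltLHS](_ : _ = mu `[0%R, 1%R]%classic)// measure_01 ltry.
- exact: measurable_funX.
- exists (M ^+ 2); split; rewrite ?num_real// => N MN t t01.
  apply: le_trans (ltW MN); rewrite /= normrX ler_sqr ?nnegrE//.
    by apply: fM; rewrite inE.
  by apply: le_trans (fM t _); rewrite ?inE.
Qed.

Lemma sqint_cst c : sqint (cst c).
Proof. by apply: (@sqint_bounded _ `|c|). Qed.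

Lemma sqint_integrable f : sqint f -> mu.-integrable `[(0 : R), 1] (EFin \o f).
Proof.
by move=> /sqint_mul/(_ (sqint_cst 1)); apply: eq_integrable => // t _ /=; rewrite mulr1.
Qed.

Lemma sqint_mulb f g (M : R) : sqint f -> measurable_fun `[(0 : R), 1] g ->
  (forall t : R, t \in `[0, 1] -> `|g t| <= M) -> sqint (fun t => f t * g t).
Proof.
move=> [mf f2] mg gM; split; first exact: measurable_funM.
apply: (@integrable_le_sq (fun t => M ^+ 2 * f t ^+ 2)).
- by apply: measurable_funX; exact: measurable_funM.
- by have := integrableZl measurable_01 (M ^+ 2) f2; apply: eq_integrable.
- move=> t t01; rewrite exprMn normrM mulrC ler_pM//; last first.
    by rewrite ger0_norm ?sqr_ge0.
  by rewrite normrX ler_sqr ?nnegrE ?gM//; apply: le_trans (gM t t01).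
Qed.

Lemma sqintZ c f : sqint f -> sqint (fun t => c * f t).
Proof.
move=> sf; have := @sqint_mulb f (cst c) `|c| sf.
rewrite (_ : (fun t => f t * cst c t) = (fun t => c * f t)); first by apply.
by apply/funext => t /=; rewrite mulrC.
Qed.

Lemma sqintD f g : sqint f -> sqint g -> sqint (fun t => f t + g t).
Proof.
move=> [mf f2] [mg g2]; split; first exact: measurable_funD.
apply: (@integrable_le_sq (fun t => 2 * f t ^+ 2 + 2 * g t ^+ 2)).
- by apply: measurable_funX; exact: measurable_funD.
- have := integrableD measurable_01 (integrableZl measurable_01 2 f2)
    (integrableZl measurable_01 2 g2).
  by apply: eq_integrable.
- by move=> t _; rewrite ger0_norm ?sqr_ge0//; have := sqr_ge0 (f t - g t); nra.
Qed.

Lemma sqintB f g : sqint f -> sqint g -> sqint (fun t => f t - g t).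
Proof.
move=> sf sg; have := sqintD sf (sqintZ (-1) sg).
by under eq_fun do rewrite mulN1r.
Qed.

Definition int01 f := mu.-integrable `[(0 : R), 1] (EFin \o f).

Lemma int01D f g : int01 f -> int01 g -> int01 (fun t => f t + g t).
Proof. by move=> hf hg; have := integrableD measurable_01 hf hg; apply: eq_integrable. Qed.

Lemma int01Z c f : int01 f -> int01 (fun t => c * f t).
Proof. by move=> hf; have := integrableZl measurable_01 c hf; apply: eq_integrable. Qed.

Lemma cauchy_schwarz_itv g (s t : R) : 0 <= s -> s <= t -> t <= 1 -> sqint g ->
  (\int[mu]_(x in `]s, t[) g x) ^+ 2 <= (t - s) * \int[mu]_(x in `[0, 1]) g x ^+ 2.
Proof.
move=> s0 st t1 sg.
have sub : (`]s, t[ `<=` `[(0 : R), 1])%classic.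
  by move=> x /=; rewrite !in_itv/= => /andP[? ?]; apply/andP; split; lra.
have mst : measurable (`]s, t[%classic : set (measurableTypeR R)).
  exact: measurable_itv.
have iS h : mu.-integrable `[(0 : R), 1] (EFin \o h) ->
    mu.-integrable `]s, t[ (EFin \o h).
  by apply: integrableS.
move: (st); rewrite le_eqVlt => /orP[/eqP ->|lst].
  by rewrite subrr mul0r set_itvoo0 ?lexx// Rintegral_set0 expr0n.
set A := \int[mu]_(x in `]s, t[) g x.
set B := \int[mu]_(x in `[0, 1]) g x ^+ 2.
(* The mean of [g]: integrating 2 c g <= g^2 + c^2 gives c A <= B, and A^2 equals (t - s) c A. *)
pose c := A / (t - s).
have ig := iS _ (sqint_integrable sg).
have ig2 : mu.-integrable `]s, t[ (EFin \o (fun x => g x ^+ 2)).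
  by apply: iS; exact: sg.2.
have le1 : \int[mu]_(x in `]s, t[) (2 * c * g x) <=
    \int[mu]_(x in `]s, t[) (g x ^+ 2 + c ^+ 2).
  apply: le_Rintegral => //.
  - by apply: iS; apply: int01Z; exact: sqint_integrable.
  - by apply: iS; apply: int01D sg.2 (sqint_integrable (sqint_cst (c ^+ 2))).
  - by move=> x _; have := sqr_ge0 (g x - c); nra.
move: le1; rewrite RintegralZl// RintegralD//; last first.
  by apply: iS; exact: sqint_integrable (sqint_cst (c ^+ 2)).
rewrite Rintegral_cst// [X in fine X]lebesgue_measure_itv/= lte_fin lst -EFinD/=.
have le2 : \int[mu]_(x in `]s, t[) (g x ^+ 2) <= B.
  apply: fine_le; rewrite ?(integrable_fin_num _ ig2) ?(integrable_fin_num _ sg.2)//.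
  apply: ge0_subset_integral => //.
  - by apply/measurable_EFinP; apply: measurable_funX; exact: sg.1.
  - by move=> x _; rewrite lee_fin sqr_ge0.
have cA : c * (t - s) = A by rewrite /c divfK// subr_eq0 gt_eqF.
rewrite -/A; have ts0 : 0 < t - s by rewrite subr_gt0.
move=> le1; have cAB : c * A <= B by nra.
have -> : A ^+ 2 = (t - s) * (c * A) by rewrite mulrA [_ * c]mulrC cA.
by rewrite ler_pM2l.
Qed.

End SquareIntegrable.
#[global] Hint Resolve measurable_01 : core.

(** * A step function of class C^1 *)

Section SmoothStep.
Context {R : realType}.
Implicit Types x : R.

Definition sqpos x : R := Num.max x 0 ^+ 2.

Lemma is_derive_sqpos x : is_derive x 1 sqpos (2 * Num.max x 0).
Proof.
have [x0|x0|->] := ltgtP x 0.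
- apply: (@near_eq_is_derive _ _ _ (cst 0)).
    near=> y; rewrite /sqpos /=.
    have y0 : y < 0 by near: y; exact: lt_nbhsl.
    by rewrite max_r ?ltW// expr0n.
  by rewrite mulr0; exact: is_derive_cst.
- apply: (@near_eq_is_derive _ _ _ (fun y : R => y ^+ 2)).
    near=> y; rewrite /sqpos /=.
    have y0 : 0 < y by near: y; exact: lt_nbhsr.
    by rewrite max_l ?ltW.
  by have := @is_deriveX _ _ id 2 x 1 1 (is_derive_id _ _); rewrite expr1 /GRing.scale/= mulr1.
- rewrite mulr0.
  have h : h^-1 *: (sqpos (h *: 1 + 0) - sqpos 0) @[h --> 0^'] --> (0 : R).
    apply/cvgrPdist_le => e e0; near=> h.
    rewrite sub0r normrN /sqpos maxxx expr0n subr0 /GRing.scale/= mulr1 addr0.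
    have h0 : h != 0 by near: h; exact: nbhs_dnbhs_neq.
    have he : `|h| <= e by near: h; apply: dnbhs0_le.
    rewrite normrM normfV normrX expr2 mulrA.
    have [h0'|h0'] := leP h 0.
      by rewrite normr0 mulr0 ltW.
    by rewrite mulVf ?mul1r// normr_eq0.
  by apply: DeriveDef; [apply: cvgP h|apply: cvg_lim].
Unshelve. all: by end_near. Qed.

Lemma continuous_max0 : continuous (fun x : R => Num.max x 0).
Proof.
move=> x; rewrite (_ : (fun x : R => Num.max x 0) = (fun x => (x + `|x|) / 2)).
  by apply: cvgMl; apply: cvgD; [exact: cvg_id|apply: cvg_norm; exact: cvg_id].
apply/funext => y; have [y0|y0] := leP y 0.
  by rewrite ler0_norm// subrr mul0r.
by rewrite gtr0_norm//; lra.
Qed.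

(** A quadratic spline climbing from 0 to 1 on [0, 1]. Its derivative is the tent of height 2 over
    that interval, hence of mass 1, and is continuous as [C1c_01] demands. *)
Definition smoothstep x : R :=
  2 * sqpos x - 4 * sqpos (x - 2^-1) + 2 * sqpos (x - 1).

Definition dsmoothstep x : R :=
  4 * Num.max x 0 - 8 * Num.max (x - 2^-1) 0 + 4 * Num.max (x - 1) 0.

Lemma is_derive_sqpos_shift (k a x : R) :
  is_derive x 1 (fun y => k * sqpos (y - a)) (k * (2 * Num.max (x - a) 0)).
Proof.
apply: is_deriveZ.
rewrite -[X in is_derive _ _ _ X]mulr1.
apply: (@is_derive1_comp _ sqpos (fun y => y - a)); first exact: is_derive_sqpos.
by rewrite -[X in is_derive _ _ _ X]subr0; apply: is_deriveB.
Qed.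

Lemma is_derive_smoothstep x : is_derive x 1 smoothstep (dsmoothstep x).
Proof.
rewrite /dsmoothstep.
rewrite (_ : 4 * _ = 2 * (2 * Num.max (x - 0) 0)); last by rewrite subr0; lra.
rewrite (_ : 8 * _ = 4 * (2 * Num.max (x - 2^-1) 0)); last by lra.
rewrite (_ : 4 * Num.max (x - 1) 0 = 2 * (2 * Num.max (x - 1) 0)); last by lra.
rewrite (_ : smoothstep = (fun y => 2 * sqpos (y - 0)) \- (fun y => 4 * sqpos (y - 2^-1))
  \+ (fun y => 2 * sqpos (y - 1))).
  by apply: is_deriveD; [apply: is_deriveB|]; exact: is_derive_sqpos_shift.
by apply/funext => y; rewrite /smoothstep/= subr0.
Qed.

Lemma continuous_dsmoothstep : continuous dsmoothstep.
Proof.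
have c k a : continuous (fun x : R => k * Num.max (x - a) 0).
  move=> x; apply: cvgMr.
  apply: (@continuous_comp _ _ _ (fun y => y - a) (fun y => Num.max y 0)).
    by apply: cvgB; [exact: cvg_id|exact: cvg_cst].
  exact: continuous_max0.
move=> x; apply: cvgD; last exact: c.
apply: cvgB; last exact: c.
by apply: cvgMr; exact: continuous_max0.
Qed.

Lemma smoothstep_le0 x : x <= 0 -> smoothstep x = 0.
Proof. by move=> x0; rewrite /smoothstep /sqpos !max_r; lra. Qed.

Lemma smoothstep_ge1 x : 1 <= x -> smoothstep x = 1.
Proof. by move=> x1; rewrite /smoothstep /sqpos !max_l; lra. Qed.

Lemma smoothstep01 x : 0 <= smoothstep x <= 1.
Proof.
have [x0|x0] := leP x 0; first by rewrite smoothstep_le0// lexx ler01.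
have [x1|x1] := leP 1 x; first by rewrite smoothstep_ge1// lexx ler01.
rewrite /smoothstep /sqpos (max_l (ltW x0)) (@max_r _ _ (x - 1)); last by lra.
by case: (lerP (x - 2^-1) 0) => h; apply/andP; split; nra.
Qed.

Lemma dsmoothstep_out x : x <= 0 \/ 1 <= x -> dsmoothstep x = 0.
Proof. by rewrite /dsmoothstep; case=> h; [rewrite !max_r|rewrite !max_l]; lra. Qed.

Lemma dsmoothstep_ge0 x : 0 <= dsmoothstep x.
Proof.
rewrite /dsmoothstep; case: (lerP x 0) => ?; case: (lerP (x - 2^-1) 0) => ?;
  case: (lerP (x - 1) 0) => ?; lra.
Qed.

End SmoothStep.

(** * Increments and uniqueness of weak derivatives *)

Section WeakDerivative.
Context {R : realType}.
Notation mu := (@lebesgue_measure R).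
Implicit Types f g h : R -> R.

Lemma Rint01_dominated (F : nat -> R -> R) f G :
  (forall n, measurable_fun `[(0 : R), 1] (F n)) ->
  (forall t : R, t \in `[0, 1] -> F n t @[n --> \oo] --> f t) ->
  int01 G -> (forall n (t : R), t \in `[0, 1] -> `|F n t| <= G t) ->
  int01 f /\ \int[mu]_(t in `[0, 1]) F n t @[n --> \oo] --> \int[mu]_(t in `[0, 1]) f t.
Proof.
move=> mF Ff iG FG.
have mf : measurable_fun `[(0 : R), 1] f.
  apply: (measurable_fun_cvg mF) => t t01; apply: Ff; by rewrite inE in t01 *.
have [|||||i1 _ c] := @dominated_convergence _ _ _ mu `[0, 1]%classic measurable_01
  (fun n => EFin \o F n) (EFin \o f) (EFin \o G).
- by move=> n; apply/measurable_EFinP; exact: mF.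
- by apply/measurable_EFinP.
- by apply: aeW => t t01; apply: cvg_EFin; [near=> n|apply: Ff; rewrite inE in t01 *].
- exact: iG.
- by apply: aeW => t n t01 /=; rewrite lee_fin; apply: FG.
split=> //; apply: fine_cvg; rewrite /Rintegral fineK//.
by apply: integrable_fin_num i1.
Unshelve. all: by end_near. Qed.

Lemma within01P {V : normedModType R} (h : R -> V) :
  {within `[0, 1], continuous h} <->
  forall a : R, a \in `[0, 1] -> forall e : R, 0 < e -> exists2 del : R, 0 < del &
    forall x : R, x \in `[0, 1] -> `|x - a| < del -> `|h x - h a| < e.
Proof.
split.
  move=> /subspace_continuousP ch a a01 e e0.
  have := ch a a01 => /cvgrPdist_lt/(_ e e0).
  rewrite near_withinE => /nbhs_ballP[del /= del0 H]; exists del => // x x01 xa.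
  by rewrite distrC; apply: H => //; rewrite /ball/= distrC.
move=> H; apply/subspace_continuousP => a a01; apply/cvgrPdist_lt => e e0.
have [del del0 h1] := H a a01 e e0.
rewrite near_withinE; apply/nbhs_ballP; exists del => //= x; rewrite /ball/= => xa x01.
by rewrite distrC; apply: h1; rewrite // distrC.
Qed.

Lemma is_derive_smoothstep_affine (a n b x : R) :
  is_derive x 1 (fun y => smoothstep ((y - a) * n + b))
    (dsmoothstep ((x - a) * n + b) * n).
Proof.
apply: (@is_derive1_comp _ smoothstep (fun y => (y - a) * n + b)).
  exact: is_derive_smoothstep.
rewrite -[X in is_derive _ _ _ X]addr0; apply: is_deriveD.
rewrite (_ : (fun y => (y - a) * n) = (fun y => n * (y - a))).
  rewrite -[X in is_derive _ _ _ X]mulr1; apply: is_deriveZ.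
  rewrite -[X in is_derive _ _ _ X]subr0; exact: is_deriveB.
by apply/funext => y; rewrite mulrC.
Qed.

Lemma continuous_affine_dsmoothstep (a n b : R) :
  continuous (fun x => dsmoothstep ((x - a) * n + b) * n).
Proof.
move=> x; apply: cvgMl.
apply: (@continuous_comp _ _ _ (fun y => (y - a) * n + b) dsmoothstep).
  apply: cvgD; last exact: cvg_cst.
  by apply: cvgMl; apply: cvgB; [exact: cvg_id|exact: cvg_cst].
exact: continuous_dsmoothstep.
Qed.

Lemma within_measurable h : {within `[0, 1], continuous h} ->
  measurable_fun `[(0 : R), 1] h.
Proof. by move=> ch; apply: subspace_continuous_measurable_fun. Qed.

Lemma within_bounded h : {within `[0, 1], continuous h} ->
  exists M : R, forall t : R, t \in `[0, 1] -> `|h t| <= M.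
Proof.
move=> /within01P ch.
have cn : {within `[0, 1], continuous (fun x => `|h x|)}.
  apply/within01P => a a01 e e0; have [del del0 H] := ch a a01 e e0.
  by exists del => // x x01 xa; apply: le_lt_trans (ler_dist_dist _ _) (H x x01 xa).
have [c c01 hc] := EVT_max ler01 cn.
by exists `|h c|.
Qed.

Lemma within_sqint h : {within `[0, 1], continuous h} -> sqint h.
Proof.
by move=> ch; have [M hM] := within_bounded ch; exact: sqint_bounded (within_measurable ch) hM.
Qed.

(** An approximate identity at [a], supported in [a - b/n, a + (1 - b)/n]. The shift [b] places the
    support to the right of [a] for b = -1 and to its left for b = 2, so that [a] may be an endpoint
    of [0, 1]. *)
Definition bump_kernel (a b : R) (n : nat) (x : R) : R :=
  dsmoothstep ((x - a) * n%:R + b) * n%:R.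

Lemma continuous_bump_kernel a b n : continuous (bump_kernel a b n).
Proof. exact: continuous_affine_dsmoothstep. Qed.

Lemma bump_kernel_ge0 a b n x : 0 <= bump_kernel a b n x.
Proof. by rewrite mulr_ge0// dsmoothstep_ge0. Qed.

Lemma within_bump_kernel a b n : {within `[0, 1], continuous (bump_kernel a b n)}.
Proof. by apply: continuous_subspaceT; exact: continuous_bump_kernel. Qed.

(** The two inequalities place the support inside [0, 1], so the primitive [smoothstep] climbs all
    the way from 0 to 1 there. *)
Lemma int_bump_kernel (a b : R) (n : nat) :
  - a * n%:R + b <= 0 -> 1 <= (1 - a) * n%:R + b ->
  \int[mu]_(x in `[0, 1]) bump_kernel a b n x = 1.
Proof.
move=> h0 h1; rewrite /Rintegral.
pose F (x : R) : R := smoothstep ((x - a) * n%:R + b).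
have dF x := is_derive_smoothstep_affine a n%:R b x.
have cF : continuous F.
  move=> x; apply: differentiable_continuous.
  by apply/derivable1_diffP; have [] := dF x.
rewrite (@continuous_FTC2 _ (bump_kernel a b n) F 0 1 ltr01).
- by rewrite /F sub0r (smoothstep_le0 h0) (smoothstep_ge1 h1) /= subr0.
- exact: within_bump_kernel.
- split.
  + by move=> x _; have [] := dF x.
  + by apply: cvg_at_right_filter; exact: cF.
  + by apply: cvg_at_left_filter; exact: cF.
- by move=> x _; rewrite derive1E; have [_ ->] := dF x.
Qed.

Lemma bump_kernel_cvg h (a b : R) : {within `[0, 1], continuous h} ->
  a \in `[0, 1] ->
  (\forall n \near \oo, - a * n%:R + b <= 0 /\ 1 <= (1 - a) * n%:R + b) ->
  \int[mu]_(x in `[0, 1]) (h x * bump_kernel a b n x) @[n --> \oo] --> h a.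
Proof.
move=> ch a01 hab; apply/cvgrPdist_le => e e0.
have [del del0 H] := (within01P h).1 ch a a01 e e0.
near=> n.
have [h0 h1] : - a * n%:R + b <= 0 /\ 1 <= (1 - a) * n%:R + b by near: n.
have n0 : 0 < n%:R :> R by rewrite ltr0n; near: n; exact: nbhs_infty_gt.
(* From here on the support of the kernel lies within [del] of [a]. *)
have nb : (`|b| + 1) / del < n%:R by near: n; exact: nbhs_infty_gtr.
have sk := within_sqint (within_bump_kernel (a := a) (b := b) (n := n)).
have sh := within_sqint ch.
have ca : sqint (cst (h a)) := sqint_cst _.
have -> : h a = \int[mu]_(x in `[0, 1]) (h a * bump_kernel a b n x).
  by rewrite RintegralZl ?int_bump_kernel ?mulr1//; exact: sqint_integrable.
rewrite -RintegralB//; [|exact: sqint_mul ca sk|exact: sqint_mul sh sk].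
apply: (le_trans (le_normr_Rintegral _ _)) => //.
  by have := sqint_mul (sqintB ca sh) sk; apply: eq_integrable => // x _ /=; rewrite mulrBl.
apply: (@le_trans _ _ (\int[mu]_(x in `[0, 1]) (e * bump_kernel a b n x))); last first.
  by rewrite RintegralZl ?int_bump_kernel ?mulr1//; exact: sqint_integrable.
apply: le_Rintegral => //.
- have := sqint_mul (sqintB ca sh) sk => /integrable_norm.
  by apply: eq_integrable => // x _ /=; rewrite mulrBl.
- exact: (sqint_mul (sqint_cst e) sk).
- move=> x x01; rewrite -mulrBl normrM (ger0_norm (bump_kernel_ge0 _ _ _ _)).
  have [xa|xa] := ltP `|x - a| del.
    by rewrite ler_wpM2r ?bump_kernel_ge0// distrC ltW// H.
  have -> : bump_kernel a b n x = 0; last by rewrite !mulr0.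
  rewrite /bump_kernel dsmoothstep_out ?mul0r//.
  have nd : `|b| + 1 < n%:R * del by rewrite -ltr_pdivrMr.
  have b1 := ler_norm b; have b2 : - b <= `|b| by rewrite -normrN ler_norm.
  move: xa; rewrite ler_normr => /orP[xa|xa].
    by right; have := ler_wpM2r (ltW n0) xa; rewrite [del * _]mulrC; lra.
  by left; have := ler_wpM2r (ltW n0) xa; rewrite [del * _]mulrC; lra.
Unshelve. all: by end_near. Qed.


Definition scalar_weak f g := [/\ {within `[0, 1], continuous f}, sqint g &
  forall phi, C1c_01 phi -> \int[mu]_(t in `[0, 1]) (f t * derive1 phi t) =
    - \int[mu]_(t in `[0, 1]) (g t * phi t)].

(* A smooth approximation of the indicator of ]s, t[, supported in
   [s + 1/n, t - 1/n]. *)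
Definition plateau (s t : R) (n : nat) (x : R) : R :=
  smoothstep ((x - s) * n%:R + -1) - smoothstep ((x - t) * n%:R + 2).

Lemma is_derive_plateau s t n (x : R) :
  is_derive x 1 (plateau s t n) (bump_kernel s (-1) n x - bump_kernel t 2 n x).
Proof. by apply: is_deriveB; exact: is_derive_smoothstep_affine. Qed.

Lemma derive1_plateau s t n :
  derive1 (plateau s t n) = bump_kernel s (-1) n \- bump_kernel t 2 n.
Proof.
by apply/funext => x; rewrite derive1E; have [_ ->] := is_derive_plateau s t n x.
Qed.

(** The plateau rises on [s + 1/n, s + 2/n] and falls on [t - 2/n, t - 1/n]; the factor 4 keeps
    these two intervals apart, and the margins of 1/n keep the support inside ]0, 1[ even when s = 0
    or t = 1. *)
Lemma plateau_C1c (s t : R) n : 0 <= s -> t <= 1 -> (0 < n)%N ->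
  4 <= (t - s) * n%:R -> C1c_01 (plateau s t n).
Proof.
move=> s0 t1 n0 st; have nR : 0 < n%:R :> R by rewrite ltr0n.
split.
- by move=> x; have [] := is_derive_plateau s t n x.
- rewrite derive1_plateau => x; apply: cvgB; exact: continuous_bump_kernel.
- have in1 : n%:R^-1 * n%:R = 1 :> R by rewrite mulVf// gt_eqF.
  have in0 : 0 < n%:R^-1 :> R by rewrite invr_gt0.
  exists (s + n%:R^-1), (t - n%:R^-1); split; [lra|lra|move=> x].
  rewrite in_itv/= negb_and -!ltNge /plateau => /orP[xs|tx].
    by rewrite !smoothstep_le0 ?subrr//; nra.
  by rewrite !smoothstep_ge1 ?subrr//; nra.
Qed.

Lemma plateau_norm s t n (x : R) : `|plateau s t n x| <= 1.
Proof.
rewrite /plateau ler_norml.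
have /andP[? ?] := smoothstep01 ((x - s) * n%:R + -1).
have /andP[? ?] := smoothstep01 ((x - t) * n%:R + 2).
by apply/andP; split; lra.
Qed.

Lemma smoothstep_right (a b x : R) : a < x \/ a = x /\ 1 <= b ->
  \forall n \near \oo, smoothstep ((x - a) * n%:R + b) = 1.
Proof.
case=> [ax|[-> b1]]; near=> n; apply: smoothstep_ge1; last first.
  by rewrite subrr mul0r add0r.
have : (1 + `|b|) / (x - a) <= n%:R by near: n; exact: nbhs_infty_ger.
rewrite ler_pdivrMr ?subr_gt0// mulrC.
have b2 : - b <= `|b| by rewrite -normrN ler_norm.
lra.
Unshelve. all: by end_near. Qed.

Lemma smoothstep_left (a b x : R) : x < a \/ x = a /\ b <= 0 ->
  \forall n \near \oo, smoothstep ((x - a) * n%:R + b) = 0.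
Proof.
case=> [xa|[-> b0]]; near=> n; apply: smoothstep_le0; last first.
  by rewrite subrr mul0r add0r.
have : `|b| / (a - x) <= n%:R by near: n; exact: nbhs_infty_ger.
rewrite ler_pdivrMr ?subr_gt0// mulrC.
have b1 := ler_norm b.
lra.
Unshelve. all: by end_near. Qed.

(** At each point both steps are eventually constant. At [s] both are 0 and at [t] both are 1
    eventually, which is why the limit is the indicator of the open interval. *)
Lemma plateau_cvg (s t x : R) : s < t ->
  plateau s t n x @[n --> \oo] --> (\1_(`]s, t[%classic) x : R).
Proof.
move=> st.
suff [u [v [uv hu hv]]] : exists u v : R, [/\ (\1_(`]s, t[%classic) x : R) = u - v,
    \forall n \near \oo, smoothstep ((x - s) * n%:R + -1) = u &
    \forall n \near \oo, smoothstep ((x - t) * n%:R + 2) = v].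
  rewrite uv; apply: cvg_near_cst; near=> n; rewrite /plateau.
  by congr (_ - _); near: n.
have [xs|sx] := leP x s.
  exists 0, 0; split.
  - by rewrite subrr indicE memNset//= in_itv/= ltNge xs.
  - apply: smoothstep_left; move: xs; rewrite le_eqVlt => /orP[/eqP xs|xs]; [right|by left].
    by split => //; lra.
  - by apply: smoothstep_left; left; exact: le_lt_trans xs st.
have [tx|xt] := leP t x.
  exists 1, 1; split.
  - by rewrite subrr indicE memNset//= in_itv/= sx ltNge tx.
  - by apply: smoothstep_right; left.
  - apply: smoothstep_right; move: tx; rewrite le_eqVlt => /orP[/eqP tx|tx]; [right|by left].
    by split => //; lra.
exists 1, 0; split.
- by rewrite subr0 indicE mem_set//= in_itv/= sx xt.
- by apply: smoothstep_right; left.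
- by apply: smoothstep_left; left.
Unshelve. all: by end_near. Qed.

Lemma measurable_plateau s t n : measurable_fun `[(0 : R), 1] (plateau s t n).
Proof.
apply: within_measurable; apply: continuous_subspaceT => x.
apply: differentiable_continuous; apply/derivable1_diffP.
by have [] := is_derive_plateau s t n x.
Qed.

Lemma near_ge_natmul (c k : R) : 0 < c -> \forall n \near \oo, k <= c * n%:R.
Proof.
move=> c0; near=> n; rewrite mulrC -ler_pdivrMr//.
by near: n; exact: nbhs_infty_ger.
Unshelve. all: by end_near. Qed.

(** Test with plateaus. Their derivatives are differences of approximate identities, so the left
    side tends to f s - f t by continuity of [f]; the right side tends to minus the integral of [g]
    by dominated convergence. *)
Lemma weak_increment f g (s t : R) : scalar_weak f g ->
  0 <= s -> s <= t -> t <= 1 -> f t - f s = \int[mu]_(x in `]s, t[) g x.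
Proof.
move=> [cf sg wfg] s0; rewrite le_eqVlt => /orP[/eqP ->|st] t1.
  by rewrite subrr set_itvoo0 ?lexx// Rintegral_set0.
have sf := within_sqint cf.
have L : \int[mu]_(x in `[0, 1]) (f x * derive1 (plateau s t n) x) @[n --> \oo] --> f s - f t.
  rewrite (_ : (fun n => _) = (fun n =>
      \int[mu]_(x in `[0, 1]) (f x * bump_kernel s (-1) n x) -
      \int[mu]_(x in `[0, 1]) (f x * bump_kernel t 2 n x))); last first.
    apply/funext => n; rewrite -RintegralB//;
      [|exact: sqint_mul sf (within_sqint (@within_bump_kernel _ _ _))..].
    by apply: eq_Rintegral => x _; rewrite derive1_plateau /= mulrBr.
  apply: cvgB; apply: bump_kernel_cvg => //; rewrite ?in_itv/=; try (apply/andP; split; lra).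
  - near=> n; split.
      have : 0 <= s * n%:R by rewrite mulr_ge0.
      by rewrite mulNr; lra.
    have : 2 <= (1 - s) * n%:R by near: n; apply: near_ge_natmul; lra.
    lra.
  - near=> n; split.
      have : 2 <= t * n%:R by near: n; apply: near_ge_natmul; lra.
      rewrite mulNr; lra.
    have : 0 <= (1 - t) * n%:R by rewrite mulr_ge0//; lra.
    lra.
have [_ D] : int01 (fun x => g x * \1_(`]s, t[%classic) x) /\
    \int[mu]_(x in `[0, 1]) (g x * plateau s t n x) @[n --> \oo] -->
    \int[mu]_(x in `[0, 1]) (g x * \1_(`]s, t[%classic) x).
  apply: (@Rint01_dominated _ _ (fun x => `|g x|)).
  - by move=> n; apply: measurable_funM; [exact: sg.1|exact: measurable_plateau].
  - by move=> x _; apply: cvgMr; exact: plateau_cvg.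
  - exact: integrable_norm (sqint_integrable sg).
  - by move=> n x _; rewrite normrM ler_piMr// plateau_norm.
have -> : \int[mu]_(x in `]s, t[) g x =
    \int[mu]_(x in `[0, 1]) (g x * \1_(`]s, t[%classic) x).
  rewrite [RHS]Rintegral_mkcond [LHS]Rintegral_mkcond.
  apply: eq_Rintegral => x _; rewrite !patchE indicE.
  case: ifPn => xst; last by rewrite mulr0; case: ifP.
  rewrite mulr1 ifT//; move: xst; rewrite !inE /= !in_itv/= => /andP[? ?].
  by apply/andP; split; lra.
have : \int[mu]_(x in `[0, 1]) (f x * derive1 (plateau s t n) x) @[n --> \oo] -->
    - \int[mu]_(x in `[0, 1]) (g x * \1_(`]s, t[%classic) x).
  apply: cvg_trans (cvgN D); apply: near_eq_cvg; near=> n.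
  rewrite wfg; first by [].
  apply: plateau_C1c => //.
    by near: n; exact: nbhs_infty_gt.
  by near: n; apply: near_ge_natmul; lra.
move=> /(cvg_unique _ L) => /(_ (@norm_hausdorff _ _)) E.
by apply/eqP; rewrite -eqr_opp opprB E.
Unshelve. all: by end_near. Qed.

(** Both derivatives have the same integral over every [0, x], namely the increment of [f]. Thus the
    primitive of g - g', extended by 0, vanishes identically, and Lebesgue differentiation gives g =
    g' almost everywhere. *)
Lemma weak_unique f g g' : scalar_weak f g -> scalar_weak f g' ->
  {ae mu, forall t, t \in `[(0 : R), 1] -> g t = g' t}.
Proof.
move=> wg wg'; have [_ sg _] := wg; have [_ sg' _] := wg'.
pose k : R -> R := (fun t => g t - g' t) \_ `[(0 : R), 1].
have sk : int01 (fun t => g t - g' t) by exact: sqint_integrable (sqintB sg sg').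
have ik : mu.-integrable setT (EFin \o k).
  have : mu.-integrable setT ((EFin \o (fun t => g t - g' t)) \_ `[0, 1]).
    by rewrite -integrable_mkcond.
  by apply: eq_integrable => // t _; rewrite /k /= !patchE; case: ifP.
have F0 x : \int[mu]_(t in `]-oo, x]) k t = 0.
  rewrite /k -Rintegral_mkcondr.
  have [x0|x0] := ltP x 0.
    rewrite (_ : _ `&` _ = set0) ?Rintegral_set0//.
    apply/seteqP; split=> y //= []; rewrite !in_itv/= => ? /andP[? ?]; lra.
  have iS (b b' : bool) (t : R) : t <= 1 -> mu.-integrable
      [set` Interval (BSide b 0) (BSide b' t)] (EFin \o (fun y => g y - g' y)).
    move=> t1; apply: integrableS sk => // y /=.
    by rewrite !itv_boundlr/=; case: b; case: b'; rewrite !bnd_simp => /andP[? ?];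
      apply/andP; split; lra.
  have Z (t : R) : 0 <= t <= 1 -> \int[mu]_(y in `[0, t]) (g y - g' y) = 0.
    move=> /andP[t0 t1].
    rewrite -Rintegral_itv_bndo_bndc; last exact: iS.
    rewrite -Rintegral_itv_obnd_cbnd; last exact: iS.
    have sub : (`]0, t[ `<=` `[(0 : R), 1])%classic.
      by move=> y /=; rewrite !in_itv/= => /andP[? ?]; apply/andP; split; lra.
    rewrite RintegralB//.
    - by rewrite -(weak_increment wg)// -(weak_increment wg')// subrr.
    - exact: integrableS (sqint_integrable sg).
    - exact: integrableS (sqint_integrable sg').
  have [x1|x1] := leP x 1.
    rewrite (_ : _ `&` _ = `[0, x]%classic); last first.
      apply/seteqP; split=> y /=; rewrite !in_itv/=.
        by move=> [? /andP[? ?]]; apply/andP.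
      by move=> /andP[? ?]; split => //; apply/andP; split; lra.
    by rewrite Z// x0.
  rewrite (_ : _ `&` _ = `[0, 1]%classic); last first.
    apply/seteqP; split=> y /=; rewrite !in_itv/=; first by move=> [].
    by move=> /andP[? ?]; split; [lra|apply/andP].
  by rewrite Z// ler01 lexx.
have ikx (y : R) : mu.-integrable `]-oo, y] (EFin \o k).
  by apply: integrableS ik => //; exact: measurable_itv.
have lk : locally_integrable [set: R] k by exact: integrable_locally_restrict.
have := FTC1Ny ikx lk.
rewrite (_ : (fun x => _) = cst 0); last by apply/funext.
move=> H; apply: (@filterS _ _ (ae_filter_ringOfSetsType mu) _ _ _ H) => t [_ +] t01.
rewrite derive1_cst /k patchE ifT; last first.
  by rewrite inE.
by move=> /esym/eqP; rewrite subr_eq0 => /eqP.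
Qed.

Lemma weak_hoelder f g (s t : R) : scalar_weak f g ->
  0 <= s -> s <= t -> t <= 1 ->
  (f t - f s) ^+ 2 <= (t - s) * \int[mu]_(x in `[0, 1]) g x ^+ 2.
Proof.
move=> wg s0 st t1; rewrite (weak_increment wg)//.
by apply: cauchy_schwarz_itv => //; case: wg.
Qed.

End WeakDerivative.

(** * Almost everywhere limits of rapidly Cauchy sequences in L^2 *)

Section FastLimit.
Context {R : realType}.
Notation mu := (@lebesgue_measure R).

Lemma int01_le (f g : R -> R) : int01 f -> int01 g ->
  (forall t : R, t \in `[0, 1] -> f t <= g t) ->
  \int[mu]_(t in `[0, 1]) f t <= \int[mu]_(t in `[0, 1]) g t.
Proof. by move=> *; apply: le_Rintegral. Qed.

Lemma int01_ae (f g : R -> R) : measurable_fun `[(0 : R), 1] f ->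
  measurable_fun `[(0 : R), 1] g ->
  {ae mu, forall t, t \in `[(0 : R), 1] -> f t = g t} ->
  \int[mu]_(t in `[0, 1]) f t = \int[mu]_(t in `[0, 1]) g t.
Proof.
move=> mf mg fg; rewrite /Rintegral; congr fine.
apply: ae_eq_integral => //; [exact/measurable_EFinP..|].
apply: (@filterS _ _ (ae_filter_ringOfSetsType mu) _ _ _ fg) => t h t01 /=.
by rewrite h// inE.
Qed.

(** The geometric rate makes the sum [Gs] of the successive distances integrable, hence finite
    almost everywhere, so the telescoping series converges there. The function |v 0| + Gs then
    dominates the whole sequence. *)
Lemma fast_limit (v : nat -> R -> R) : (forall j, sqint (v j)) ->
  (forall j, \int[mu]_(t in `[0, 1]) (v j.+1 t - v j t) ^+ 2 <= 8 * (2^-1 ^+ j) ^+ 2) ->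
  exists g : R -> R, [/\ measurable_fun `[(0 : R), 1] g,
    {ae mu, forall t, t \in `[(0 : R), 1] -> v j t @[j --> \oo] --> g t} &
    forall (phi : R -> R) (M : R), measurable_fun `[(0 : R), 1] phi ->
      (forall t : R, t \in `[0, 1] -> `|phi t| <= M) ->
      \int[mu]_(t in `[0, 1]) (v j t * phi t) @[j --> \oo] -->
      \int[mu]_(t in `[0, 1]) (g t * phi t)].
Proof.
move=> sv hv.
pose a j t : R := `|v j.+1 t - v j t|.
have sa j : sqint (fun t => v j.+1 t - v j t) by exact: sqintB.
have ia j : int01 (a j) by exact: integrable_norm (sqint_integrable (sa j)).
have ma j : measurable_fun `[(0 : R), 1] (a j).
  by apply: measurableT_comp => //; exact: (sa j).1.
(* With q = 2^-j, the bound a <= a^2 / (2 q) + q / 2 integrates to at most 4 q + q / 2 <= 5 q,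
   written as 10 / 2^(j+1) to match the geometric series of [epsilon_trick0]. *)
have ba j : \int[mu]_(t in `[0, 1]) a j t <= 10 / (2 ^ j.+1)%:R.
  pose q : R := 2^-1 ^+ j.
  have q0 : 0 < q by rewrite exprn_gt0// invr_gt0.
  have -> : 10 / (2 ^ j.+1)%:R = 5 * q.
    by rewrite natrX exprS invfM -exprVn /q; lra.
  have h1 : \int[mu]_(t in `[0, 1]) a j t <= \int[mu]_(t in `[0, 1])
      ((2 * q)^-1 * (v j.+1 t - v j t) ^+ 2 + q / 2).
    apply: int01_le => //.
      by apply: int01D; [apply: int01Z; exact: (sa j).2|exact: sqint_integrable (sqint_cst _)].
    move=> t _; rewrite -(real_normK (num_real (v j.+1 t - v j t))) -/(a j t).
    have -> : (2 * q)^-1 * a j t ^+ 2 + q / 2 = (a j t ^+ 2 + q ^+ 2) / (2 * q).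
      by field; rewrite gt_eqF.
    rewrite ler_pdivlMr; last by lra.
    by have := sqr_ge0 (a j t - q); nra.
  apply: (le_trans h1); rewrite RintegralD//; last 2 first.
  - by apply: int01Z; exact: (sa j).2.
  - exact: sqint_integrable (sqint_cst _).
  rewrite Rintegral_cst// [X in fine X]measure_01 mulr1 RintegralZl//; last exact: (sa j).2.
  apply: (@le_trans _ _ ((2 * q)^-1 * (8 * q ^+ 2) + q / 2)).
    by rewrite lerD2r ler_wpM2l ?hv// invr_ge0; lra.
  rewrite (_ : (2 * q)^-1 * (8 * q ^+ 2) = 4 * q); first by lra.
  by field; rewrite gt_eqF.
pose Gs t : \bar R := (\sum_(0 <= j <oo) (a j t)%:E)%E.
have Gs0 t : (0 <= Gs t)%E by apply: nneseries_ge0 => j _ _; rewrite lee_fin normr_ge0.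
have mGs : measurable_fun `[(0 : R), 1] Gs.
  apply: ge0_emeasurable_sum => [j t _ _|j _]; first by rewrite lee_fin normr_ge0.
  by apply/measurable_EFinP; exact: ma.
have iGs : mu.-integrable `[(0 : R), 1] Gs.
  apply/integrableP; split => //.
  under eq_integral do rewrite gee0_abs//.
  rewrite /Gs integral_nneseries//; last 2 first.
  - by move=> j; apply/measurable_EFinP; exact: ma.
  - by move=> j t _; rewrite lee_fin normr_ge0.
  apply: (@le_lt_trans _ _ (\sum_(0 <= j <oo) (10 / (2 ^ j.+1)%:R)%:E)%E); last first.
    by apply: le_lt_trans (epsilon_trick0 xpredT _) (ltry _).
  apply: lee_nneseries => [j _ _|j _].
    by apply: integral_ge0 => t _; rewrite lee_fin normr_ge0.
  have := ba j; rewrite /Rintegral -lee_fin fineK//.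
  exact: (integrable_fin_num _ (ia j)).
pose A : set R := [set t | Gs t != +oo%E].
have mA : measurable (`[(0 : R), 1] `&` A).
  rewrite (_ : A = [set t | Gs t < +oo]%E); last first.
    by apply/seteqP; split => t /=; rewrite ltey.
  exact: emeasurable_fun_infty_o.
have aeA : {ae mu, forall t, t \in `[(0 : R), 1] -> A t}.
  have := integrable_ae measurable_01 iGs => H.
  apply: (@filterS _ _ (ae_filter_ringOfSetsType mu) _ _ _ H) => t h t01.
  by apply/eqP => E; move: h; rewrite E => /(_ t01).
(* Cut off outside the set of convergence, so that the sequence converges at every point and its
   limit is measurable. *)
pose w j t : R := v j t * \1_(`[(0 : R), 1] `&` A) t.
have mw j : measurable_fun `[(0 : R), 1] (w j).
  by apply: measurable_funM; [exact: (sv j).1|exact: measurable_indic].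
have partial n (t : R) : A t -> \sum_(0 <= j < n) a j t <= fine (Gs t).
  move=> At; rewrite -lee_fin fineK; last first.
    by rewrite ge0_fin_numE ?Gs0// ltey.
  rewrite -sumEFin; apply: (@nneseries_lim_ge _ (fun j => (a j t)%:E) xpredT 0 n) => j _ _.
  by rewrite lee_fin normr_ge0.
have vcvg (t : R) : A t -> cvgn (v ^~ t).
  move=> At.
  have cN : cvgn [normed series (telescope (v ^~ t))].
    apply: (@nondecreasing_is_cvgn _ _ ); last first.
      by exists (fine (Gs t)) => _ [n _ <-]; exact: partial.
    by apply: nondecreasing_series => n _ _; exact: normr_ge0.
  have := normed_cvg cN; rewrite telescopeK => c.
  have -> : v ^~ t = (fun n => (v n t - v 0%N t) + cst (v 0%N t) n).
    by apply/funext => n; rewrite /= subrK.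
  by apply: is_cvgD => //; exact: is_cvg_cst.
have wcvg (t : R) : cvgn (w ^~ t).
  rewrite /w indicE; case: (boolP (t \in _)) => [|_].
    by rewrite inE => -[_ At]; under eq_fun do rewrite mulr1; exact: vcvg.
  by under eq_fun do rewrite mulr0; exact: is_cvg_cst.
pose g t : R := limn (w ^~ t).
have mg : measurable_fun `[(0 : R), 1] g.
  by apply: (measurable_fun_cvg mw) => t _; exact: wcvg.
exists g; split => //.
  apply: (@filterS _ _ (ae_filter_ringOfSetsType mu) _ _ _ aeA) => t At t01.
  rewrite /g /w indicE mem_set; last by split => //; exact: At.
  rewrite [X in _ --> limn X](_ : _ = v ^~ t); first by apply: vcvg; exact: At.
  by apply/funext => j; rewrite mulr1.
move=> phi M mphi bphi.
have bw j (t : R) : `|w j t| <= `|v 0%N t| + fine (Gs t).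
  rewrite /w indicE; case: (boolP (t \in _)) => [|_]; last first.
    by rewrite mulr0 normr0 addr_ge0// fine_ge0.
  rewrite inE mulr1 => -[_ At].
  have -> : v j t = v 0%N t + \sum_(0 <= i < j) (v i.+1 t - v i t).
    by rewrite telescope_sumr// addrC subrK.
  apply: (le_trans (ler_normD _ _)); rewrite lerD2l.
  by apply: (le_trans (ler_norm_sum _ _ _)); exact: partial.
have iG : int01 (fine \o Gs).
  apply: le_integrable iGs => //.
    apply/measurable_EFinP; exact: measurableT_comp.
  move=> t _; rewrite /= (gee0_abs (Gs0 t)) ger0_norm ?fine_ge0//.
  by move: (Gs0 t); case: (Gs t) => //= _; rewrite leey.
have [|||| _] := @Rint01_dominated _ (fun j t => w j t * phi t) (fun t => g t * phi t)
  (fun t => M * (`|v 0%N t| + fine (Gs t))).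
- by move=> j; exact: measurable_funM.
- by move=> t _; apply: cvgMl; exact: wcvg.
- apply: int01Z; apply: int01D => //.
  exact: integrable_norm (sqint_integrable (sv 0%N)).
- by move=> j t t01; rewrite normrM mulrC ler_pM// bphi.
rewrite (_ : (fun n => _) = (fun j => \int[mu]_(t in `[0, 1]) (v j t * phi t)))//.
apply/funext => j; apply: int01_ae.
- exact: measurable_funM.
- by apply: measurable_funM => //; exact: (sv j).1.
- apply: (@filterS _ _ (ae_filter_ringOfSetsType mu) _ _ _ aeA) => t At t01.
  by rewrite /w indicE mem_set ?mulr1//; split => //; exact: At.
Unshelve. all: by end_near. Qed.

Lemma fatou01 (h_ : nat -> R -> R) (h : R -> R) (S : R) :
  (forall j, int01 (h_ j)) -> measurable_fun `[(0 : R), 1] h ->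
  (forall j t, 0 <= h_ j t) -> (forall t, 0 <= h t) ->
  {ae mu, forall t, t \in `[(0 : R), 1] -> h_ j t @[j --> \oo] --> h t} ->
  (forall j, \int[mu]_(t in `[0, 1]) h_ j t <= S) ->
  int01 h /\ \int[mu]_(t in `[0, 1]) h t <= S.
Proof.
move=> ih mh h_0 h0 hh hS.
have mE j : measurable_fun `[(0 : R), 1] (EFin \o h_ j) by apply: measurable_int (ih j).
have mhE : measurable_fun `[(0 : R), 1] (EFin \o h) by apply/measurable_EFinP.
have m_inf : measurable_fun `[(0 : R), 1] (fun t => limn_einf (fun j => (h_ j t)%:E)).
  rewrite (_ : (fun t => _) = (fun t => - limn_esup (fun j => - (h_ j t)%:E))%E).
    apply: measurableT_comp => //; apply: measurable_fun_limn_esup => j.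
    by apply: measurableT_comp => //; exact: mE.
  by apply/funext => t; rewrite -[RHS]limn_einfN;
    congr limn_einf; apply/funext => j /=; rewrite opprK.
have le1 : (\int[mu]_(t in `[0%R, 1%R]) (h t)%:E <= S%:E)%E.
  rewrite (_ : (\int[mu]_(t in `[0%R, 1%R]) (h t)%:E =
      \int[mu]_(t in `[0%R, 1%R]) limn_einf (fun j => (h_ j t)%:E))%E); last first.
    apply: ae_eq_integral => //.
    apply: (@filterS _ _ (ae_filter_ringOfSetsType mu) _ _ _ hh) => t H t01.
    have c : (h_ j t)%:E @[j --> \oo] --> (h t)%:E.
      by apply: cvg_EFin; [near=> j|apply: H; rewrite inE in t01 *].
    by have [-> _] := cvg_limn_einf_sup c.
  apply: (le_trans (fatou mu measurable_01 mE _)).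
    by move=> j t _; rewrite lee_fin.
  rewrite limn_einf_lim; apply: lime_le; first exact: is_cvg_einfs.
  near=> j; apply: (@le_trans _ _ (\int[mu]_(t in `[0%R, 1%R]) (h_ j t)%:E)%E).
    by apply: ereal_inf_lbound; exists j => /=.
  rewrite -(fineK (integrable_fin_num _ (ih j)))//.
  by rewrite lee_fin; exact: hS.
have i1 : int01 h.
  apply/integrableP; split => //.
  under eq_integral do rewrite /= ger0_norm//.
  exact: le_lt_trans le1 (ltry _).
split=> //; rewrite -lee_fin /Rintegral fineK//.
exact: (integrable_fin_num _ i1).
Unshelve. all: by end_near. Qed.

End FastLimit.

(** * Semicontinuity of the energy *)

Section VectorPaths.
Context {R : realType} {d : nat}.
Notation mu := (@lebesgue_measure R).
Implicit Types (g h gamma eta : R -> 'rV[R]_d) (v : 'rV[R]_d).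

Lemma enorm_sq v : enorm v ^+ 2 = \sum_(i < d) v ord0 i ^+ 2.
Proof. by rewrite sqr_sqrtr// sumr_ge0// => i _; exact: sqr_ge0. Qed.

Lemma coord_le_enorm v i : v ord0 i ^+ 2 <= enorm v ^+ 2.
Proof. by rewrite enorm_sq (bigD1 i)//= lerDl sumr_ge0// => j _; exact: sqr_ge0. Qed.

Lemma coord_le_norm v i : `|v ord0 i| <= `|v|.
Proof. by rewrite -[leRHS]/(mx_norm v) mx_normrE; exact: (le_bigmax _ _ (ord0, i)). Qed.

Lemma norm_le_coord v (e : R) : 0 <= e -> (forall i, `|v ord0 i| <= e) -> `|v| <= e.
Proof.
move=> e0 h; rewrite -[leLHS]/(mx_norm v) mx_normrE; apply: bigmax_le => // -[j i] _ /=.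
by rewrite ord1.
Qed.

Lemma norm_le_enorm v : `|v| <= enorm v.
Proof.
apply: norm_le_coord => [|i]; first exact: sqrtr_ge0.
by rewrite -ler_sqr ?nnegrE ?sqrtr_ge0// real_normK ?num_real// coord_le_enorm.
Qed.

Lemma enorm_sq_le v : enorm v ^+ 2 <= d%:R * `|v| ^+ 2.
Proof.
rewrite enorm_sq; apply: (@le_trans _ _ (\sum_(i < d) `|v| ^+ 2)).
  apply: ler_sum => i _; rewrite -real_normK ?num_real// ler_sqr ?nnegrE//.
  exact: coord_le_norm.
by rewrite sumr_const card_ord mulr_natl.
Qed.

Lemma L2_01_coord g i : L2_01 g -> sqint (fun t => g t ord0 i).
Proof.
move=> [mg ig]; split; first exact: mg.
apply: (@integrable_le_sq _ (fun t => enorm (g t) ^+ 2)) => //.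
  by apply: measurable_funX; exact: mg.
by move=> t _; rewrite ger0_norm ?sqr_ge0// coord_le_enorm.
Qed.

Lemma measurable_enorm_sq g : (forall i, measurable_fun `[(0 : R), 1] (fun t => g t ord0 i)) ->
  measurable_fun `[(0 : R), 1] (fun t => enorm (g t) ^+ 2).
Proof.
move=> mg; rewrite (_ : (fun t => _) = (fun t => \sum_(i < d) g t ord0 i ^+ 2)).
  by apply: measurable_sum => i; apply: measurable_funX; exact: mg.
by apply/funext => t; rewrite enorm_sq.
Qed.

Lemma int01_sum (I : Type) (s : seq I) (F : I -> R -> R) :
  (forall i, int01 (F i)) -> int01 (fun t => \sum_(i <- s) F i t).
Proof.
move=> iF; elim: s => [|i s IH].
  under eq_fun do rewrite big_nil; exact: sqint_integrable (sqint_cst 0).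
by under eq_fun do rewrite big_cons; exact: int01D.
Qed.

Lemma coord_L2_01 g : (forall i, sqint (fun t => g t ord0 i)) -> L2_01 g.
Proof.
move=> sg; split; first by move=> i; exact: (sg i).1.
rewrite (_ : (fun t => _) = EFin \o (fun t => \sum_(i < d) g t ord0 i ^+ 2)).
  by apply: int01_sum => i; exact: (sg i).2.
by apply/funext => t /=; rewrite enorm_sq.
Qed.

Lemma within_coord gamma i : {within `[0, 1], continuous gamma} ->
  {within `[0, 1], continuous (fun t => gamma t ord0 i)}.
Proof.
move=> /within01P cg; apply/within01P => a a01 e e0; have [del del0 H] := cg a a01 e e0.
exists del => // x x01 xa; apply: le_lt_trans (H x x01 xa).
by have := coord_le_norm (gamma x - gamma a) i; rewrite !mxE.
Qed.

Lemma weak_derivative_coord gamma g i : {within `[0, 1], continuous gamma} ->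
  weak_derivative gamma g ->
  scalar_weak (fun t => gamma t ord0 i) (fun t => g t ord0 i).
Proof.
move=> cg [Lg wg]; split; [exact: within_coord|exact: L2_01_coord|by move=> phi /wg].
Qed.

(** The parallelogram identity in L^2, obtained coordinate by coordinate under the integral. *)
Lemma energy_mid (a b : R -> 'rV[R]_d) : L2_01 a -> L2_01 b ->
  4 * energy (fun t => 2^-1 *: (a t + b t)) + energy (fun t => a t - b t) =
  2 * energy a + 2 * energy b.
Proof.
move=> La Lb.
have Lc (c : R) (u w : R -> 'rV[R]_d) : L2_01 u -> L2_01 w ->
    L2_01 (fun t => u t + c *: w t).
  move=> Lu Lw; apply: coord_L2_01 => i.
  under eq_fun do rewrite !mxE.
  by apply: sqintD; [exact: L2_01_coord|apply: sqintZ; exact: L2_01_coord].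
have Lm : L2_01 (fun t => 2^-1 *: (a t + b t)).
  apply: coord_L2_01 => i; under eq_fun do rewrite !mxE.
  by apply: sqintZ; apply: sqintD; exact: L2_01_coord.
have Ls : L2_01 (fun t => a t - b t).
  by under eq_fun do rewrite -scaleN1r; exact: Lc.
rewrite /energy -!RintegralZl//; [|exact: Lb.2|exact: La.2|exact: Lm.2].
rewrite -!RintegralD//; [|by apply: int01Z; case: La|by apply: int01Z; case: Lb|
  by apply: int01Z; case: Lm|exact: Ls.2].
apply: eq_Rintegral => t _; rewrite !enorm_sq !mulr_sumr -!big_split/=.
by apply: eq_bigr => i _; rewrite !mxE; field.
Qed.

Lemma C1c_within (phi : R -> R) : C1c_01 phi ->
  {within `[0, 1], continuous phi} /\ {within `[0, 1], continuous (derive1 phi)}.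
Proof.
move=> [dphi cphi' _]; split; apply: continuous_subspaceT => // x.
by apply: differentiable_continuous; apply/derivable1_diffP.
Qed.

Lemma int01_mul (f1 f2 : R -> R) : sqint f1 -> {within `[0, 1], continuous f2} ->
  int01 (fun t => f1 t * f2 t).
Proof. by move=> s1 c2; exact: sqint_mul s1 (within_sqint c2). Qed.

Lemma scalar_weak_mid (c : R) (f1 f2 g1 g2 : R -> R) : scalar_weak f1 g1 ->
  scalar_weak f2 g2 ->
  scalar_weak (fun t => c * (f1 t + f2 t)) (fun t => c * (g1 t + g2 t)).
Proof.
move=> [c1 s1 w1] [c2 s2 w2]; split.
- move=> x; apply: cvgM; first exact: cvg_cst.
  by apply: cvgD; [exact: c1|exact: c2].
- by apply: sqintZ; exact: sqintD.
move=> phi Cphi; have [cp cp'] := C1c_within Cphi.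
have E (u1 u2 k : R -> R) : sqint u1 -> sqint u2 -> {within `[0, 1], continuous k} ->
    \int[mu]_(t in `[0, 1]) (c * (u1 t + u2 t) * k t) =
    c * (\int[mu]_(t in `[0, 1]) (u1 t * k t) + \int[mu]_(t in `[0, 1]) (u2 t * k t)).
  move=> su1 su2 ck; have i1 := int01_mul su1 ck; have i2 := int01_mul su2 ck.
  rewrite -RintegralD// -RintegralZl//; last exact: int01D.
  by apply: eq_Rintegral => t _; rewrite -mulrA mulrDl.
by rewrite !E ?w1 ?w2//; [rewrite -mulrN opprD|exact: within_sqint..].
Qed.

Lemma weak_derivative_mid gamma eta g h : {within `[0, 1], continuous gamma} ->
  {within `[0, 1], continuous eta} -> weak_derivative gamma g ->
  weak_derivative eta h ->
  weak_derivative (fun t => 2^-1 *: (gamma t + eta t)) (fun t => 2^-1 *: (g t + h t)).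
Proof.
move=> cg ce wg wh.
have H i : scalar_weak (fun t => (2^-1 *: (gamma t + eta t)) ord0 i)
    (fun t => (2^-1 *: (g t + h t)) ord0 i).
  have := scalar_weak_mid 2^-1 (weak_derivative_coord i cg wg) (weak_derivative_coord i ce wh).
  by congr scalar_weak; apply/funext => t; rewrite !mxE.
split; first by apply: coord_L2_01 => i; case: (H i).
by move=> phi Cphi i; case: (H i) => _ _; apply.
Qed.

(** Both sides of the integration by parts for [f_ j] have a limit: the left one because [f_]
    converges uniformly and the derivative of the test function is bounded, the right one by
    [fast_limit]. *)
Lemma scalar_weak_limit (f : R -> R) (f_ v : nat -> R -> R) :
  {within `[0, 1], continuous f} -> (forall j, scalar_weak (f_ j) (v j)) ->
  (forall e : R, 0 < e -> \forall j \near \oo, forall t : R, t \in `[0, 1] ->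
    `|f_ j t - f t| <= e) ->
  (forall j, \int[mu]_(t in `[0, 1]) (v j.+1 t - v j t) ^+ 2 <= 8 * (2^-1 ^+ j) ^+ 2) ->
  exists g : R -> R, [/\ measurable_fun `[(0 : R), 1] g,
    {ae mu, forall t, t \in `[(0 : R), 1] -> v j t @[j --> \oo] --> g t} &
    forall phi, C1c_01 phi -> \int[mu]_(t in `[0, 1]) (f t * derive1 phi t) =
      - \int[mu]_(t in `[0, 1]) (g t * phi t)].
Proof.
move=> cf wf uf fv.
have [|g [mg vg ivg]] := fast_limit _ fv; first by move=> j; case: (wf j).
exists g; split => // phi Cphi; have [cp cp'] := C1c_within Cphi.
have [M hM] := within_bounded cp; have [M' hM'] := within_bounded cp'.
have L1 := ivg phi M (within_measurable cp) hM.
have L2 : \int[mu]_(t in `[0, 1]) (f_ j t * derive1 phi t) @[j --> \oo] -->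
    \int[mu]_(t in `[0, 1]) (f t * derive1 phi t).
  have M'0 : 0 <= M' by apply: le_trans (hM' 0 _); rewrite ?in_itv/= ?lexx ?ler01.
  apply/cvgrPdist_le => e e0; near=> j.
  have [cfj _ _] := wf j.
  rewrite -RintegralB//; [|exact: int01_mul (within_sqint _) cp'..].
  apply: (le_trans (le_normr_Rintegral _ _)) => //.
    exact: integrableB (int01_mul (within_sqint cf) cp') (int01_mul (within_sqint cfj) cp').
  have h : forall t : R, t \in `[0, 1] -> `|f_ j t - f t| <= e / (M' + 1).
    by near: j; apply: uf; rewrite divr_gt0//; lra.
  apply: (@le_trans _ _ (\int[mu]_(t in `[0, 1]) (cst e t))); last first.
    by rewrite Rintegral_cst// [X in fine X]measure_01 mulr1.
  apply: int01_le.
  - apply: integrable_norm.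
    exact: integrableB (int01_mul (within_sqint cf) cp') (int01_mul (within_sqint cfj) cp').
  - exact: sqint_integrable (sqint_cst _).
  - move=> t t01; rewrite -mulrBl normrM distrC.
    apply: (@le_trans _ _ (e / (M' + 1) * M')); first by rewrite ler_pM// ?h ?hM'.
    rewrite /= mulrAC ler_pdivrMr; last by lra.
    by rewrite ler_pM2l//; lra.
have L3 : \int[mu]_(t in `[0, 1]) (f_ j t * derive1 phi t) @[j --> \oo] -->
    - \int[mu]_(t in `[0, 1]) (g t * phi t).
  rewrite (_ : (fun j => _) = (fun j => - \int[mu]_(t in `[0, 1]) (v j t * phi t))).
    exact: cvgN L1.
  by apply/funext => j; case: (wf j) => _ _ /(_ _ Cphi) ->.
exact: (cvg_unique (@norm_hausdorff _ _) L2 L3).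
Unshelve. all: by end_near. Qed.


(** A competitor [p] carries its path [p.1] together with a weak derivative [p.2], so that midpoints
    of competitors come with the midpoint of the derivatives. *)
Definition near_path gamma (S e : R) (p : (R -> 'rV[R]_d) * (R -> 'rV[R]_d)) :=
  [/\ {within `[0, 1], continuous p.1}, weak_derivative p.1 p.2, energy p.2 <= S &
    forall t : R, t \in `[0, 1] -> `|p.1 t - gamma t| <= e].

Lemma energy_ge0 g : 0 <= energy g.
Proof. by apply: Rintegral_ge0 => t _; exact: sqr_ge0. Qed.

Lemma L2_01B g h : L2_01 g -> L2_01 h -> L2_01 (fun t => g t - h t).
Proof.
move=> Lg Lh; apply: coord_L2_01 => i.
rewrite (_ : (fun t => _) = (fun t => g t ord0 i - h t ord0 i)).
  by apply: sqintB; exact: L2_01_coord.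
by apply/funext => t; rewrite !mxE.
Qed.

Lemma near_path_mid gamma (S e e' : R) p p' : near_path gamma S e p ->
  near_path gamma S e' p' ->
  near_path gamma S (Num.max e e')
    (fun t => 2^-1 *: (p.1 t + p'.1 t), fun t => 2^-1 *: (p.2 t + p'.2 t)).
Proof.
move=> [c w E D] [c' w' E' D']; split => /=.
- move=> x; apply: cvgZr; apply: cvgD; [exact: c|exact: c'].
- exact: weak_derivative_mid.
- have := energy_mid w.1 w'.1; have := energy_ge0 (fun t => p.2 t - p'.2 t).
  lra.
- move=> t t01.
  have -> : 2^-1 *: (p.1 t + p'.1 t) - gamma t =
      2^-1 *: ((p.1 t - gamma t) + (p'.1 t - gamma t)).
    apply/matrixP => i j; rewrite !mxE; lra.
  rewrite normrZ ger0_norm ?invr_ge0//.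
  have := ler_normD (p.1 t - gamma t) (p'.1 t - gamma t).
  have := D t t01; have := D' t t01.
  have : e <= Num.max e e' by rewrite le_max lexx.
  have : e' <= Num.max e e' by rewrite le_max lexx orbT.
  lra.
Qed.

Lemma within_uniform_limit gamma :
  (forall e : R, 0 < e -> exists2 eta : R -> 'rV[R]_d, {within `[0, 1], continuous eta} &
    forall t : R, t \in `[0, 1] -> `|eta t - gamma t| <= e) ->
  {within `[0, 1], continuous gamma}.
Proof.
move=> H; apply/within01P => a a01 e e0.
have e40 : 0 < e / 4 by rewrite divr_gt0.
have [eta /within01P c D] := H _ e40.
have [del del0 h] := c a a01 _ e40; exists del => // x x01 xa.
have := h x x01 xa; have := D x x01; have := D a a01.
rewrite (_ : gamma x - gamma a =
  (eta x - eta a) + ((eta a - gamma a) - (eta x - gamma x))); last first.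
  by apply/matrixP => i j; rewrite !mxE; lra.
move=> h1 h2 h3; apply: (le_lt_trans (ler_normD _ _)).
have := ler_normB (eta a - gamma a) (eta x - gamma x).
by lra.
Qed.

(* Near-minimisers of the energy in shrinking uniform neighbourhoods of the
   limit are Cauchy by the parallelogram identity, because those
   neighbourhoods are convex. *)
Theorem weak_derivative_limit gamma (S : R) :
  (forall e : R, 0 < e -> exists p, near_path gamma S e p) ->
  {within `[0, 1], continuous gamma} /\
  exists2 g, weak_derivative gamma g & energy g <= S.
Proof.
move=> near_ex.
have cgamma : {within `[0, 1], continuous gamma}.
  apply: within_uniform_limit => e e0; have [p [c _ _ D]] := near_ex e e0.
  by exists p.1.
split => //.
pose En e := [set energy p.2 | p in near_path gamma S e].
have hEn e : 0 < e -> has_inf (En e).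
  move=> e0; have [p hp] := near_ex e e0; split; first by exists (energy p.2), p.
  by exists 0 => _ [q _ <-]; exact: energy_ge0.
have inf_le e p : near_path gamma S e p -> inf (En e) <= energy p.2.
  move=> hp; apply: ge_inf; last by exists p.
  by exists 0 => _ [q _ <-]; exact: energy_ge0.
(* [inf (En e)] grows as [e] decreases; [I] is its limit at 0, the relaxed energy of [gamma]. *)
pose I := sup [set inf (En e) | e in [set e | 0 < e]].
have hI : has_sup [set inf (En e) | e in [set e | 0 < e]].
  split; first by exists (inf (En 1)), 1 => //=; exact: ltr01.
  exists S => _ [e /= e0 <-]; have [p hp] := near_ex e e0.
  by apply: (le_trans (inf_le _ _ hp)); case: hp.
have le_I e : 0 < e -> inf (En e) <= I.
  by move=> e0; apply: ub_le_sup; [case: hI|exists e].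
pose q j : R := 2^-1 ^+ j.
have q0 j : 0 < q j by rewrite exprn_gt0// invr_gt0.
have /choice[ep hep] j : exists ep : R * ((R -> 'rV[R]_d) * (R -> 'rV[R]_d)),
    [/\ 0 < ep.1, ep.1 <= q j, I - q j ^+ 2 < inf (En ep.1),
      near_path gamma S ep.1 ep.2 & energy ep.2.2 < I + q j ^+ 2].
  have qj2 : 0 < q j ^+ 2 by rewrite exprn_gt0.
  have Iq : I - q j ^+ 2 < I by lra.
  have [_ [e /= e0 <-] Ie] := sup_gt hI.1 Iq.
  (* Cutting the radius at [q j] makes the competitors converge uniformly to [gamma], and a smaller
     radius can only raise the infimum. *)
  have m0 : 0 < Num.min e (q j) by rewrite lt_min e0 q0.
  have [_ [p hp <-] pI] := inf_adherent qj2 (hEn _ m0).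
  exists (Num.min e (q j), p); split => //=.
  - by rewrite ge_min lexx orbT.
  - apply: (lt_le_trans Ie); apply: lb_le_inf; first by case: (hEn _ m0).
    move=> _ [p' [c w E D] <-]; apply: inf_le; split => // t t01.
    by apply: (le_trans (D t t01)); rewrite ge_min lexx.
  - by apply: (lt_le_trans pI); rewrite lerD2r le_I.
pose eta j := (ep j).2.1; pose v j := (ep j).2.2.
have Lv j : L2_01 (v j) by have [_ _ _ [_ []]] := hep j.
(* The midpoint of two successive competitors stays in the larger of the two neighbourhoods, so its
   energy is at least I - q^2, while both competitors have energy at most I + q^2. The parallelogram
   identity leaves 4 (I + q^2) - 4 (I - q^2) = 8 q^2. *)
have cauchy j : energy (fun t => v j.+1 t - v j t) <= 8 * q j ^+ 2.
  have [e0 eq Ie np Ee] := hep j; have [e0' eq' Ie' np' Ee'] := hep j.+1.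
  have qS : q j.+1 = q j / 2 by rewrite /q exprSr.
  have q2 : q j.+1 ^+ 2 <= q j ^+ 2.
    by rewrite ler_sqr ?nnegrE ?ltW//; have := q0 j; lra.
  have := energy_mid (Lv j.+1) (Lv j).
  have : I - q j ^+ 2 <= energy (fun t => 2^-1 *: (v j.+1 t + v j t)).
    have := inf_le _ _ (near_path_mid np' np); rewrite maxEle.
    rewrite -/(v j) -/(v j.+1) => h; case: ifP h => _ /= h.
      apply: (le_trans _ h); apply: ltW; exact: Ie.
    apply: (le_trans _ h); apply: ltW; apply: le_lt_trans Ie'; lra.
  move: Ee Ee'; rewrite -/(v j) -/(v j.+1); clear -q2; lra.
have ceta j : {within `[0, 1], continuous (eta j)} by have [_ _ _ []] := hep j.
have weta j : weak_derivative (eta j) (v j) by have [_ _ _ []] := hep j.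
have Deta j (t : R) : t \in `[0, 1] -> `|eta j t - gamma t| <= q j.
  by move=> t01; have [_ eq _ [_ _ _ D] _] := hep j; exact: le_trans (D t t01) eq.
have cq : q j @[j --> \oo] --> (0 : R).
  by apply: cvg_expr; rewrite ger0_norm ?invr_ge0// invf_lt1// ltr1n.
have coordB (u w : 'rV[R]_d) i : u ord0 i - w ord0 i = (u - w) ord0 i.
  by rewrite !mxE.
have /choice[G hG] i : exists g : R -> R, [/\ measurable_fun `[(0 : R), 1] g,
    {ae mu, forall t, t \in `[(0 : R), 1] -> v j t ord0 i @[j --> \oo] --> g t} &
    forall phi, C1c_01 phi -> \int[mu]_(t in `[0, 1]) (gamma t ord0 i * derive1 phi t) =
      - \int[mu]_(t in `[0, 1]) (g t * phi t)].
  apply: (@scalar_weak_limit (fun t => gamma t ord0 i) (fun j t => eta j t ord0 i)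
    (fun j t => v j t ord0 i)).
  - exact: within_coord.
  - by move=> j; exact: weak_derivative_coord.
  - move=> e e0; near=> j => t t01.
    rewrite coordB; apply: (le_trans (coord_le_norm _ _)).
    apply: (le_trans (Deta j t t01)).
    by near: j; apply: (cvgr_le _ cq).
  - move=> j; apply: le_trans (cauchy j); apply: int01_le.
    + exact: (sqintB (L2_01_coord i (Lv j.+1)) (L2_01_coord i (Lv j))).2.
    + exact: (L2_01B (Lv j.+1) (Lv j)).2.
    + by move=> t _; rewrite coordB; exact: coord_le_enorm.
pose g t : 'rV[R]_d := \row_i G i t.
have gE i : (fun t => g t ord0 i) = G i by apply/funext => t; rewrite mxE.
have mg i : measurable_fun `[(0 : R), 1] (fun t => g t ord0 i) by rewrite gE; case: (hG i).
have [||||||ig gS] := @fatou01 _ (fun j t => enorm (v j t) ^+ 2) (fun t => enorm (g t) ^+ 2) S.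
- by move=> j; exact: (Lv j).2.
- exact: measurable_enorm_sq.
- by move=> *; exact: sqr_ge0.
- by move=> *; exact: sqr_ge0.
- have := @filter_forall _ _ (fun i t => t \in `[(0 : R), 1] -> v j t ord0 i @[j --> \oo] --> G i t)
    _ (ae_filter_ringOfSetsType mu) (fun i => let: And3 _ h _ := hG i in h).
  move=> H; apply: (@filterS _ _ (ae_filter_ringOfSetsType mu) _ _ _ H) => t h t01.
  rewrite enorm_sq; rewrite (_ : (fun j => _) = (fun j => \sum_(i < d) v j t ord0 i ^+ 2)).
    apply: cvg_big => [|i _]; first exact: add_continuous.
    by rewrite mxE; apply: cvgM; exact: h.
  by apply/funext => j; rewrite enorm_sq.
- by move=> j; have [_ _ _ []] := hep j.
exists g => //; split; first by split.
move=> phi Cphi i; have [_ _ /(_ phi Cphi) ->] := hG i.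
by congr (- _); apply: eq_Rintegral => t _; rewrite mxE.
Unshelve. all: by end_near. Qed.

End VectorPaths.

(** * Uniqueness, Hoelder bound and lower semicontinuity for vector paths *)

Section UniquenessHoelder.
Context {R : realType} {d : nat}.
Notation mu := (@lebesgue_measure R).
Implicit Types (g h gamma eta : R -> 'rV[R]_d).

Lemma weak_derivative_unique gamma g h : {within `[0, 1], continuous gamma} ->
  weak_derivative gamma g -> weak_derivative gamma h ->
  {ae mu, forall t, t \in `[(0 : R), 1] -> g t = h t}.
Proof.
move=> cg wg wh.
have H := @filter_forall _ _ (fun i t => t \in `[(0 : R), 1] -> g t ord0 i = h t ord0 i)
    _ (ae_filter_ringOfSetsType mu) (fun i => weak_unique (weak_derivative_coord i cg wg)
      (weak_derivative_coord i cg wh)).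
apply: (@filterS _ _ (ae_filter_ringOfSetsType mu) _ _ _ H) => t e t01.
by apply/rowP => i; exact: e.
Qed.

Lemma energy_ae g h : L2_01 g -> L2_01 h ->
  {ae mu, forall t, t \in `[(0 : R), 1] -> g t = h t} -> energy g = energy h.
Proof.
move=> Lg Lh gh; apply: int01_ae.
- exact: measurable_enorm_sq Lg.1.
- exact: measurable_enorm_sq Lh.1.
- by apply: (@filterS _ _ (ae_filter_ringOfSetsType mu) _ _ _ gh) => t e t01; rewrite e.
Qed.

Lemma energy_unique gamma g h : {within `[0, 1], continuous gamma} ->
  weak_derivative gamma g -> weak_derivative gamma h -> energy g = energy h.
Proof.
by move=> cg wg wh; apply: energy_ae wg.1 wh.1 (weak_derivative_unique cg wg wh).
Qed.

Lemma path_hoelder gamma g (s t : R) : {within `[0, 1], continuous gamma} ->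
  weak_derivative gamma g -> 0 <= s -> s <= t -> t <= 1 ->
  `|gamma t - gamma s| <= Num.sqrt ((t - s) * energy g).
Proof.
move=> cg wg s0 st t1; apply: norm_le_coord => [|i]; first exact: sqrtr_ge0.
rewrite -ler_sqr ?nnegrE ?sqrtr_ge0// real_normK ?num_real//.
rewrite sqr_sqrtr; last by rewrite mulr_ge0 ?subr_ge0// energy_ge0.
have -> : (gamma t - gamma s) ord0 i = gamma t ord0 i - gamma s ord0 i by rewrite !mxE.
apply: (le_trans (weak_hoelder (weak_derivative_coord i cg wg) s0 st t1)).
rewrite ler_wpM2l ?subr_ge0//; apply: int01_le.
- exact: (L2_01_coord i wg.1).2.
- exact: wg.1.2.
- by move=> x _; exact: coord_le_enorm.
Qed.

(** Otherwise paths arbitrarily close to [gamma] have energy below energy g - e, and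
    [weak_derivative_limit] gives [gamma] a weak derivative of at most that energy, against
    uniqueness. *)
Lemma energy_lsc gamma g : {within `[0, 1], continuous gamma} ->
  weak_derivative gamma g -> forall e : R, 0 < e -> exists2 del : R, 0 < del &
  forall eta h, {within `[0, 1], continuous eta} -> weak_derivative eta h ->
    (forall t : R, t \in `[0, 1] -> `|eta t - gamma t| <= del) ->
    energy g - e <= energy h.
Proof.
move=> cg wg e e0; apply: contrapT => N.
have [|_ [g' wg' Eg']] := @weak_derivative_limit _ _ gamma (energy g - e).
  move=> del del0; apply: contrapT => N'; apply: N; exists del => // eta h ce we D.
  rewrite leNgt; apply/negP => lt; apply: N'; exists (eta, h); split => //=.
  exact: ltW.
by have := energy_unique cg wg wg'; lra.
Qed.

End UniquenessHoelder.

(** * The path space *)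

Section PathSpaceDistance.
Context {R : realType} {d : nat} {r K : {posnum R}}.
Notation mu := (@lebesgue_measure R).
Implicit Types (gamma eta : Omega d r K).

Lemma path_spec gamma : path_set r%:num K%:num (val gamma).
Proof. exact: set_mem (valP gamma). Qed.

Lemma path_continuous gamma : {within `[0, 1], continuous (val gamma)}.
Proof. by have [[]] := path_spec gamma. Qed.

Lemma path_velocity gamma : weak_derivative (val gamma) (velocity (val gamma)).
Proof. by apply: getPex; have [[]] := path_spec gamma. Qed.

Definition kinetic gamma : R := energy (velocity (val gamma)).

Lemma kinetic_ge0 gamma : 0 <= kinetic gamma.
Proof. exact: energy_ge0. Qed.

Lemma kinetic_le gamma : kinetic gamma <= K%:num.
Proof.
have [_ _ [g wg]] := path_spec gamma.
by rewrite /kinetic (energy_unique (@path_continuous gamma) (path_velocity gamma) wg).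
Qed.

Lemma path_out gamma t : t \notin `[0, 1] -> val gamma t = 0.
Proof. by have [[_ + _] _ _] := path_spec gamma; apply. Qed.

Lemma path_norm gamma t : `|val gamma t| <= r%:num.
Proof.
have [t01|t01] := boolP (t \in `[0, 1]); last by rewrite path_out// normr0.
apply: (le_trans (norm_le_enorm _)).
by have [_ + _] := path_spec gamma; exact.
Qed.

(** Measured in the sup norm of the row vectors, not the Euclidean one. The supremum runs over the
    whole line, both paths being 0 off [0, 1]. *)
Definition udist gamma eta : R :=
  sup (range (fun t => `|val gamma t - val eta t|)).

Lemma udist_ge gamma eta t : `|val gamma t - val eta t| <= udist gamma eta.
Proof.
apply: ub_le_sup; last by exists t.
exists (r%:num + r%:num) => _ [s _ <-].
by apply: (le_trans (ler_normB _ _)); rewrite lerD// path_norm.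
Qed.

Lemma udist_le gamma eta (e : R) :
  (forall t : R, t \in `[0, 1] -> `|val gamma t - val eta t| <= e) ->
  udist gamma eta <= e.
Proof.
move=> h; apply: ge_sup; first by exists `|val gamma 0 - val eta 0|, 0.
move=> _ [t _ <-]; have [/h//|t01] := boolP (t \in `[0, 1]).
rewrite !path_out// subrr normr0.
by apply: le_trans (h 0 _); rewrite ?in_itv/= ?lexx ?ler01.
Qed.

Lemma udist_ge0 gamma eta : 0 <= udist gamma eta.
Proof. by apply: le_trans (udist_ge gamma eta 0). Qed.

Lemma udistC gamma eta : udist gamma eta = udist eta gamma.
Proof.
rewrite /udist (_ : (fun t => _) = (fun t => `|val eta t - val gamma t|))//.
by apply/funext => t; rewrite distrC.
Qed.

Lemma udistxx gamma : udist gamma gamma = 0.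
Proof.
apply/eqP; rewrite eq_le udist_ge0 andbT; apply: udist_le => t _.
by rewrite subrr normr0.
Qed.

Lemma udist_triangle gamma eta xi : udist gamma xi <= udist gamma eta + udist eta xi.
Proof.
apply: udist_le => t _; apply: (le_trans _ (lerD (udist_ge gamma eta t) (udist_ge eta xi t))).
by apply: ler_distD.
Qed.

(** The pointwise limit of the coordinates is a uniform limit; [weak_derivative_limit] with S = K
    makes it a path of the same space, and the ball constraint passes to the limit pointwise. *)
Lemma udist_complete (x_ : nat -> Omega d r K) :
  (forall e : R, 0 < e -> exists n0, forall m n, (n0 <= m)%N -> (n0 <= n)%N ->
    udist (x_ m) (x_ n) <= e) ->
  exists x, forall e : R, 0 < e -> exists n0, forall n, (n0 <= n)%N -> udist (x_ n) x <= e.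
Proof.
move=> cauchy.
have cv t i : cvgn (fun n => val (x_ n) t ord0 i).
  apply/cauchy_cvgP/cauchy_exP => e e0.
  have e20 : 0 < e / 2 by rewrite divr_gt0.
  have [n0 h] := cauchy (e / 2) e20.
  exists (val (x_ n0) t ord0 i); exists n0 => // n /= n0n.
  rewrite /ball/=; apply: (@le_lt_trans _ _ (e / 2)); last by lra.
  apply: le_trans (h n0 n (leqnn _) n0n); apply: le_trans (udist_ge _ _ t).
  by have := coord_le_norm (val (x_ n0) t - val (x_ n) t) i; rewrite !mxE.
pose x t : 'rV[R]_d := \row_i limn (fun n => val (x_ n) t ord0 i).
have unif (e : R) : 0 < e -> exists n0, forall n t, (n0 <= n)%N -> `|val (x_ n) t - x t| <= e.
  move=> e0; have [n0 h] := cauchy e e0; exists n0 => n t n0n.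
  apply: norm_le_coord => [|i]; first exact: ltW.
  have c : `|val (x_ n) t ord0 i - val (x_ m) t ord0 i| @[m --> \oo] -->
      `|(val (x_ n) t - x t) ord0 i|.
    by rewrite !mxE; apply: cvg_norm; apply: cvgB; [exact: cvg_cst|exact: cv].
  rewrite -(cvg_lim _ c)//; apply: limr_le; first exact: (cvgP _ c).
  near=> m; have n0m : (n0 <= m)%N by near: m; exact: nbhs_infty_ge.
  apply: le_trans (h n m n0n n0m); apply: le_trans (udist_ge _ _ t).
  by have := coord_le_norm (val (x_ n) t - val (x_ m) t) i; rewrite !mxE.
have [|cx [g wg Eg]] := @weak_derivative_limit _ _ x K%:num.
  move=> e e0; have [n0 h] := unif e e0.
  exists (val (x_ n0), velocity (val (x_ n0))); split => /=.
  - exact: path_continuous.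
  - exact: path_velocity.
  - exact: kinetic_le.
  - by move=> t _; exact: h.
have px : path_set r%:num K%:num x.
  split; last by exists g.
    split => // [t t01|]; last by exists g.
    apply/rowP => i; rewrite !mxE; under eq_fun do rewrite path_out// mxE.
    exact: lim_cst.
  move=> t t01; rewrite /eball/= -ler_sqr ?nnegrE ?sqrtr_ge0// enorm_sq.
  have c : \sum_(i < d) val (x_ n) t ord0 i ^+ 2 @[n --> \oo] --> \sum_(i < d) x t ord0 i ^+ 2.
    apply: cvg_big => [|i _]; first exact: add_continuous.
    by rewrite mxE; apply: cvgM; exact: cv.
  rewrite -(cvg_lim _ c)//; apply: limr_le; first exact: (cvgP _ c).
  near=> n; rewrite -enorm_sq ler_sqr ?nnegrE ?sqrtr_ge0//.
  by have [_ h _] := path_spec (x_ n); exact: h.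
exists (exist _ x (mem_set px) : Omega d r K) => e e0.
have [n0 h] := unif e e0; exists n0 => n n0n.
by apply: udist_le => t _ /=; exact: h.
Unshelve. all: by end_near. Qed.

Lemma Lnorm2_01 (g : R -> 'rV[R]_d) : L2_01 g ->
  Lnorm_01 2%:E g = (Num.sqrt (energy g))%:E.
Proof.
move=> Lg; rewrite /Lnorm_01 unlock.
rewrite (_ : (\int[mu]_x _)%E = (energy g)%:E).
  by rewrite poweR_EFin powR12_sqrt// energy_ge0.
rewrite /energy /Rintegral fineK; last exact: (integrable_fin_num _ Lg.2).
rewrite [RHS]integral_mkcond; apply: eq_integral => t _.
rewrite !patchE; case: ifP => _; last by rewrite abse0 poweR0r// pnatr_eq0.
rewrite /= ger0_norm ?sqrtr_ge0//.
by rewrite powR_mulrn// sqrtr_ge0.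
Qed.

Lemma Lnormy_01_le (g : R -> 'rV[R]_d) (a : R) : 0 <= a ->
  (forall t : R, t \in `[0, 1] -> enorm (g t) <= a) -> (Lnorm_01 +oo g <= a%:E)%E.
Proof.
move=> a0 ga; rewrite /Lnorm_01 unlock; case: ifP => _; last by rewrite lee_fin.
apply/ess_supP; apply: aeW => t; rewrite /= patchE; case: ifPn => t01.
  by rewrite /= lee_fin ger0_norm ?sqrtr_ge0// ga//; rewrite inE in t01.
by rewrite abse0 lee_fin.
Qed.

Lemma enorm_le (v : 'rV[R]_d) (a : R) : `|v| <= a -> enorm v <= Num.sqrt d%:R * a.
Proof.
move=> va; have a0 : 0 <= a by apply: le_trans va.
rewrite -ler_sqr ?nnegrE ?sqrtr_ge0 ?mulr_ge0 ?sqrtr_ge0//.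
apply: (le_trans (enorm_sq_le v)); rewrite exprMn sqr_sqrtr// ler_wpM2l//.
by rewrite ler_sqr ?nnegrE.
Qed.

Lemma path_dist_le gamma eta (a b : R) : 0 <= a -> 0 <= b -> udist gamma eta <= a ->
  energy (fun t => velocity (val gamma) t - velocity (val eta) t) <= b ^+ 2 ->
  (path_dist (val gamma) (val eta) <= (Num.sqrt d%:R * a + b)%:E)%E.
Proof.
move=> a0 b0 Da Eb; rewrite /path_dist [leRHS]EFinD; apply: leeD.
  apply: Lnormy_01_le => [|t t01]; first by rewrite mulr_ge0// sqrtr_ge0.
  by apply: enorm_le; apply: le_trans Da; exact: udist_ge.
rewrite Lnorm2_01; last first.
  exact: L2_01B (path_velocity gamma).1 (path_velocity eta).1.
by rewrite lee_fin -(ger0_norm b0) -sqrtr_sqr ler_wsqrtr.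
Qed.

Lemma measureT_gt0 : (0 < mu setT)%E.
Proof.
apply: (@lt_le_trans _ _ (mu `[0%R, 1%R]%classic)); first by rewrite measure_01 lte01.
by apply: le_measure; rewrite ?inE.
Qed.

(** The essential supremum controls the difference only almost everywhere. By continuity an excess
    at one time would persist on an interval of positive length. *)
Lemma udist_lt gamma eta (e : R) : (path_dist (val gamma) (val eta) < e%:E)%E ->
  udist gamma eta <= e.
Proof.
move=> de; apply: udist_le => t0 t01; rewrite leNgt; apply/negP => et.
have : (Lnorm_01 +oo (val gamma \- val eta)%R < e%:E)%E.
  apply: le_lt_trans de; rewrite /path_dist -[leLHS]adde0 leeD2l//.
  exact: Lnorm_ge0.
rewrite /Lnorm_01 unlock measureT_gt0 => /ltW/ess_supP [N [mN N0 sub]].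
have /within01P cont : {within `[0, 1], continuous (fun t => val gamma t - val eta t)}.
  by move=> x; apply: cvgB; exact: path_continuous.
have m0 : 0 < `|val gamma t0 - val eta t0| - e by rewrite subr_gt0.
have [del del0 H] := cont t0 t01 _ m0.
(* The neighbourhood of [t0] is clipped to [0, 1]; it keeps positive length even when [t0] is an
   endpoint. *)
pose a := Num.max 0 (t0 - del); pose b := Num.min 1 (t0 + del).
have /andP[t00 t10] : 0 <= t0 <= 1 by move: t01; rewrite in_itv.
have ab : a < b.
  rewrite /a /b gt_max !lt_min; move: t00 t10 del0; clear.
  by move=> *; apply/andP; split; apply/andP; split; lra.
have mab : (mu `]a, b[%classic = (b - a)%:E)%E by rewrite lebesgue_measure_itv/= lte_fin ab -EFinD.
have : (mu `]a, b[%classic <= mu N)%E.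
  apply: le_measure; rewrite ?inE//.
  move=> t /=; rewrite in_itv/= => /andP[]; rewrite /a /b gt_max lt_min.
  move=> /andP[ta0 ta1] /andP[tb0 tb1]; apply: sub => /=.
  have tt : t \in `[0, 1] by rewrite in_itv/=; apply/andP; split; apply: ltW.
  rewrite patchE ifT ?inE//= lee_fin ger0_norm ?sqrtr_ge0//.
  apply/negP; rewrite -ltNge; apply: (lt_le_trans _ (norm_le_enorm _)).
  have td : `|t - t0| < del.
    by rewrite ltr_norml; move: ta1 tb1; clear => *; apply/andP; split; lra.
  have := H t tt td; set u := _ - _; set w := _ - _ in et * => h.
  have := ler_distD u w 0; rewrite !subr0 (distrC w u).
  by move: h; clear; lra.
by rewrite mab N0 lee_fin; rewrite leNgt subr_gt0 ab.
Qed.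

(** The uniform topology is coarser than that of [path_dist], so its open sets are among the
    generators. *)
Lemma path_openP (U : set (Omega d r K)) :
  (forall gamma, U gamma -> exists2 e : R, 0 < e &
    forall eta, udist gamma eta <= e -> U eta) -> measurable U.
Proof.
move=> oU; apply: sub_sigma_algebra => gamma Ug.
have [e e0 h] := oU gamma Ug; exists e => // eta /udist_lt; exact: h.
Qed.

End PathSpaceDistance.

(** * Lipschitz regularisation of semicontinuous functions *)

Section MoreauEnvelope.
Context {R : realType} {T : Type} (D : T -> T -> R) (g : T -> R).
Hypothesis D_ge0 : forall x y, 0 <= D x y.
Hypothesis Dxx : forall x, D x x = 0.
Hypothesis D_tri : forall x y z, D x z <= D x y + D y z.
Hypothesis g_ge0 : forall x, 0 <= g x.
Hypothesis g_lsc : forall x (e : R), 0 < e -> exists2 del : R, 0 < del &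
  forall y, D x y <= del -> g x - e <= g y.

(* Moreau-Yosida regularisation: its Lipschitz values increase to the merely
   semicontinuous [g], which makes the integral of [g] semicontinuous under
   weak limits. *)
Definition envelope (n : nat) (x : T) : R := inf (range (fun y => g y + n%:R * D x y)).

Lemma envelope_has_inf n x : has_inf (range (fun y => g y + n%:R * D x y)).
Proof.
split; first by exists (g x + n%:R * D x x), x.
by exists 0 => _ [y _ <-]; rewrite addr_ge0 ?mulr_ge0.
Qed.

Lemma envelope_le_at n x y : envelope n x <= g y + n%:R * D x y.
Proof. by apply: ge_inf; [case: (envelope_has_inf n x)|exists y]. Qed.

Lemma envelope_le n x : envelope n x <= g x.
Proof. by have := envelope_le_at n x x; rewrite Dxx mulr0 addr0. Qed.

Lemma envelope_ge n x c : (forall y, c <= g y + n%:R * D x y) -> c <= envelope n x.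
Proof.
move=> h; apply: lb_le_inf; first by case: (envelope_has_inf n x).
by move=> _ [y _ <-].
Qed.

Lemma envelope_ge0 n x : 0 <= envelope n x.
Proof. by apply: envelope_ge => y; rewrite addr_ge0 ?mulr_ge0. Qed.

Lemma envelope_lipschitz n x y : envelope n x <= envelope n y + n%:R * D x y.
Proof.
rewrite -lerBlDr; apply: envelope_ge => z.
rewrite lerBlDr; apply: (le_trans (envelope_le_at n x z)).
by rewrite -addrA -mulrDr lerD2l ler_wpM2l// addrC.
Qed.

Lemma envelope_cvg x : envelope n x @[n --> \oo] --> g x.
Proof.
apply/cvgrPdist_le => e e0; have [del del0 h] := g_lsc x e0.
near=> n.
(* For such [n] the penalty alone exceeds [g x] at distance more than [del]; closer points are
   handled by semicontinuity. *)
have nd : g x <= del * n%:R by near: n; exact: near_ge_natmul.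
rewrite ger0_norm ?subr_ge0 ?envelope_le// lerBlDr -lerBlDl.
apply: envelope_ge => y; have [yd|yd] := leP (D x y) del.
  by apply: (le_trans (h y yd)); rewrite lerDl mulr_ge0.
have := ler_wpM2l (ler0n R n) (ltW yd); have := g_ge0 y.
rewrite mulrC in nd; lra.
Unshelve. all: by end_near. Qed.

Lemma envelope_unif n : (forall x y, D x y = D y x) -> unif_for D (envelope n).
Proof.
move=> DC e e0; exists (e / n.+1%:R); first by rewrite divr_gt0.
move=> x y xy; have nD : n%:R * D x y <= e.
  apply: (@le_trans _ _ (n.+1%:R * D x y)); first by rewrite ler_wpM2r// ler_nat.
  by rewrite mulrC -ler_pdivlMr.
have := envelope_lipschitz n x y; have := envelope_lipschitz n y x.
by rewrite (DC y x) ler_norml => *; apply/andP; split; lra.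
Qed.

End MoreauEnvelope.

(** * Coding of the path space and measurability of maps into it *)

Section PathSpaceMeasurability.
Context {R : realType} {d : nat} {r K : {posnum R}}.
Notation mu := (@lebesgue_measure R).
Notation Om := (Omega d r K).
Implicit Types (gamma eta : Om).

Lemma lipschitz_unif (H : Om -> R) (C : R) :
  (forall gamma eta, `|H gamma - H eta| <= C * udist gamma eta) -> unif_for udist H.
Proof.
move=> HC e e0; have C0 : 0 < `|C| + 1 by rewrite ltr_wpDl.
exists (e / (`|C| + 1)); first by rewrite divr_gt0.
move=> x y xy; apply: (le_trans (HC x y)).
apply: (@le_trans _ _ ((`|C| + 1) * udist x y)).
  by rewrite ler_wpM2r ?udist_ge0//; have := ler_norm C; lra.
by rewrite mulrC -ler_pdivlMr.
Qed.

Lemma udist_unif gamma : unif_for udist (udist gamma).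
Proof.
apply: (@lipschitz_unif _ 1) => x y; rewrite mul1r ler_norml.
have := udist_triangle gamma y x; have := udist_triangle gamma x y.
rewrite (udistC y x); move: (udist _ _) (udist _ _) (udist _ _) => a b c *.
by apply/andP; split; lra.
Qed.

Lemma unif_path_measurable (H : Om -> R) : unif_for udist H -> measurable_fun setT H.
Proof.
move=> uH; apply: (measurability _ (RGenOInfty.measurableE R)).
move=> _ [_ [c ->] <-]; rewrite setTI; apply: path_openP => gamma /=.
rewrite in_itv/= andbT -subr_gt0; set e := _ - c => e0.
have e20 : 0 < e / 2 by rewrite divr_gt0.
have [del del0 h] := uH _ e20; exists del => // eta /h ge.
rewrite in_itv/= andbT; move: ge; rewrite ler_norml => /andP[_].
by move: e0; rewrite /e; clear; lra.
Qed.

Lemma kinetic_lsc gamma (e : R) : 0 < e -> exists2 del : R, 0 < del &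
  forall eta, udist gamma eta <= del -> kinetic gamma - e <= kinetic eta.
Proof.
move=> e0.
have [del del0 h] := energy_lsc (@path_continuous _ _ _ _ gamma) (path_velocity gamma) e0.
exists del => // eta ge; apply: h (path_velocity eta) _; first exact: path_continuous.
by move=> t _; rewrite distrC; apply: le_trans (udist_ge _ _ t) ge.
Qed.

Definition kinetic_env := envelope (@udist R d r K) (@kinetic R d r K).

Lemma kinetic_env_unif n : unif_for udist (kinetic_env n).
Proof.
apply: envelope_unif.
- exact: udist_ge0.
- exact: udist_triangle.
- exact: kinetic_ge0.
- exact: udistC.
Qed.

Lemma kinetic_env_cvg gamma : kinetic_env n gamma @[n --> \oo] --> kinetic gamma.
Proof.
apply: envelope_cvg.
- exact: udist_ge0.
- exact: udistxx.
- exact: kinetic_ge0.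
- exact: kinetic_lsc.
Qed.

Lemma kinetic_measurable : measurable_fun setT (@kinetic R d r K).
Proof.
apply: (@measurable_fun_cvg _ _ _ _ kinetic_env) => [n|gamma _].
  exact: unif_path_measurable (kinetic_env_unif n).
exact: kinetic_env_cvg.
Qed.

Lemma parallelogram_bound (m D k k' B : R) : 0 <= B -> 4 * m + D = 2 * k + 2 * k' ->
  k - B / 8 <= m -> k' <= k + B / 8 -> D <= B.
Proof. lra. Qed.

Lemma half_sumB (u w : 'rV[R]_d) : 2^-1 *: (u + w) - u = 2^-1 *: (w - u).
Proof.
apply/matrixP => i j; rewrite !mxE; move: (u i j) (w i j) => x y.
by clear; lra.
Qed.

(* Uniform convergence together with convergence of the energies implies
   convergence in W^{1,2}: this is how the strong topology is seen from the
   uniform one. *)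
Lemma path_open_udist (U : set Om) gamma : path_open U -> U gamma ->
  exists2 e : R, 0 < e & forall eta, udist gamma eta <= e ->
    kinetic eta <= kinetic gamma + e -> U eta.
Proof.
move=> oU Ug; have [e e0 h] := oU gamma Ug.
(* A uniform distance of b / C, with sqrt d from comparing the two norms, and an L^2 distance of [b]
   between the velocities give a [path_dist] of at most 2 b = e / 2. The slack a = b^2 / 8 is the
   one expected by [parallelogram_bound]. *)
pose C := Num.sqrt d%:R + 1 : R.
have C0 : 0 < C by rewrite ltr_wpDl ?sqrtr_ge0.
pose b := e / 4.
have b0 : 0 < b by rewrite divr_gt0.
pose a := b ^+ 2 / 8.
have a0 : 0 < a by rewrite divr_gt0// exprn_gt0.
have [del del0 hd] := energy_lsc (@path_continuous _ _ _ _ gamma) (path_velocity gamma) a0.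
exists (Num.min (Num.min del a) (b / C)).
  by rewrite !lt_min del0 a0 divr_gt0.
move=> eta; rewrite !le_min -andbA => /and3P[ud _ ub] ke.
have ka : kinetic eta <= kinetic gamma + a.
  by apply: (le_trans ke); rewrite lerD2l !ge_min lexx orbT.
apply: h.
have mid : kinetic gamma - a <=
    energy (fun t => 2^-1 *: (velocity (val gamma) t + velocity (val eta) t)).
  apply: (hd (fun t => 2^-1 *: (val gamma t + val eta t))).
  - by move=> x; apply: cvgZr; apply: cvgD; exact: path_continuous.
  - apply: weak_derivative_mid; [exact: path_continuous|exact: path_continuous|..];
      exact: path_velocity.
  - move=> t _.
    have -> : 2^-1 *: (val gamma t + val eta t) - val gamma t =
        2^-1 *: (val eta t - val gamma t).
      exact: half_sumB.
    rewrite normrZ ger0_norm ?invr_ge0// distrC.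
    apply: le_trans (le_trans (udist_ge gamma eta t) ud).
    by rewrite ler_piMl// invf_le1// ler1n.
have em := energy_mid (path_velocity gamma).1 (path_velocity eta).1.
have Eb : energy (fun t => velocity (val gamma) t - velocity (val eta) t) <= b ^+ 2.
  exact: parallelogram_bound (sqr_ge0 b) em mid ka.
apply: le_lt_trans (path_dist_le _ (ltW b0) ub Eb) _.
  by rewrite divr_ge0 ?ltW.
rewrite lte_fin; have : Num.sqrt d%:R * (b / C) <= b.
  rewrite mulrCA ler_piMr ?(ltW b0)// ler_pdivrMr// mul1r.
  by rewrite /C lerDl.
by rewrite /b; move: e0; clear => ? ?; lra.
Qed.

(** All threshold tests at all scales, enumerated by [pickle]: coordinate [i] at the grid time j /
    (N + 1) against the level l / (N + 1). Adding [r%:num] makes the coordinate nonnegative, so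
    natural [l] suffice; numbers that code nothing give [false]. *)
Definition path_test (n : nat) gamma : bool :=
  if @unpickle (nat * 'I_d * nat * nat)%type n is Some (N, i, j, l) then
    val gamma (j%:R / N.+1%:R) ord0 i + r%:num <= l%:R / N.+1%:R
  else false.

Lemma eval_coord_unif (t : R) i : unif_for udist (fun gamma => val gamma t ord0 i).
Proof.
apply: (@lipschitz_unif _ 1) => gamma eta; rewrite mul1r.
apply: le_trans (udist_ge gamma eta t).
by have := coord_le_norm (val gamma t - val eta t) i; rewrite !mxE.
Qed.

Lemma measurable_path_test n : measurable_fun setT (path_test n).
Proof.
rewrite /path_test; case: unpickle => [[[[N i] j] l]|]; last exact: measurable_cst.
apply: measurable_fun_ler; last exact: measurable_cst.
apply: measurable_funD; last exact: measurable_cst.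
exact: unif_path_measurable (eval_coord_unif _ _).
Qed.

Lemma pre_test n gamma eta m : pre path_test n gamma = pre path_test n eta ->
  (m < n)%N -> path_test m gamma = path_test m eta.
Proof.
elim: n => //= n IH [e1 e2]; rewrite ltnS leq_eqVlt => /orP[/eqP ->//|].
exact: IH.
Qed.

(** Take the least level that [gamma] passes. It is at most [M], so [eta] passes it too, while
    [gamma] fails the level just below: the coordinate of [eta] exceeds that of [gamma] by at most
    one grid step. *)
Lemma coord_test (N M : nat) gamma eta (i : 'I_d) (j : nat) : 2 * r%:num * N.+1%:R <= M%:R ->
  (forall l, (l <= M)%N ->
    path_test (pickle (N, i, j, l)) gamma = path_test (pickle (N, i, j, l)) eta) ->
  val eta (j%:R / N.+1%:R) ord0 i <= val gamma (j%:R / N.+1%:R) ord0 i + N.+1%:R^-1.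
Proof.
set t := j%:R / N.+1%:R => NM same.
have N0 : 0 < N.+1%:R :> R by rewrite ltr0n.
have bd (xi : Om) : `|val xi t ord0 i| <= r%:num.
  exact: le_trans (coord_le_norm (val xi t) i) (path_norm xi t).
have ex : exists l : nat, val gamma t ord0 i + r%:num <= l%:R / N.+1%:R.
  exists M; rewrite ler_pdivlMr//; apply: le_trans NM; rewrite ler_pM2r//.
  by have := bd gamma; rewrite ler_norml => /andP[_]; lra.
case: (ex_minnP ex) => l hl lmin.
have lM : (l <= M)%N.
  apply: lmin; rewrite ler_pdivlMr//; apply: le_trans NM; rewrite ler_pM2r//.
  by have := bd gamma; rewrite ler_norml => /andP[_]; lra.
have := same l lM; rewrite /path_test !pickleK -/t hl => /esym/idP he.
(* At l = 0 there is no level below; then the coordinate of [eta] is at most -r, hence at most that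
   of [gamma]. *)
case: l lmin hl he lM => [|l] lmin hl he lM.
  move: he; rewrite mul0r => he; have := bd gamma; rewrite ler_norml => /andP[h1 _].
  have A (x y rho c : R) : y + rho <= 0 -> - rho <= x -> 0 < c -> y <= x + c.
    by clear => *; lra.
  by apply: A he h1 _; rewrite invr_gt0.
have : ~~ (val gamma t ord0 i + r%:num <= l%:R / N.+1%:R).
  by apply/negP => /lmin; rewrite ltnn.
rewrite -ltNge; move: he; rewrite -natr1 mulrDl mul1r.
have A (x y rho c b : R) : y + rho <= b + c -> b < x + rho -> y <= x + c.
  by clear => *; lra.
exact: A.
Qed.

(** Three contributions of e / 3: the tests make the two paths close at the grid times, and between
    grid times the Hoelder bound with energy at most [K] controls the oscillation of each. *)
Lemma path_test_small (e : R) : 0 < e ->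
  exists n, forall gamma eta, pre path_test n gamma = pre path_test n eta ->
    udist gamma eta <= e.
Proof.
move=> e0.
have e30 : 0 < e / 3 by rewrite divr_gt0.
have [N [N1 NK]] : exists N : nat, N.+1%:R^-1 <= e / 3 /\
    Num.sqrt (N.+1%:R^-1 * K%:num) <= e / 3.
  pose N := Num.bound (3 / e + K%:num / (e / 3) ^+ 2).
  have hN : 3 / e + K%:num / (e / 3) ^+ 2 < N.+1%:R.
    apply: (@lt_le_trans _ _ N%:R); last by rewrite ler_nat.
    by apply: archi_boundP; rewrite addr_ge0// divr_ge0// ?ltW// exprn_gt0.
  have p1 : 0 < 3 / e by rewrite divr_gt0.
  have p2 : 0 <= K%:num / (e / 3) ^+ 2 by rewrite divr_ge0// sqr_ge0.
  have N0 : 0 < N.+1%:R :> R by rewrite ltr0n.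
  exists N; split.
    rewrite -[e / 3]invrK lef_pV2 ?posrE ?invr_gt0// invf_div; apply: ltW; lra.
  rewrite -[leRHS](ger0_norm (ltW e30)) -sqrtr_sqr ler_wsqrtr//.
  rewrite mulrC ler_pdivrMr// mulrC -ler_pdivrMr ?exprn_gt0//; apply: ltW; lra.
have N0 : 0 < N.+1%:R :> R by rewrite ltr0n.
pose M := Num.bound (2 * r%:num * N.+1%:R).
have NM : 2 * r%:num * N.+1%:R <= M%:R.
  by apply/ltW/archi_boundP; rewrite !mulr_ge0.
(* The codes of the tests needed at scale [N]; the grid index goes up to N + 1, which serves t = 1.
   The depth must exceed every such code. *)
pose F (x : 'I_d * 'I_N.+2 * 'I_M.+1) := pickle (N, x.1.1, x.1.2 : nat, x.2 : nat).
exists (\max_x F x).+1 => gamma eta same.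
have test (i : 'I_d) (j l : nat) : (j <= N.+1)%N -> (l <= M)%N ->
    path_test (pickle (N, i, j, l)) gamma = path_test (pickle (N, i, j, l)) eta.
  move=> jN lM; apply: (pre_test same); rewrite ltnS.
  have jN' : (j < N.+2)%N by rewrite ltnS.
  have lM' : (l < M.+1)%N by rewrite ltnS.
  exact: (leq_bigmax (F := F) (i, Ordinal jN', Ordinal lM')).
have grid (i : 'I_d) (j : nat) : (j <= N.+1)%N ->
    `|val gamma (j%:R / N.+1%:R) ord0 i - val eta (j%:R / N.+1%:R) ord0 i| <= e / 3.
  move=> jN; have t1 := coord_test NM (fun l lM => test i j l jN lM).
  have t2 := coord_test NM (fun l lM => esym (test i j l jN lM)).
  have A (x y c b : R) : y <= x + c -> x <= y + c -> c <= b -> `|x - y| <= b.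
    by clear => *; rewrite ler_norml; apply/andP; split; lra.
  exact: A t1 t2 N1.
apply: udist_le => t t01.
have /andP[t0 t1] : 0 <= t <= 1 by move: t01; rewrite in_itv.
pose j := Num.trunc (t * N.+1%:R).
have tN0 : 0 <= t * N.+1%:R by rewrite mulr_ge0.
have /andP[j1 j2] : j%:R <= t * N.+1%:R < j.+1%:R by exact: trunc_itv.
have jN : (j <= N.+1)%N.
  by rewrite -(ler_nat R); apply: (le_trans j1); rewrite ler_piMl.
pose s := j%:R / N.+1%:R : R.
have s0 : 0 <= s by rewrite divr_ge0.
have st : s <= t by rewrite ler_pdivrMr.
have ts : t - s <= N.+1%:R^-1.
  by rewrite lerBlDr -[X in _ <= X + _]mul1r -mulrDl ler_pdivlMr// addrC natr1 ltW.
have osc (xi : Om) : `|val xi t - val xi s| <= e / 3.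
  apply: (le_trans (path_hoelder (@path_continuous _ _ _ _ xi) (path_velocity xi) s0 st t1)).
  apply: le_trans NK; apply: ler_wsqrtr; rewrite ler_pM ?subr_ge0 ?energy_ge0//.
  exact: kinetic_le.
have gs : `|val gamma s - val eta s| <= e / 3.
  apply: norm_le_coord => [|i]; first exact: ltW.
  by rewrite !mxE; exact: grid.
have -> : val gamma t - val eta t = (val gamma t - val gamma s) +
    (val gamma s - val eta s) - (val eta t - val eta s).
  by rewrite addrA subrK opprB addrA subrK.
have o1 := osc gamma; have o2 := osc eta.
apply: (le_trans (ler_normB _ _)).
rewrite (_ : e = e / 3 + e / 3 + e / 3); last by field.
rewrite lerD//; apply: (le_trans (ler_normD _ _)); exact: lerD.
Qed.

(** The energy along [G] is measurable as a limit of its envelopes. By [path_open_udist], a strongly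
    open set is the union of the sets [basic p] that it contains, and there are countably many
    [p]. *)
Lemma measurable_into_path d' (X : measurableType d') (G : X -> Om) :
  (forall H, unif_for udist H -> measurable_fun setT (H \o G)) ->
  measurable_fun setT G.
Proof.
move=> hG.
have mk : measurable_fun setT (@kinetic R d r K \o G).
  apply: (@measurable_fun_cvg _ _ _ _ (fun n => kinetic_env n \o G)).
    by move=> n; apply: hG; exact: kinetic_env_unif.
  by move=> x _; exact: kinetic_env_cvg.
apply: (@measurability _ _ X Om setT G (@path_open R d r K)) => //.
move=> _ [U oU <-]; rewrite setTI.
(* Representatives of the cells: countably many centres, dense for [udist] by [path_test_small]. *)
pose c (w : seq bool) := rep path_test w.
pose basic (p : seq bool * nat * rat) : set Om :=
  [set eta | udist (c p.1.1) eta < p.1.2.+1%:R^-1 /\ kinetic eta < ratr p.2].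
rewrite (_ : G @^-1` U = \bigcup_p (if `[< basic p `<=` U >] then G @^-1` basic p else set0)).
  apply: countable_bigcupT_measurable => // -[[w m] q]; case: ifP => // _.
  rewrite (_ : _ @^-1` _ = [set x | udist (c w) (G x) < m.+1%:R^-1] `&`
    [set x | kinetic (G x) < ratr q])//.
  apply: measurableI.
    rewrite -[X in measurable X]setTI.
    have := hG _ (udist_unif (c w)) measurableT _ (measurable_itv `]-oo, m.+1%:R^-1[).
    by congr (measurable (_ `&` _)); apply/seteqP; split=> x /=; rewrite in_itv.
  rewrite -[X in measurable X]setTI.
  have := mk measurableT _ (measurable_itv `]-oo, ratr q[).
  by congr (measurable (_ `&` _)); apply/seteqP; split=> x /=; rewrite in_itv.
apply/seteqP; split=> [x /= Ux|x [p _]]; last first.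
  by case: ifPn => // /asboolP sub; exact: sub.
have [e e0 h] := path_open_udist oU Ux.
pose m := Num.bound (2 / e).
have m0 : 0 < m.+1%:R^-1 :> R by rewrite invr_gt0 ltr0n.
have me : m.+1%:R^-1 <= e / 2.
  rewrite -[e / 2]invrK lef_pV2 ?posrE ?invr_gt0 ?ltr0n ?divr_gt0// invf_div.
  apply: (@le_trans _ _ m%:R); last by rewrite ler_nat.
  by apply/ltW/archi_boundP; rewrite divr_ge0// ltW.
have [q] := @rat_in_itvoo R (kinetic (G x)) (kinetic (G x) + e / 2)
  (ltr_pwDr (divr_gt0 e0 (ltr0n R 2)) (lexx _)).
rewrite in_itv/= => /andP[q1 q2].
have [n hn] := path_test_small (divr_gt0 m0 (ltr0n R 2)).
set w := pre path_test n (G x).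
have cw : udist (c w) (G x) <= m.+1%:R^-1 / 2 by apply: hn; rewrite /c pre_repE.
have sub : basic (w, m, q) `<=` U.
  move=> eta [/= d1 d2]; apply: h; last first.
    apply/ltW/(lt_le_trans d2)/(le_trans (ltW q2)).
    by rewrite lerD2l ler_pdivrMr// ler_peMr ?(ltW e0)// ler1n.
  apply: (le_trans (udist_triangle _ (c w) _)); rewrite udistC.
  apply: le_trans (lerD (le_trans cw (_ : _ <= m.+1%:R^-1)) (ltW d1)) _.
    by rewrite ler_pdivrMr// ler_peMr ?(ltW m0)// ler1n.
  by apply: le_trans (lerD me me) _; rewrite -splitr.
exists (w, m, q) => //; rewrite asboolT//; split => //=.
by apply: (le_lt_trans cw); rewrite ltr_pdivrMr// ltr_pMr// ltr1n.
Qed.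

Theorem path_compact (U : set_system (probability Om R)) : UltraFilter U ->
  exists Q : probability Om R, forall H, unif_for udist H ->
    (fun P : probability Om R => \int[P]_x H x) @ U --> \int[Q]_x H x.
Proof.
move=> UU; apply: (@ultra_limit_probability _ _ _ udist path_test).
- exact: measurable_path_test.
- exact: path_test_small.
- exact: udist_complete.
- by move=> G; exact: measurable_into_path.
Qed.

End PathSpaceMeasurability.

(** * Limits, images and mixtures of plans *)

Lemma Rintegral_fineK {R : realType} {dT} {T : measurableType dT} (P : probability T R)
    (f : T -> R) (M : R) : measurable_fun setT f -> (forall x, `|f x| <= M) ->
  (\int[P]_x f x)%:E = (\int[P]_x (f x)%:E)%E.
Proof.
move=> mf bf; rewrite /Rintegral fineK//.
exact: integrable_fin_num (bounded_integrable P mf bf).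
Qed.

Section ProbabilityLimits.
Context {R : realType} {dT : measure_display} {T : measurableType dT}.
Implicit Types (P Q : probability T R).

Lemma Rintegral_bounded_cvg P (F : nat -> T -> R) (f : T -> R) (M : R) :
  (forall n, measurable_fun setT (F n)) -> (forall n x, `|F n x| <= M) ->
  (forall x, F n x @[n --> \oo] --> f x) ->
  \int[P]_x F n x @[n --> \oo] --> \int[P]_x f x.
Proof.
move=> mF bF Ff.
have mf : measurable_fun setT f.
  by apply: (measurable_fun_cvg mF) => x _; exact: Ff.
have iM : P.-integrable setT (EFin \o cst M).
  by apply: (@bounded_integrable _ _ _ P _ `|M|).
have [|||||i1 _ c] := @dominated_convergence _ _ _ P setT measurableT
  (fun n => EFin \o F n) (EFin \o f) (EFin \o cst M).
- by move=> n; apply/measurable_EFinP.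
- by apply/measurable_EFinP.
- by apply: aeW => x _; apply: cvg_EFin; [near=> n|exact: Ff].
- exact: iM.
- by apply: aeW => x n _ /=; rewrite lee_fin.
apply: fine_cvg; rewrite /Rintegral fineK//.
by apply: integrable_fin_num i1.
Unshelve. all: by end_near. Qed.

Lemma Rintegral_pushforward {d'} {Y : measurableType d'} (phi : T -> Y) P
    (mu : probability Y R) (h : Y -> R) (M : R) :
  measurable_fun setT phi -> (forall A, measurable A -> pushforward P phi A = mu A) ->
  measurable_fun setT h -> (forall y, `|h y| <= M) ->
  \int[P]_x h (phi x) = \int[mu]_y h y.
Proof.
move=> mphi Pmu mh bh; apply: EFin_inj.
rewrite (Rintegral_fineK mu mh bh) (@Rintegral_fineK _ _ _ P _ M) => [||x]; last 2 first.
- exact: measurableT_comp.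
- exact: bh.
rewrite -[RHS](@eq_measure_integral _ _ _ setT mu (pushforward P phi));
  last by move=> A mA _; exact: Pmu.
rewrite integral_pushforward//; first exact/measurable_EFinP.
apply: (@bounded_integrable _ _ _ P _ M) => [|x]; last exact: bh.
exact: measurableT_comp.
Qed.

Lemma Rintegral_indic P A : measurable A -> \int[P]_x \1_A x = fine (P A).
Proof. by move=> mA; rewrite /Rintegral integral_indic// setIT. Qed.

Lemma mixture_probability P P' (s : R) : 0 <= s <= 1 ->
  exists Q, forall A, measurable A -> Q A = ((1 - s)%:E * P A + s%:E * P' A)%E.
Proof.
move=> /andP[s0 s1]; have s1' : 0 <= 1 - s by rewrite subr_ge0.
pose m := measure_add (mscale (NngNum s1') P) (mscale (NngNum s0) P').
have m1 : m setT = 1%E.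
  transitivity ((1 - s)%:E * P setT + s%:E * P' setT)%E; first by rewrite /m measure_addE.
  by rewrite !probability_setT !mule1 -EFinD subrK.
have [Q hQ] := probability_of_measure m1.
by exists Q => A mA; rewrite hQ; exact: measure_addE.
Qed.

(** Additivity in the measure is applied to the nonnegative function f + M; the shift cancels since
    all three measures have mass 1 and the weights add up to 1. *)
Lemma Rintegral_mixture P P' Q (s : R) (f : T -> R) (M : R) : 0 <= s <= 1 ->
  (forall A, measurable A -> Q A = ((1 - s)%:E * P A + s%:E * P' A)%E) ->
  measurable_fun setT f -> (forall x, `|f x| <= M) ->
  \int[Q]_x f x = (1 - s) * \int[P]_x f x + s * \int[P']_x f x.
Proof.
move=> /andP[s0 s1] hQ mf bf; have s1' : 0 <= 1 - s by rewrite subr_ge0.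
have bg x : 0 <= f x + M by have := bf x; rewrite ler_norml => /andP[h _]; rewrite -lerBlDr sub0r.
have mg : measurable_fun setT (fun x => f x + M) by exact: measurable_funD.
have bg' x : `|f x + M| <= M + M.
  by rewrite ger0_norm// lerD2r; have := bf x; rewrite ler_norml => /andP[].
have shift (P0 : probability T R) : \int[P0]_x (f x + M) = \int[P0]_x f x + M.
  rewrite RintegralD//; last 2 first.
  - exact: bounded_integrable bf.
  - by apply: (@bounded_integrable _ _ _ P0 _ `|M|).
  rewrite Rintegral_cst//= (_ : P0 _ = 1%E) ?mulr1//.
  exact: probability_setT.
have : \int[Q]_x (f x + M) = (1 - s) * \int[P]_x (f x + M) + s * \int[P']_x (f x + M).
  apply: EFin_inj; rewrite EFinD !EFinM !(Rintegral_fineK _ mg bg').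
  rewrite (@eq_measure_integral _ _ _ _
    (measure_add (mscale (NngNum s1') P) (mscale (NngNum s0) P'))) => [|A mA _]; last first.
    by apply: etrans (hQ A mA) _; exact/esym/measure_addE.
  have mge : measurable_fun setT (fun x => (f x + M)%:E) by exact/measurable_EFinP.
  rewrite ge0_integral_measure_add//; last by move=> x _; rewrite lee_fin.
  by rewrite !ge0_integral_mscale//; move=> x _; rewrite lee_fin.
rewrite !shift; move: (\int[Q]_x f x) (\int[P]_x f x) (\int[P']_x f x) => a b c h.
by rewrite -[LHS](addrK M) h; ring.
Qed.

End ProbabilityLimits.

(** * Marginals and energies of weak limits *)

Section Marginals.
Context {R : realType} {d : nat}.
Notation vdist := (fun v w : 'rV[R]_d => `|v - w|).

Lemma open_norm_le (O : set 'rV[R]_d) v : open O -> O v ->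
  exists2 e : R, 0 < e & forall w, `|v - w| <= e -> O w.
Proof.
move=> oO Ov; have : nbhs v O by exact: open_nbhs_nbhs.
rewrite -nbhs_ballE => -[e /= e0 h]; exists (e / 2); first by rewrite divr_gt0.
move=> w vw; apply: h; rewrite -ball_normE /ball_/=; apply: (le_lt_trans vw).
by rewrite ltr_pdivrMr// ltr_pMr// ltr1n.
Qed.

Lemma unif_norm_measurable (h : 'rV[R]_d -> R) : unif_for vdist h ->
  measurable_fun [set: euclidean R d] h.
Proof.
move=> uh; apply: (measurability _ (RGenOInfty.measurableE R)).
move=> _ [_ [c ->] <-]; rewrite setTI; apply: sub_sigma_algebra.
have openI (A : set 'rV[R]_d) : A `<=` A° -> open A by rewrite openE.
apply: openI => v /=; rewrite in_itv/= andbT -subr_gt0; set e := _ - c => e0.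
have [del del0 hd] := uh _ (divr_gt0 e0 (ltr0n R 2)).
rewrite /interior -nbhs_ballE; exists del => //= w.
rewrite -ball_normE /ball_/= => /ltW /hd; rewrite in_itv/= andbT ler_norml => /andP[_].
by move: e0; rewrite /e; move: (h v) (h w) => x y; lra.
Qed.

Section Evaluation.
Context {r K : {posnum R}}.
Notation Om := (Omega d r K).

Lemma measurable_eval_path t : measurable_fun setT (@eval_path R d r K t).
Proof.
apply: (@measurability _ _ Om (euclidean R d) setT _ (@open 'rV[R]_d)) => //.
move=> _ [V oV <-]; rewrite setTI; apply: path_openP => gamma /= Vg.
have [e e0 h] := open_norm_le oV Vg; exists e => // eta ge; apply: h.
exact: le_trans (udist_ge gamma eta t) ge.
Qed.

Lemma unif_eval_path (h : 'rV[R]_d -> R) t : unif_for vdist h ->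
  unif_for udist (fun gamma : Om => h (eval_path t gamma)).
Proof.
move=> uh e e0; have [del del0 hd] := uh e e0; exists del => // x y xy.
exact/hd/(le_trans (udist_ge x y t) xy).
Qed.

End Evaluation.

(** Openness brings the indicator within reach of [envelope], so integrals of uniformly continuous
    functions determine the masses of open sets. *)
Lemma indic_open_lsc (O : set 'rV[R]_d) v (e : R) : open O -> 0 < e ->
  exists2 del : R, 0 < del & forall w, `|v - w| <= del -> \1_O v - e <= \1_O w :> R.
Proof.
move=> oO e0; have [Ov|nOv] := pselect (O v).
  have [del del0 h] := open_norm_le oO Ov; exists del => // w /h Ow.
  by rewrite !indicE !mem_set// gerBl ltW.
exists 1 => // w _; rewrite !indicE (memNset nOv) sub0r.
by apply: (@le_trans _ _ 0); rewrite ?ler0n// oppr_le0 ltW.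
Qed.

Definition indic_env (O : set 'rV[R]_d) := envelope vdist (\1_O : 'rV[R]_d -> R).

Lemma indic_env_unif O n : unif_for vdist (indic_env O n).
Proof.
apply: envelope_unif => [v w|v w z|v|v w] //.
- exact: ler_distD.
- exact: distrC.
Qed.

Lemma indic_env_cvg O v : open O -> indic_env O n v @[n --> \oo] --> (\1_O v : R).
Proof.
move=> oO; apply: envelope_cvg => [x y|x|x|x e] //.
- by rewrite subrr normr0.
- exact: indic_open_lsc.
Qed.

Lemma indic_env_bounded O n v : `|indic_env O n v| <= 1.
Proof.
rewrite ger0_norm ?envelope_ge0//.
apply: (@le_trans _ _ (\1_O v)).
  by apply: envelope_le => // x; rewrite subrr normr0.
by rewrite indicE; case: (_ \in _).
Qed.

End Marginals.

Section UltraLimits.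
Context {R : realType} {d : nat} {r K : {posnum R}}.
Notation Om := (Omega d r K).
Context (U : set_system (probability Om R)) {UU : UltraFilter U}.
Variable Q : probability Om R.
Hypothesis UQ : forall H, unif_for udist H ->
  (fun P : probability Om R => \int[P]_x H x) @ U --> \int[Q]_x H x.

Lemma kinetic_norm (gamma : Om) : `|kinetic gamma| <= K%:num.
Proof. by rewrite ger0_norm ?kinetic_ge0 ?kinetic_le. Qed.

Lemma kinetic_env_le n (gamma : Om) : kinetic_env n gamma <= kinetic gamma.
Proof.
apply: envelope_le.
- exact: udist_ge0.
- exact: udistxx.
- exact: kinetic_ge0.
Qed.

Lemma kinetic_env_norm n (gamma : Om) : `|kinetic_env n gamma| <= K%:num.
Proof.
rewrite ger0_norm; first exact: le_trans (kinetic_env_le n gamma) (kinetic_le gamma).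
by apply: envelope_ge0; [exact: udist_ge0|exact: kinetic_ge0].
Qed.

(** Each envelope is a test function below the energy, so the bound survives along [U] with the
    envelope in place of the energy, using a >= 0. Dominated convergence under [Q] then restores the
    energy. *)
Lemma kinetic_ultra_le (a c : R) (H : Om -> R) : 0 <= a -> unif_for udist H ->
  U [set P | a * \int[P]_x kinetic x + \int[P]_x H x <= c] ->
  a * \int[Q]_x kinetic x + \int[Q]_x H x <= c.
Proof.
move=> a0 uH Uc.
have le_n n : a * \int[Q]_x kinetic_env n x + \int[Q]_x H x <= c.
  have cv : (fun P : probability Om R => a * \int[P]_x kinetic_env n x + \int[P]_x H x) @ U
      --> a * \int[Q]_x kinetic_env n x + \int[Q]_x H x.
    apply: cvgD; last exact: UQ.
    by apply: cvgM; [exact: cvg_cst|exact/UQ/kinetic_env_unif].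
  rewrite -(cvg_lim _ cv)//; apply: limr_le; first by apply/cvg_ex; eexists; exact: cv.
  apply: filterS Uc => P /=; apply: le_trans; rewrite lerD2r ler_wpM2l//.
  apply: le_Rintegral => //.
  - apply: bounded_integrable (kinetic_env_norm n).
    exact: unif_path_measurable (kinetic_env_unif n).
  - exact: bounded_integrable kinetic_measurable kinetic_norm.
  - by move=> x _; exact: kinetic_env_le.
have cv : a * \int[Q]_x kinetic_env n x + \int[Q]_x H x @[n --> \oo] -->
    a * \int[Q]_x kinetic x + \int[Q]_x H x.
  apply: cvgD; last exact: cvg_cst.
  apply: cvgM; first exact: cvg_cst.
  apply: (@Rintegral_bounded_cvg _ _ _ _ _ _ K%:num).
  - by move=> n; exact: unif_path_measurable (kinetic_env_unif n).
  - exact: kinetic_env_norm.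
  - exact: kinetic_env_cvg.
rewrite -(cvg_lim _ cv)//; apply: limr_le; first by apply/cvg_ex; eexists; exact: cv.
exact: nearW.
Qed.

(** The two measures agree on open sets, tested through envelopes of indicators; open sets are
    stable under intersection and generate the Borel sets. *)
Lemma marginal_ultra t (mu : probability (euclidean R d) R) :
  U [set P | forall A, measurable A -> pushforward P (eval_path t) A = mu A] ->
  forall A, measurable A -> pushforward Q (eval_path t) A = mu A.
Proof.
move=> Umu.
have opens (O : set 'rV[R]_d) : open O -> pushforward Q (eval_path t) O = mu O.
  move=> oO.
  (* The integral is constant on a member of [U], so its limit is that constant. *)
  have eq_n n : \int[Q]_x indic_env O n (eval_path t x) = \int[mu]_y indic_env O n y.
    have := UQ (unif_eval_path t (indic_env_unif O n)).
    move/cvg_lim => <- //; apply: lim_near_cst => //.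
    apply: filterS Umu => P Pmu; apply: Rintegral_pushforward Pmu _ _.
    - exact: measurable_eval_path.
    - exact: unif_norm_measurable (indic_env_unif O n).
    - exact: indic_env_bounded.
  have mO : measurable (O : set (euclidean R d)) by exact: sub_sigma_algebra.
  have e1 : \int[Q]_x \1_O (eval_path t x) = \int[mu]_y \1_O y :> R.
    have c1 : \int[Q]_x indic_env O n (eval_path t x) @[n --> \oo] -->
        \int[Q]_x \1_O (eval_path t x).
      apply: (@Rintegral_bounded_cvg _ _ _ _ _ _ 1) => [n|n x|x].
      - apply: unif_path_measurable; exact: unif_eval_path (indic_env_unif O n).
      - exact: indic_env_bounded.
      - exact: indic_env_cvg.
    have c2 : \int[mu]_y indic_env O n y @[n --> \oo] --> \int[mu]_y \1_O y.
      apply: (@Rintegral_bounded_cvg _ _ _ _ _ _ 1) => [n|n x|x].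
      - exact: unif_norm_measurable (indic_env_unif O n).
      - exact: indic_env_bounded.
      - exact: indic_env_cvg.
    rewrite (funext eq_n) in c1.
    by rewrite -(cvg_lim _ c1)// (cvg_lim _ c2).
  have mQO : measurable (eval_path t @^-1` O : set Om).
    by rewrite -[X in measurable X]setTI; exact: measurable_eval_path.
  rewrite /pushforward -[LHS]fineK; last exact: fin_num_measure.
  rewrite -[RHS]fineK; last exact: fin_num_measure.
  congr EFin.
  by rewrite -(Rintegral_indic Q mQO) -(Rintegral_indic mu mO) -e1; congr Rintegral.
pose nu0 : {measure set (euclidean R d) -> \bar R} := pushforward Q (eval_path t).
pose nu := nu0 (measurable_eval_path t).
have oI : setI_closed (@open 'rV[R]_d) by move=> V W; exact: openI.
have cov : \bigcup_(k : nat) (setT : set (euclidean R d)) = setT.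
  by apply/seteqP; split=> // x _; exists 0%N.
have nuT (k : nat) : (nu setT < +oo)%E.
  by rewrite (_ : nu setT = 1%E) ?ltry//; exact: (probability_setT Q).
have gen : (measurable : set (set (euclidean R d))) = <<s @open 'rV[R]_d >> by [].
move=> A; exact: (@measure_unique _ R (euclidean R d) (@open 'rV[R]_d) (fun=> setT) gen oI
  (fun=> openT) cov nu mu opens nuT A).
Qed.

Lemma Pi_path_ultra mu nu : U (Pi_path r K mu nu) -> Pi_path r K mu nu Q.
Proof.
by move=> h; split; apply: marginal_ultra; apply: filterS h => P [].
Qed.

End UltraLimits.

Lemma fine_probT {R : realType} {dT} {T : measurableType dT} (P : probability T R) :
  fine (P setT) = 1.
Proof. by rewrite (_ : P setT = 1%E)//; exact: probability_setT. Qed.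

Lemma cst_integrable {R : realType} {dT} {T : measurableType dT} (P : probability T R) (c : R) :
  P.-integrable setT (EFin \o cst c).
Proof. by apply: (@bounded_integrable _ _ _ P _ `|c|). Qed.

Lemma Rintegral_norm_le {R : realType} {dT} {T : measurableType dT} (P : probability T R)
    (f : T -> R) (M : R) : measurable_fun setT f -> (forall x, `|f x| <= M) ->
  `|\int[P]_x f x| <= M.
Proof.
move=> mf bf; have := @Rintegral_dist_le _ _ _ P f (cst 0) M 0 M mf.
rewrite Rintegral_cst// mul0r subr0; apply=> // [x|x]; first by rewrite normr0.
by rewrite subr0.
Qed.

(** * The game *)

Section FubiniBounded.
Context {R : realType} {d1 d2 : measure_display}.
Context {T1 : measurableType d1} {T2 : measurableType d2}.
Variables (P1 : probability T1 R) (P2 : probability T2 R).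
Variables (f : T1 * T2 -> R) (M : R).
Hypotheses (mf : measurable_fun setT f) (bf : forall z, `|f z| <= M).

Lemma prod_integrable : (P1 \x P2)%E.-integrable setT (EFin \o f).
Proof.
apply: measurable_bounded_integrable => //.
  rewrite [ltLHS](_ : _ = (P1 setT * P2 setT)%E).
    rewrite (_ : P1 setT = 1%E); last exact: probability_setT.
    by rewrite (_ : P2 setT = 1%E) ?mule1 ?ltry//; exact: probability_setT.
  by rewrite -setXTT; exact: product_measure1E.
by exists M; split; rewrite ?num_real// => N MN x _; apply: le_trans (bf x) (ltW MN).
Qed.

Lemma Rintegral_prod12 :
  \int[(P1 \x P2)%E]_z f z = \int[P1]_x \int[P2]_y f (x, y).
Proof.
rewrite [LHS]/Rintegral -integral12_prod_meas1; last exact: prod_integrable.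
rewrite [RHS]/Rintegral; congr fine; apply: eq_integral => x _.
rewrite (@Rintegral_fineK _ _ _ P2 _ M)//.
exact: measurableT_comp mf (measurable_pair1 x).
Qed.

Lemma Rintegral_prod21 :
  \int[(P1 \x P2)%E]_z f z = \int[P2]_y \int[P1]_x f (x, y).
Proof.
rewrite [LHS]/Rintegral -integral21_prod_meas1; last exact: prod_integrable.
rewrite [RHS]/Rintegral; congr fine; apply: eq_integral => y _.
rewrite (@Rintegral_fineK _ _ _ P1 _ M)//.
exact: measurableT_comp mf (measurable_pair2 y).
Qed.

End FubiniBounded.

(** * The interaction term *)

Section SquaredDistance.
Context {R : realType} {d : nat}.
Notation mu := (@lebesgue_measure R).

Definition sqdist {r K L : {posnum R}} (gamma : Omega d r K) (xi : Omega d r L) : R :=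
  \int[mu]_(t in `[0, 1]) enorm (val gamma t - val xi t) ^+ 2.

Lemma enorm_sqB_le (u v w : 'rV[R]_d) (r : R) : `|u| <= r -> `|v| <= r -> `|w| <= r ->
  `|enorm (u - w) ^+ 2 - enorm (v - w) ^+ 2| <= d%:R * (4 * r) * `|u - v|.
Proof.
move=> ur vr wr; have r0 : 0 <= r by apply: le_trans ur.
rewrite !enorm_sq -sumrB; apply: (le_trans (ler_norm_sum _ _ _)).
apply: (@le_trans _ _ (\sum_(i < d) 4 * r * `|u - v|)); last first.
  by rewrite sumr_const card_ord -[leLHS]mulr_natl mulrA.
apply: ler_sum => i _; rewrite !mxE.
rewrite (_ : _ ^+ 2 - _ = (u ord0 i + v ord0 i - (w ord0 i + w ord0 i)) * (u - v) ord0 i).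
  rewrite normrM ler_pM ?coord_le_norm//.
  have cl (z : 'rV[R]_d) : `|z| <= r -> `|z ord0 i| <= r.
    exact: le_trans (coord_le_norm z i).
  apply: (le_trans (ler_normB _ _)).
  rewrite (_ : 4 * r = r + r + (r + r)); last by ring.
  by rewrite lerD//; apply: (le_trans (ler_normD _ _)); rewrite lerD// cl.
by rewrite !mxE; ring.
Qed.

Section TwoPaths.
Context {r K L : {posnum R}}.
Implicit Types (gamma eta : Omega d r K) (xi : Omega d r L).

Lemma sqdistC gamma xi : sqdist gamma xi = sqdist xi gamma.
Proof.
apply: eq_Rintegral => t _; rewrite !enorm_sq; apply: eq_bigr => i _.
by rewrite !mxE -sqrrN opprB.
Qed.

Lemma sqdist_int01 gamma xi : int01 (fun t => enorm (val gamma t - val xi t) ^+ 2).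
Proof.
apply: sqint_integrable; apply: (@sqint_bounded _ _ (d%:R * (r%:num + r%:num) ^+ 2)).
  apply: measurable_enorm_sq => i.
  rewrite (_ : (fun t => _) = (fun t => val gamma t ord0 i - val xi t ord0 i)).
    have sq K' (g : Omega d r K') : sqint (fun t => val g t ord0 i).
      by apply: within_sqint; apply: within_coord; exact: path_continuous.
    exact: (sqintB (sq _ gamma) (sq _ xi)).1.
  by apply/funext => t; rewrite !mxE.
move=> t _; rewrite ger0_norm ?sqr_ge0//; apply: (le_trans (enorm_sq_le _)).
rewrite ler_wpM2l// ler_sqr ?nnegrE ?addr_ge0//.
by apply: (le_trans (ler_normB _ _)); rewrite lerD// path_norm.
Qed.

Lemma sqdist_lipschitz gamma eta xi :
  `|sqdist gamma xi - sqdist eta xi| <= d%:R * (4 * r%:num) * udist gamma eta.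
Proof.
have C0 : 0 <= d%:R * (4 * r%:num) * udist gamma eta.
  by rewrite !mulr_ge0// udist_ge0.
have ig := sqdist_int01 gamma xi; have ie := sqdist_int01 eta xi.
rewrite /sqdist -RintegralB//.
apply: (le_trans (le_normr_Rintegral _ _)) => //.
  by have := int01D ig (int01Z (-1) ie); apply: eq_integrable => // t _ /=; rewrite mulN1r.
apply: (@le_trans _ _ (\int[mu]_(t in `[0, 1]) (d%:R * (4 * r%:num) * udist gamma eta))).
  apply: int01_le.
  - have := int01D ig (int01Z (-1) ie) => /integrable_norm.
    by apply: eq_integrable => // t _ /=; rewrite mulN1r.
  - exact/sqint_integrable/sqint_cst.
  - move=> t _; have := enorm_sqB_le (path_norm gamma t) (path_norm eta t) (path_norm xi t).
    move/le_trans; apply.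
    by rewrite ler_wpM2l ?udist_ge// !mulr_ge0.
by rewrite Rintegral_cst// -[X in fine X]/(mu `[0, 1]%classic) measure_01 mulr1.
Qed.

End TwoPaths.

Lemma sqdist_bounded {r K L : {posnum R}} (gamma : Omega d r K) (xi : Omega d r L) :
  `|sqdist gamma xi| <= d%:R * (r%:num + r%:num) ^+ 2.
Proof.
have ig := sqdist_int01 gamma xi.
rewrite ger0_norm; last by apply: Rintegral_ge0 => t _; exact: sqr_ge0.
apply: (@le_trans _ _ (\int[mu]_(t in `[0, 1]) (d%:R * (r%:num + r%:num) ^+ 2))).
  apply: int01_le => // [|t _]; first exact/sqint_integrable/sqint_cst.
  apply: (le_trans (enorm_sq_le _)).
  rewrite ler_wpM2l// ler_sqr ?nnegrE ?addr_ge0//.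
  by apply: (le_trans (ler_normB _ _)); rewrite lerD// path_norm.
by rewrite Rintegral_cst// -[X in fine X]/(mu `[0, 1]%classic) measure_01 mulr1.
Qed.

End SquaredDistance.


(** * Splitting of the payoff *)

Section GameValue.
Context {R : realType} {d : nat} {r K L : {posnum R}} (alpha : R).
Notation mu := (@lebesgue_measure R).
Notation Om1 := (Omega d r K).
Notation Om2 := (Omega d r L).

Lemma Rint01_combination (f g h : R -> R) (a b : R) : int01 f -> int01 g -> int01 h ->
  \int[mu]_(t in `[0, 1]) (b * f t - b * g t + a * h t) =
  b * \int[mu]_(t in `[0, 1]) f t +
  (a * \int[mu]_(t in `[0, 1]) h t - b * \int[mu]_(t in `[0, 1]) g t).
Proof.
move=> If Ig Ih; have Ibf := int01Z b If; have Ibg := int01Z b Ig.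
have Ifg : int01 (fun t => b * f t - b * g t).
  by have := int01D Ibf (int01Z (-1) Ibg); apply: eq_integrable => // t _ /=; rewrite mulN1r.
rewrite RintegralD//; last exact: int01Z.
by rewrite RintegralB// !RintegralZl//; ring.
Qed.

Lemma cost_split (gamma : Om1) (xi : Om2) : cost alpha gamma xi =
  2^-1 * kinetic gamma + (alpha * sqdist gamma xi - 2^-1 * kinetic xi).
Proof.
exact: Rint01_combination (path_velocity gamma).1.2 (path_velocity xi).1.2 (sqdist_int01 gamma xi).
Qed.

(* A Caratheodory function: continuous in the first variable, measurable in
   the second one. *)
Lemma measurable_sqdist : measurable_fun setT (fun z : Om1 * Om2 => sqdist z.1 z.2).
Proof.
(* Rounding the first path to the representative of its cell reduces preimages to countable unions
   of products. *)
pose F n (z : Om1 * Om2) := sqdist (rep path_test (pre path_test n z.1) : Om1) z.2.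
have uH (xi : Om2) : unif_for udist (fun gamma : Om1 => sqdist gamma xi).
  exact: lipschitz_unif (fun gamma eta => sqdist_lipschitz gamma eta xi).
apply: (@measurable_fun_cvg _ _ _ _ F) => [n|z _]; last first.
  exact: (unif_rep_cvg path_test_small (uH z.2)).
move=> _ B mB; rewrite setTI.
rewrite (_ : F n @^-1` B = \bigcup_w ([set gamma : Om1 | pre path_test n gamma = w] `*`
    ((fun xi : Om2 => sqdist (rep path_test w : Om1) xi) @^-1` B))).
  apply: countable_bigcupT_measurable => // w; apply: measurableX.
    have [<-|nw] := eqVneq (size w) n; first exact: measurable_pre measurable_path_test _.
    rewrite (_ : mkset _ = set0)//; apply/seteqP; split=> x //= xw.
    by move: nw; rewrite -xw size_pre eqxx.
  have ux : unif_for udist (fun xi : Om2 => sqdist (rep path_test w : Om1) xi).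
    apply: (@lipschitz_unif _ _ _ _ _ (d%:R * (4 * r%:num))) => x y.
    by rewrite !(sqdistC (rep path_test w : Om1)); exact: sqdist_lipschitz.
  rewrite -[X in measurable X]setTI; exact: unif_path_measurable ux measurableT _ mB.
apply/seteqP; split=> [[x y] Bz|[x y] [w _ [/= <-]]] //.
by exists (pre path_test n x).
Qed.

Definition cost_bound : R :=
  2^-1 * K%:num + (`|alpha| * (d%:R * (r%:num + r%:num) ^+ 2) + 2^-1 * L%:num).

Lemma half_kinetic_norm {K' : {posnum R}} (gamma : Omega d r K') :
  `|2^-1 * kinetic gamma| <= 2^-1 * K'%:num.
Proof. by rewrite normrM ger0_norm ?invr_ge0// ler_wpM2l ?invr_ge0// kinetic_norm. Qed.

Lemma payoff_norm (gamma : Om1) (xi : Om2) : `|alpha * sqdist gamma xi - 2^-1 * kinetic xi| <=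
  `|alpha| * (d%:R * (r%:num + r%:num) ^+ 2) + 2^-1 * L%:num.
Proof.
apply: (le_trans (ler_normB _ _)); rewrite lerD ?half_kinetic_norm// normrM.
by rewrite ler_wpM2l// sqdist_bounded.
Qed.

Lemma cost_norm (gamma : Om1) (xi : Om2) : `|cost alpha gamma xi| <= cost_bound.
Proof.
rewrite cost_split; apply: (le_trans (ler_normD _ _)).
by rewrite lerD ?half_kinetic_norm ?payoff_norm.
Qed.

Lemma measurable_half_kinetic {K' : {posnum R}} :
  measurable_fun setT (fun gamma : Omega d r K' => 2^-1 * kinetic gamma).
Proof. by apply: measurable_funM => //; exact: kinetic_measurable. Qed.

Lemma measurable_cost : measurable_fun setT (fun z : Om1 * Om2 => cost alpha z.1 z.2).
Proof.
rewrite (_ : (fun z => _) = (fun z : Om1 * Om2 => 2^-1 * kinetic z.1 +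
    (alpha * sqdist z.1 z.2 - 2^-1 * kinetic z.2))); last first.
  by apply/funext => z; exact: cost_split.
apply: measurable_funD.
  exact: measurableT_comp measurable_half_kinetic measurable_fst.
apply: measurable_funB.
  by apply: measurable_funM => //; exact: measurable_sqdist.
exact: measurableT_comp measurable_half_kinetic measurable_snd.
Qed.

(** The mean cost of [gamma] against [P2], less half the energy of [gamma]. The energy of the
    opponent contributes a constant, so this is Lipschitz for the uniform distance and is a
    legitimate test function. *)
Definition payoff1 (P2 : probability Om2 R) (gamma : Om1) : R :=
  \int[P2]_xi (alpha * sqdist gamma xi - 2^-1 * kinetic xi).

Definition payoff2 (P1 : probability Om1 R) (xi : Om2) : R :=
  \int[P1]_gamma (2^-1 * kinetic gamma + alpha * sqdist gamma xi).

Lemma measurable_payoff (gamma : Om1) :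
  measurable_fun setT (fun xi : Om2 => alpha * sqdist gamma xi - 2^-1 * kinetic xi).
Proof.
apply: measurable_funB; last exact: measurable_half_kinetic.
apply: measurable_funM => //.
exact: measurableT_comp measurable_sqdist (measurable_pair1 gamma).
Qed.

Lemma measurable_payoff' (xi : Om2) :
  measurable_fun setT (fun gamma : Om1 => 2^-1 * kinetic gamma + alpha * sqdist gamma xi).
Proof.
apply: measurable_funD; first exact: measurable_half_kinetic.
apply: measurable_funM => //.
exact: measurableT_comp measurable_sqdist (measurable_pair2 xi).
Qed.

Lemma payoff'_norm (gamma : Om1) (xi : Om2) : `|2^-1 * kinetic gamma + alpha * sqdist gamma xi| <=
  2^-1 * K%:num + `|alpha| * (d%:R * (r%:num + r%:num) ^+ 2).
Proof.
apply: (le_trans (ler_normD _ _)); rewrite lerD ?half_kinetic_norm// normrM.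
by rewrite ler_wpM2l// sqdist_bounded.
Qed.

Lemma payoff1_unif P2 : unif_for udist (payoff1 P2).
Proof.
apply: (@lipschitz_unif _ _ _ _ _ (`|alpha| * (d%:R * (4 * r%:num)))) => x y; rewrite /payoff1.
apply: (Rintegral_dist_le P2 (measurable_payoff x) (measurable_payoff y)
  (payoff_norm x) (payoff_norm y)) => xi.
by rewrite opprB addrA subrK -mulrBr normrM -mulrA ler_wpM2l// sqdist_lipschitz.
Qed.

Lemma payoff2_unif P1 : unif_for udist (payoff2 P1).
Proof.
apply: (@lipschitz_unif _ _ _ _ _ (`|alpha| * (d%:R * (4 * r%:num)))) => x y; rewrite /payoff2.
apply: (Rintegral_dist_le P1 (measurable_payoff' x) (measurable_payoff' y)
  (fun g => payoff'_norm g x) (fun g => payoff'_norm g y)) => gamma.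
rewrite opprD addrACA subrr add0r -mulrBr normrM -mulrA ler_wpM2l//.
by rewrite !(sqdistC gamma) sqdist_lipschitz.
Qed.

Lemma payoff1_norm P2 gamma : `|payoff1 P2 gamma| <=
  `|alpha| * (d%:R * (r%:num + r%:num) ^+ 2) + 2^-1 * L%:num.
Proof. exact: Rintegral_norm_le _ (measurable_payoff gamma) (payoff_norm gamma). Qed.

Lemma payoff2_norm P1 xi : `|payoff2 P1 xi| <=
  2^-1 * K%:num + `|alpha| * (d%:R * (r%:num + r%:num) ^+ 2).
Proof. exact: Rintegral_norm_le _ (measurable_payoff' xi) (fun g => payoff'_norm g xi). Qed.

Lemma half_kinetic_integrable {K' : {posnum R}} (P : probability (Omega d r K') R) :
  P.-integrable setT (EFin \o (fun gamma => 2^-1 * kinetic gamma)).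
Proof. exact: bounded_integrable measurable_half_kinetic half_kinetic_norm. Qed.

Lemma sigma0_inner1 P1 P2 :
  sigma0 alpha P1 P2 = \int[P1]_gamma (2^-1 * kinetic gamma + payoff1 P2 gamma).
Proof.
rewrite /sigma0 (@Rintegral_prod12 _ _ _ _ _ _ _ _ cost_bound); last 2 first.
- exact: measurable_cost.
- by move=> z; exact: cost_norm.
apply: eq_Rintegral => gamma _; under eq_Rintegral do rewrite cost_split /=.
have Ic := cst_integrable P2 (2^-1 * kinetic gamma).
have Ip := bounded_integrable P2 (measurable_payoff gamma) (payoff_norm gamma).
by rewrite RintegralD// Rintegral_cst// fine_probT mulr1.
Qed.

Lemma sigma0_inner2 P1 P2 :
  sigma0 alpha P1 P2 = \int[P2]_xi (payoff2 P1 xi - 2^-1 * kinetic xi).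
Proof.
rewrite /sigma0 (@Rintegral_prod21 _ _ _ _ _ _ _ _ cost_bound); last 2 first.
- exact: measurable_cost.
- by move=> z; exact: cost_norm.
apply: eq_Rintegral => xi _; under eq_Rintegral do rewrite cost_split /= addrA.
have Ic := cst_integrable P1 (2^-1 * kinetic xi).
have Ip := bounded_integrable P1 (measurable_payoff' xi) (fun g => payoff'_norm g xi).
by rewrite RintegralB// Rintegral_cst// fine_probT mulr1.
Qed.

Lemma sigma0_split1 P1 P2 :
  sigma0 alpha P1 P2 = 2^-1 * \int[P1]_gamma kinetic gamma + \int[P1]_gamma payoff1 P2 gamma.
Proof.
have Ik := half_kinetic_integrable P1.
have Ip := bounded_integrable P1 (unif_path_measurable (payoff1_unif P2)) (payoff1_norm P2).
rewrite sigma0_inner1 RintegralD// RintegralZl//.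
exact: bounded_integrable kinetic_measurable kinetic_norm.
Qed.

(** Written as the opposite of a sum of the form treated by [kinetic_ultra_le], so that the
    maximiser's upper semicontinuity is the minimiser's lower semicontinuity after a change of
    sign. *)
Lemma sigma0_split2 P1 P2 :
  sigma0 alpha P1 P2 = - (2^-1 * \int[P2]_xi kinetic xi + \int[P2]_xi (- payoff2 P1 xi)).
Proof.
have ip : P2.-integrable setT (EFin \o payoff2 P1).
  exact: bounded_integrable (unif_path_measurable (payoff2_unif P1)) (payoff2_norm P1).
rewrite sigma0_inner2 RintegralB//; last exact: half_kinetic_integrable.
rewrite RintegralZl//; last exact: bounded_integrable kinetic_measurable kinetic_norm.
have -> : \int[P2]_xi (- payoff2 P1 xi) = - \int[P2]_xi payoff2 P1 xi.
  by under eq_Rintegral do rewrite -mulN1r; rewrite RintegralZl// mulN1r.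
by rewrite opprD opprK addrC.
Qed.

Lemma inner1_measurable P2 :
  measurable_fun setT (fun gamma : Om1 => 2^-1 * kinetic gamma + payoff1 P2 gamma).
Proof.
by apply: measurable_funD; [exact: measurable_half_kinetic|
  exact: unif_path_measurable (payoff1_unif P2)].
Qed.

Lemma inner1_norm P2 (gamma : Om1) : `|2^-1 * kinetic gamma + payoff1 P2 gamma| <= cost_bound.
Proof.
by apply: (le_trans (ler_normD _ _)); rewrite lerD ?half_kinetic_norm ?payoff1_norm.
Qed.

Lemma inner2_measurable P1 :
  measurable_fun setT (fun xi : Om2 => payoff2 P1 xi - 2^-1 * kinetic xi).
Proof.
by apply: measurable_funB; [exact: unif_path_measurable (payoff2_unif P1)|
  exact: measurable_half_kinetic].
Qed.

Lemma inner2_norm P1 (xi : Om2) : `|payoff2 P1 xi - 2^-1 * kinetic xi| <= cost_bound.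
Proof.
apply: (le_trans (ler_normB _ _)).
by rewrite /cost_bound addrA lerD ?half_kinetic_norm ?payoff2_norm.
Qed.

Lemma sigma0_norm (P1 : probability Om1 R) (P2 : probability Om2 R) :
  `|sigma0 alpha P1 P2| <= cost_bound.
Proof.
by rewrite sigma0_inner1; exact: Rintegral_norm_le _ (inner1_measurable P2) (inner1_norm P2).
Qed.

Lemma sigma0_mix1 (P1 P1' Q : probability Om1 R) (P2 : probability Om2 R) (s : R) : 0 <= s <= 1 ->
  (forall A, measurable A -> Q A = ((1 - s)%:E * P1 A + s%:E * P1' A)%E) ->
  sigma0 alpha Q P2 = (1 - s) * sigma0 alpha P1 P2 + s * sigma0 alpha P1' P2.
Proof.
move=> s01 hQ; rewrite !sigma0_inner1.
exact: (Rintegral_mixture s01 hQ (inner1_measurable P2) (inner1_norm P2)).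
Qed.

Lemma sigma0_mix2 (P1 : probability Om1 R) (P2 P2' Q : probability Om2 R) (s : R) : 0 <= s <= 1 ->
  (forall A, measurable A -> Q A = ((1 - s)%:E * P2 A + s%:E * P2' A)%E) ->
  sigma0 alpha P1 Q = (1 - s) * sigma0 alpha P1 P2 + s * sigma0 alpha P1 P2'.
Proof.
move=> s01 hQ; rewrite !sigma0_inner2.
exact: (Rintegral_mixture s01 hQ (inner2_measurable P1) (inner2_norm P1)).
Qed.

End GameValue.

Lemma Pi_path_mixture {R : realType} {d : nat} {r K : {posnum R}}
    (mu nu : probability (euclidean R d) R) (P P' Q : probability (Omega d r K) R) (s : R) :
  (forall A, measurable A -> Q A = ((1 - s)%:E * P A + s%:E * P' A)%E) ->
  Pi_path r K mu nu P -> Pi_path r K mu nu P' -> Pi_path r K mu nu Q.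
Proof.
move=> hQ [Pmu Pnu] [P'mu P'nu].
have mix t (m : probability (euclidean R d) R) :
    (forall A, measurable A -> pushforward P (eval_path t) A = m A) ->
    (forall A, measurable A -> pushforward P' (eval_path t) A = m A) ->
    forall A, measurable A -> pushforward Q (eval_path t) A = m A.
  move=> h h' A mA.
  have mE : measurable (eval_path t @^-1` A : set (Omega d r K)).
    by rewrite -[X in measurable X]setTI; exact: measurable_eval_path.
  rewrite [LHS](hQ _ mE); have := h A mA; have := h' A mA; rewrite /pushforward => -> ->.
  have mf : m A \is a fin_num by exact: fin_num_measure.
  by rewrite -(fineK mf) -!EFinM -EFinD -mulrDl subrK mul1r.
by split; exact: mix.
Qed.

(** * Passage to the limit in each player's own plan *)

Section Compactness.
Context {R : realType} {d : nat} {r K L : {posnum R}} (alpha : R).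
Notation Om1 := (Omega d r K).
Notation Om2 := (Omega d r L).

(** One limit [Q] serves all opponents, because [payoff1 P2] is a test function for every [P2]. *)
Lemma sigma0_compact1 mu nu (U : set_system (probability Om1 R)) : UltraFilter U ->
  U (Pi_path r K mu nu) -> exists2 Q, Pi_path r K mu nu Q &
    forall (P2 : probability Om2 R) c,
      U [set P | sigma0 alpha P P2 <= c] -> sigma0 alpha Q P2 <= c.
Proof.
move=> UU UPi; have [Q hQ] := path_compact UU; exists Q; first exact: Pi_path_ultra hQ _ _ UPi.
move=> P2 c Uc; rewrite sigma0_split1.
apply: (kinetic_ultra_le hQ) => //; first exact: payoff1_unif.
by apply: filterS Uc => P /=; rewrite sigma0_split1.
Qed.

Lemma sigma0_compact2 mu nu (U : set_system (probability Om2 R)) : UltraFilter U ->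
  U (Pi_path r L mu nu) -> exists2 Q, Pi_path r L mu nu Q &
    forall (P1 : probability Om1 R) c,
      U [set P | c <= sigma0 alpha P1 P] -> c <= sigma0 alpha P1 Q.
Proof.
move=> UU UPi; have [Q hQ] := path_compact UU; exists Q; first exact: Pi_path_ultra hQ _ _ UPi.
move=> P1 c Uc; rewrite sigma0_split2 lerNr.
apply: (kinetic_ultra_le hQ) => //; last first.
  by apply: filterS Uc => P /=; rewrite sigma0_split2 lerNr.
have u2 : unif_for udist (payoff2 alpha P1 : Om2 -> R) by exact: payoff2_unif.
by move=> e /u2[del del0 h]; exists del => // x y /h; rewrite -opprD normrN.
Qed.

End Compactness.

(** * Equilibrium and value of the game *)

Lemma NETP_minimax {R : realType} {T1 T2 : Type} (f : T1 -> T2 -> R) (A1 : set T1)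
    (A2 : set T2) p1 p2 : is_NETP f A1 A2 p1 p2 ->
  (f p1 p2)%:E = ereal_inf [set ereal_sup [set (f q1 q2)%:E | q2 in A2] | q1 in A1] /\
  (f p1 p2)%:E = ereal_sup [set ereal_inf [set (f q1 q2)%:E | q1 in A1] | q2 in A2].
Proof.
move=> [A1p A2p max2 min1]; split; apply/eqP; rewrite eq_le; apply/andP; split.
- apply: le_ereal_inf_tmp => _ [q1 Aq1 <-]; apply: (@le_trans _ _ (f q1 p2)%:E).
    by rewrite lee_fin min1.
  by apply: ereal_sup_ubound; exists p2.
- apply: ge_ereal_inf; eexists; first by exists p1.
  by apply: ge_ereal_sup => _ [q2 Aq2 <-]; rewrite lee_fin max2.
- apply: le_ereal_sup_tmp; eexists; first by exists p2.
  by apply: le_ereal_inf_tmp => _ [q1 Aq1 <-]; rewrite lee_fin min1.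
- apply: ge_ereal_sup => _ [q2 Aq2 <-]; apply: (@le_trans _ _ (f p1 q2)%:E).
    by apply: ereal_inf_lbound; exists p1.
  by rewrite lee_fin max2.
Qed.

(** Nonemptiness of both constraint sets is assumed: the bounds [K] and [L] may be too small for the
    prescribed marginals, and an empty set admits no equilibrium. *)
Theorem theorem1p2 (R : realType) (d : nat) (r K L : {posnum R})
    (alpha : R) (alpha_gt0 : 0 < alpha)
    (mu1 nu1 mu2 nu2 : probability (euclidean R d) R)
    (mu1X : mu1 (eball r%:num) = 1%E) (nu1X : nu1 (eball r%:num) = 1%E)
    (mu2Y : mu2 (eball r%:num) = 1%E) (nu2Y : nu2 (eball r%:num) = 1%E)
    (Pi1_neq0 : Pi_path r K mu1 nu1 !=set0)
    (Pi2_neq0 : Pi_path r L mu2 nu2 !=set0) :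
  let Pi1 := Pi_path r K mu1 nu1 in
  let Pi2 := Pi_path r L mu2 nu2 in
  exists (p1 : probability (Omega d r K) R) (p2 : probability (Omega d r L) R),
    [/\ is_NETP (sigma0 alpha) Pi1 Pi2 p1 p2,
        (sigma0 alpha p1 p2)%:E =
          ereal_inf [set ereal_sup [set (sigma0 alpha q1 q2)%:E | q2 in Pi2]
                    | q1 in Pi1] &
        (sigma0 alpha p1 p2)%:E =
          ereal_sup [set ereal_inf [set (sigma0 alpha q1 q2)%:E | q1 in Pi1]
                    | q2 in Pi2]].
Proof.
have mix1 : mixable1 (sigma0 alpha) (Pi_path r K mu1 nu1) (Pi_path r L mu2 nu2).
  move=> P P' s AP AP' s01; have [Q hQ] := mixture_probability P P' s01.
  by exists Q => [|P2 _]; [exact: Pi_path_mixture hQ AP AP'|exact: sigma0_mix1 s01 hQ].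
have mix2 : mixable2 (sigma0 alpha) (Pi_path r K mu1 nu1) (Pi_path r L mu2 nu2).
  move=> P P' s AP AP' s01; have [Q hQ] := mixture_probability P P' s01.
  by exists Q => [|P1 _]; [exact: Pi_path_mixture hQ AP AP'|exact: sigma0_mix2 s01 hQ].
have bd P1 P2 : Pi_path r K mu1 nu1 P1 -> Pi_path r L mu2 nu2 P2 ->
    `|sigma0 alpha P1 P2| <= @cost_bound R d r K L alpha.
  by move=> _ _; exact: sigma0_norm.
have [U UU UA|U UU UA|p1 [p2 NE]] := saddle_point Pi1_neq0 Pi2_neq0 mix1 mix2 bd.
- have [Q AQ hQ] := @sigma0_compact1 _ _ _ _ L alpha _ _ _ UU UA.
  by exists Q => // P2 c _; exact: hQ.
- have [Q AQ hQ] := @sigma0_compact2 _ _ _ K _ alpha _ _ _ UU UA.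
  by exists Q => // P1 c _; exact: hQ.
by move=> Pi1 Pi2; exists p1, p2; have [] := NETP_minimax NE.
Qed.
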